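(* Let $S_j$ be local potentials satisfying (A)–(E) and let $\omega\in\mathbb{Q}^d$. Then there exists a ghost circle $\Gamma_\omega\subset\overline{\mathcal{B}}_\omega$ for the $S_j$ that contains a global minimizer.
   Context: Notation: $\|i\|=\sum_{k=1}^d|i_k|$, $B_j^r=\{k:\|k-j\|\le r\}$, $(\tau_{k,l}x)_i=x_{i+k}+l$. Local potentials $S_j:\mathbb{R}^{\mathbb{Z}^d}\to\mathbb{R}$, $j\in\mathbb{Z}^d$, satisfy: (A) there is $r\in(0,\infty)$ and $C^2$ functions $s_j:\mathbb{R}^{B_j^r}\to\mathbb{R}$ with $S_j(x)=s_j(x|_{B_j^r})$; (B) $S_j(\tau_{k,l}x)=S_{j+k}(x)$; (C) each $S_j$ is bounded below and $S_j(x)\to\infty$ as $|x_k-x_j|\to\infty$ whenever $\|k-j\|=1$; (D) $\partial_{i,k}S_j\le0$ for $i\ne k$, and $\partial_{i,k}S_i<0$ when $\|i-k\|=1$; (E) $|\partial_{i,k}S_j|\le C$ uniformly. Birkhoff: $\tau_{k,l}x\ge x$ or $\tau_{k,l}x\le x$ (pointwise) for all $(k,l)$; rotation vector $\omega$: $\lim_nx_{ni}/n=\langle\omega,i\rangle$. $\overline{\mathcal{B}}_\omega$: Birkhoff configurations with rotation vector $\omega$ and $\tau_{k,l}x=x$ whenever $\langle\omega,k\rangle+l=0$. $\mathbb{X}=\{x:\sum_i2^{-\|i\|}|x_i|<\infty\}$; $(\nabla W(x))_i=\sum_{\|j-i\|\le r}\partial_iS_j(x)$; $\Psi_t$ the complete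 flow of $\dot x=-\nabla W(x)$ on $\mathbb{X}$. A ghost circle is a set $\Gamma\subset\mathbb{R}^{\mathbb{Z}^d}$ that is nonempty, closed and connected (pointwise topology), strictly ordered (for $x,y\in\Gamma$: $x\ll y$, $x=y$ or $y\ll x$, where $\ll$ means strict inequality in every coordinate), shift-invariant ($\tau_{k,l}\Gamma\subset\Gamma$), and satisfies $\Psi_t(\Gamma)=\Gamma$ for all $t\in\mathbb{R}$. Global minimizer: $W_B(x+y)\ge W_B(x)$ for every finite $B$ and every $y$ supported in $\mathring{B}^{(r)}=\{i\in B:B_i^r\subset B\}$, $W_B=\sum_{j\in B}S_j$. *)

(* Defs.v *)
From Stdlib Require Import Reals Lra ZArith QArith Qreals List Vector VectorEq.
Import ListNotations.
Open Scope R_scope.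

Definition Zd (d : nat) := Vector.t Z d.

Definition zadd {d} (u v : Zd d) : Zd d := Vector.map2 Z.add u v.
Definition zsub {d} (u v : Zd d) : Zd d := Vector.map2 Z.sub u v.
Definition zscal {d} (n : Z) (v : Zd d) : Zd d := Vector.map (Z.mul n) v.
Definition znorm {d} (v : Zd d) : Z :=
  List.fold_right (fun z acc => (Z.abs z + acc)%Z) 0%Z (Vector.to_list v).
Definition zeqb {d} (u v : Zd d) : bool := VectorEq.eqb Z Z.eqb u v.

Definition zrange (n : nat) : list Z :=
  List.map (fun m => (Z.of_nat m - Z.of_nat n)%Z) (List.seq 0 (2 * n + 1)).
Fixpoint box (d : nat) (n : nat) : list (Zd d) :=
  match d with
  | O => [Vector.nil Z]
  | S d' => List.flat_map (fun z => List.map (fun v => Vector.cons Z z d' v) (box d' n))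
                          (zrange n)
  end.

Definition Rsum (l : list R) : R := List.fold_right Rplus 0 l.

Definition config (d : nat) := Zd d -> R.

Definition tau {d} (k : Zd d) (l : Z) (x : config d) : config d :=
  fun i => x (zadd i k) + IZR l.

Definition bump {d} (x : config d) (i : Zd d) (h : R) : config d :=
  fun k => if zeqb k i then x k + h else x k.

Definition pw_continuous {d} (F : config d -> R) : Prop :=
  forall x eps, 0 < eps -> exists (L : list (Zd d)) delta, 0 < delta /\
    forall y, (forall i, List.In i L -> Rabs (y i - x i) < delta) -> Rabs (F y - F x) < eps.

Record LocalPotentials (d : nat) := {
  S : Zd d -> config d -> R;
  dS : Zd d -> Zd d -> config d -> R;
  ddS : Zd d -> Zd d -> Zd d -> config d -> R;
  rad : R;
  rad_pos : 0 < rad;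
  A_local : forall j x y, (forall k, IZR (znorm (zsub k j)) <= rad -> x k = y k) ->
              S j x = S j y;
  A_d1 : forall j i x, derivable_pt_lim (fun h => S j (bump x i h)) 0 (dS j i x);
  A_d2 : forall j i k x, derivable_pt_lim (fun h => dS j i (bump x k h)) 0 (ddS j i k x);
  A_cont0 : forall j, pw_continuous (S j);
  A_cont1 : forall j i, pw_continuous (dS j i);
  A_cont2 : forall j i k, pw_continuous (ddS j i k);
  B_inv : forall j k l x, S j (tau k l x) = S (zadd j k) x;
  C_below : forall j, exists m, forall x, m <= S j x;
  C_coerc : forall j k, znorm (zsub k j) = 1%Z ->
              forall M, exists R0, forall x, Rabs (x k - x j) > R0 -> S j x > M;
  D_twist : forall j i k x, i <> k -> ddS j i k x <= 0;
  D_strict : forall i k x, znorm (zsub i k) = 1%Z -> ddS i i k x < 0;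
  E_bound : exists C, forall j i k x, Rabs (ddS j i k x) <= C
}.

Arguments S {d}. Arguments dS {d}. Arguments ddS {d}. Arguments rad {d}.

Definition dotQ {d} (w : Vector.t Q d) (k : Zd d) : Q :=
  List.fold_right Qplus 0%Q
    (List.map (fun p => (fst p * inject_Z (snd p))%Q)
       (List.combine (Vector.to_list w) (Vector.to_list k))).

Definition Birkhoff {d} (x : config d) : Prop :=
  forall k l, (forall i, tau k l x i >= x i) \/ (forall i, tau k l x i <= x i).

Definition has_rotation_vector {d} (w : Vector.t Q d) (x : config d) : Prop :=
  forall i, Un_cv (fun n => x (zscal (Z.of_nat n) i) / INR n) (Q2R (dotQ w i)).

Definition Bbar {d} (w : Vector.t Q d) (x : config d) : Prop :=
  Birkhoff x /\ has_rotation_vector w x /\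
  forall k l, Qeq (dotQ w k + inject_Z l)%Q 0%Q -> forall i, tau k l x i = x i.

Definition wsum {d} (x : config d) (n : nat) : R :=
  Rsum (List.map (fun i => (/ 2) ^ (Z.to_nat (znorm i)) * Rabs (x i)) (box d n)).

(* sum_i 2^{-||i||} |x_i| < oo  (nonnegative terms: bounded partial sums) *)
Definition inX {d} (x : config d) : Prop := exists M, forall n, wsum x n <= M.

Definition gradW {d} (P : LocalPotentials d) (x : config d) (i : Zd d) : R :=
  Rsum (List.map (fun v => if Rle_dec (IZR (znorm v)) (rad P) then dS P (zadd i v) i x else 0)
          (box d (Z.to_nat (up (rad P))))).

Definition flow_line {d} (P : LocalPotentials d) (g : R -> config d) : Prop :=
  (forall t, inX (g t)) /\
  (forall t eps, 0 < eps -> exists delta, 0 < delta /\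
     forall s, Rabs (s - t) < delta -> forall n, wsum (fun i => g s i - g t i) n <= eps) /\
  (forall t i, derivable_pt_lim (fun s => g s i) t (- gradW P (g t) i)).

(* Psi_t(Gamma) = Gamma for all t (Psi the complete flow) *)
Definition flow_invariant {d} (P : LocalPotentials d) (G : config d -> Prop) : Prop :=
  forall x, G x ->
    (exists g, flow_line P g /\ g 0 = x) /\
    (forall g, flow_line P g -> g 0 = x -> forall t, G (g t)).

Definition pw_open {d} (U : config d -> Prop) : Prop :=
  forall x, U x -> exists (L : list (Zd d)) eps, 0 < eps /\
    forall y, (forall i, List.In i L -> Rabs (y i - x i) < eps) -> U y.

Definition pw_closed {d} (G : config d -> Prop) : Prop :=
  forall x, (forall (L : list (Zd d)) eps, 0 < eps ->
               exists y, G y /\ forall i, List.In i L -> Rabs (y i - x i) < eps) -> G x.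

Definition pw_connected {d} (G : config d -> Prop) : Prop :=
  forall U V, pw_open U -> pw_open V ->
    (forall x, G x -> U x \/ V x) ->
    (forall x, ~ (G x /\ U x /\ V x)) ->
    (forall x, ~ (G x /\ U x)) \/ (forall x, ~ (G x /\ V x)).

Definition strictly_ordered {d} (G : config d -> Prop) : Prop :=
  forall x y, G x -> G y -> (forall i, x i < y i) \/ x = y \/ (forall i, y i < x i).

Definition ghost_circle {d} (P : LocalPotentials d) (G : config d -> Prop) : Prop :=
  (exists x, G x) /\ pw_closed G /\ pw_connected G /\ strictly_ordered G /\
  (forall k l x, G x -> G (tau k l x)) /\ flow_invariant P G.

Definition WB {d} (P : LocalPotentials d) (B : list (Zd d)) (x : config d) : R :=
  Rsum (List.map (fun j => S P j x) B).

Definition global_minimizer {d} (P : LocalPotentials d) (x : config d) : Prop :=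
  forall (B : list (Zd d)) (y : config d), NoDup B ->
    (forall i, y i <> 0 -> List.In i B /\ forall k, IZR (znorm (zsub k i)) <= rad P -> List.In k B) ->
    WB P B (fun i => x i + y i) >= WB P B x.

(* Main.v *)
(** A configuration in the closure of the Birkhoff class of a rational [w] is
    determined by finitely many coordinates, so the gradient flow restricted to
    such configurations is finite dimensional; by the twist condition it is
    strongly order preserving. A minimizer [m] of the periodic action is
    comparable to all its translates, hence equal to those with the same mean
    height, i.e. to [tau k l m] with [<w,k> + l = 0]; the same applies on larger
    tori, which makes [m] a global minimizer. By Zorn's lemma take a maximal chain
    (for the pointwise order) containing [m] and invariant under translations and
    under the flow. It is closed, and it has no gap: the two ends of a gap would be equilibria
    [x <= y], and between two ordered equilibria there is always an ordered
    complete orbit, whose translates could be added to the chain. To find that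
    orbit, minimize the action on each slice [{x <= z <= y, sum z = s}]; at the
    minimizer the gradient has one sign, so its orbit is monotone. Either these
    orbits accumulate on a complete monotone orbit, or both ends attract and a
    mountain pass gives a third equilibrium. Without gaps, the chain is a
    Lipschitz image of the real line, hence connected. *)
Require Import Defs.
From Stdlib Require Import Reals Lra Lia ZArith QArith Qreals List FinFun.
From Stdlib Require Vector VectorEq.
From Stdlib Require Import Classical ClassicalEpsilon FunctionalExtensionality.
From Coquelicot Require Import Hierarchy RInt RInt_analysis Derive Continuity.
From mathcomp Require classical_sets.
Import ListNotations.
Open Scope R_scope.

(** The order arguments run in the sup norm, on configurations at bounded distance from the linear
    one, but a flow line is only continuous in the weighted norm of X. Invariance quantifies over
    all such lines, so uniqueness is proved in the weighted norm, and existence by a Picard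
    iteration in the sup norm. No critical point is assumed nondegenerate, so there is no unstable
    manifold to follow out of an equilibrium. Monotone orbits started ever closer to it replace one:
    each crosses the same level of [total], the time before the crossing tends to infinity by
    Lipschitz dependence on the initial point, and a limit of the orbits recentred at the crossing
    is complete and ordered. The height [total], a sum over one period, makes chains tractable:
    between ordered periodic configurations, the difference in height bounds the difference at every
    site. So suprema in a chain are uniform limits, and the height parametrises a gapless chain. An
    orbit may join the maximal chain only together with all its translates; a translation either
    fixes it or carries the gap off itself. *)

Notation lsum f l := (Rsum (List.map f l)).

Lemma Rabs_le_inv x a : Rabs x <= a -> - a <= x <= a.
Proof. unfold Rabs; destruct (Rcase_abs x); lra. Qed.

Lemma Rabs_minus_self x : Rabs (x - x) = 0.
Proof. unfold Rminus; rewrite Rplus_opp_r; apply Rabs_R0. Qed.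

Lemma choice_fun {A B : Type} (R : A -> B -> Prop) :
  (forall a, exists b, R a b) -> exists f, forall a, R a (f a).
Proof.
  intros H. exists (fun a => proj1_sig (constructive_indefinite_description _ (H a))).
  intros a. apply proj2_sig.
Qed.

(** * Finite sums over lists *)

Lemma lsum_ext {A} (f g : A -> R) l :
  (forall a, In a l -> f a = g a) -> lsum f l = lsum g l.
Proof.
  induction l as [|a l IH]; intros H; simpl; [reflexivity|].
  rewrite (H a (or_introl eq_refl)), IH; [reflexivity|].
  intros b Hb; apply H; now right.
Qed.

Lemma lsum_plus {A} (f g : A -> R) l : lsum (fun a => f a + g a) l = lsum f l + lsum g l.
Proof. induction l as [|a l IH]; simpl; [|rewrite IH]; ring. Qed.

Lemma lsum_minus {A} (f g : A -> R) l : lsum (fun a => f a - g a) l = lsum f l - lsum g l.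
Proof. induction l as [|a l IH]; simpl; [|rewrite IH]; ring. Qed.

Lemma lsum_scal {A} c (f : A -> R) l : lsum (fun a => c * f a) l = c * lsum f l.
Proof. induction l as [|a l IH]; simpl; [|rewrite IH]; ring. Qed.

Lemma lsum_const {A} c (l : list A) : lsum (fun _ => c) l = INR (length l) * c.
Proof.
  induction l as [|a l IH]; [simpl; ring|].
  change (length (a :: l)) with (Datatypes.S (length l)); rewrite S_INR.
  simpl; rewrite IH; ring.
Qed.

Lemma lsum_le {A} (f g : A -> R) l :
  (forall a, In a l -> f a <= g a) -> lsum f l <= lsum g l.
Proof.
  induction l as [|a l IH]; intros H; simpl; [lra|].
  apply Rplus_le_compat; [apply H; now left|apply IH; intros b Hb; apply H; now right].
Qed.

Lemma lsum_ge0 {A} (f : A -> R) l : (forall a, In a l -> 0 <= f a) -> 0 <= lsum f l.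
Proof.
  intros H; rewrite <- (Rmult_0_r (INR (length l))), <- lsum_const; now apply lsum_le.
Qed.

Lemma lsum_abs {A} (f : A -> R) l : Rabs (lsum f l) <= lsum (fun a => Rabs (f a)) l.
Proof.
  induction l as [|a l IH]; simpl; [rewrite Rabs_R0; lra|].
  eapply Rle_trans; [apply Rabs_triang|]; lra.
Qed.

Lemma lsum_app {A} (f : A -> R) l l' : lsum f (l ++ l') = lsum f l + lsum f l'.
Proof. induction l as [|a l IH]; simpl; [|rewrite IH]; ring. Qed.

Lemma lsum_map {A B} (f : B -> R) (h : A -> B) l : lsum f (List.map h l) = lsum (fun a => f (h a)) l.
Proof. rewrite List.map_map; reflexivity. Qed.

Lemma lsum_flat_map {A B} (f : B -> R) (h : A -> list B) l :
  lsum f (List.flat_map h l) = lsum (fun a => lsum f (h a)) l.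
Proof. induction l as [|a l IH]; simpl; [reflexivity|]. now rewrite lsum_app, IH. Qed.

Lemma lsum_exchange {A B} (f : A -> B -> R) l l' :
  lsum (fun a => lsum (f a) l') l = lsum (fun b => lsum (fun a => f a b) l) l'.
Proof.
  induction l as [|a l IH]; simpl.
  - symmetry; rewrite lsum_const; ring.
  - now rewrite IH, lsum_plus.
Qed.

Lemma lsum_mem_le {A} (f : A -> R) l a :
  (forall b, In b l -> 0 <= f b) -> In a l -> f a <= lsum f l.
Proof.
  intros H Ha; destruct (in_split _ _ Ha) as (l1 & l2 & ->).
  rewrite lsum_app; simpl.
  assert (0 <= lsum f l1) by (apply lsum_ge0; intros; apply H, in_or_app; now left).
  assert (0 <= lsum f l2) by (apply lsum_ge0; intros; apply H, in_or_app; right; now right).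
  lra.
Qed.

Lemma lsum_incl {A} (f : A -> R) l : forall l', NoDup l -> incl l l' ->
  (forall a, In a l' -> 0 <= f a) -> lsum f l <= lsum f l'.
Proof.
  induction l as [|a l IH]; intros l' Hn Hi H; simpl.
  - now apply lsum_ge0.
  - inversion Hn; subst.
    destruct (in_split a l' (Hi a (or_introl eq_refl))) as (l1 & l2 & ->).
    rewrite lsum_app; simpl.
    assert (lsum f l <= lsum f (l1 ++ l2)).
    { apply IH; auto.
      - intros b Hb. assert (In b (l1 ++ a :: l2)) by (apply Hi; now right).
        apply in_app_or in H0; apply in_or_app; destruct H0 as [|[<-|]]; tauto.
      - intros b Hb; apply H; apply in_app_or in Hb; apply in_or_app; simpl; tauto. }
    rewrite lsum_app in H0; lra.
Qed.

Lemma lsum_support {A} (f : A -> R) l : forall l', NoDup l -> NoDup l' -> incl l l' ->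
  (forall a, In a l' -> ~ In a l -> f a = 0) -> lsum f l = lsum f l'.
Proof.
  induction l as [|a l IH]; intros l' Hn Hn' Hi H; simpl.
  - rewrite (lsum_ext f (fun _ => 0)); [rewrite lsum_const; ring|]. intros; apply H; auto.
  - inversion Hn; subst.
    destruct (in_split a l' (Hi a (or_introl eq_refl))) as (l1 & l2 & ->).
    apply NoDup_remove in Hn' as (Hn' & Ha).
    rewrite lsum_app; simpl.
    assert (lsum f l = lsum f (l1 ++ l2)).
    { apply IH; auto.
      - intros b Hb. assert (In b (l1 ++ a :: l2)) by (apply Hi; now right).
        apply in_app_or in H0; apply in_or_app; destruct H0 as [|[<-|]]; tauto.
      - intros b Hb Hbl; apply H.
        + apply in_app_or in Hb; apply in_or_app; simpl; tauto.
        + intros [<-|]; tauto. }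
    rewrite lsum_app in H0; lra.
Qed.

Lemma list_bound {A} (Pr : A -> R -> Prop) l :
  (forall a r r', r <= r' -> Pr a r -> Pr a r') ->
  (forall a, In a l -> exists r, Pr a r) -> exists r, 0 < r /\ forall a, In a l -> Pr a r.
Proof.
  intros Hm; induction l as [|a l IH]; intros H.
  - exists 1; split; [lra|]; intros a [].
  - destruct IH as (r & Hr & IH); [intros b Hb; apply H; now right|].
    destruct (H a (or_introl eq_refl)) as (r' & Hr').
    exists (Rmax r r'); split; [eapply Rlt_le_trans; [exact Hr|apply Rmax_l]|].
    intros b [<-|Hb]; [eapply Hm; [apply Rmax_r|exact Hr']|eapply Hm; [apply Rmax_l|auto]].
Qed.

Lemma list_small {A} (Pr : A -> R -> Prop) l :
  (forall a r r', 0 < r' -> r' <= r -> Pr a r -> Pr a r') ->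
  (forall a, In a l -> exists r, 0 < r /\ Pr a r) ->
  exists r, 0 < r /\ forall a, In a l -> Pr a r.
Proof.
  intros Hm; induction l as [|a l IH]; intros H.
  - exists 1; split; [lra|]; intros a [].
  - destruct IH as (r & Hr & IH); [intros b Hb; apply H; now right|].
    destruct (H a (or_introl eq_refl)) as (r' & Hr' & Hp).
    assert (0 < Rmin r r') by (apply Rmin_pos; auto).
    exists (Rmin r r'); split; [auto|].
    intros b [<-|Hb]; [eapply Hm; [auto|apply Rmin_r|exact Hp]|eapply Hm; [auto|apply Rmin_l|auto]].
Qed.

(** * Lattice vectors *)

Definition zz {d} : Zd d := Vector.const 0%Z d.

Lemma vec_ext {d} (u v : Zd d) : (forall p, Vector.nth u p = Vector.nth v p) -> u = v.
Proof. intros H; apply Vector.eq_nth_iff; intros p ? <-; apply H. Qed.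

Lemma nth_zadd {d} (u v : Zd d) p : Vector.nth (zadd u v) p = (Vector.nth u p + Vector.nth v p)%Z.
Proof. now apply Vector.nth_map2. Qed.
Lemma nth_zsub {d} (u v : Zd d) p : Vector.nth (zsub u v) p = (Vector.nth u p - Vector.nth v p)%Z.
Proof. now apply Vector.nth_map2. Qed.
Lemma nth_zscal {d} n (u : Zd d) p : Vector.nth (zscal n u) p = (n * Vector.nth u p)%Z.
Proof. now apply Vector.nth_map. Qed.
Lemma zadd_cons {d} a b (u v : Zd d) :
  zadd (Vector.cons Z a d u) (Vector.cons Z b d v) = Vector.cons Z (a + b)%Z d (zadd u v).
Proof. reflexivity. Qed.
Lemma zsub_cons {d} a b (u v : Zd d) :
  zsub (Vector.cons Z a d u) (Vector.cons Z b d v) = Vector.cons Z (a - b)%Z d (zsub u v).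
Proof. reflexivity. Qed.
Lemma zscal_cons {d} n a (u : Zd d) : zscal n (Vector.cons Z a d u) = Vector.cons Z (n * a)%Z d (zscal n u).
Proof. reflexivity. Qed.
Lemma nth_zz {d} (p : Fin.t d) : Vector.nth zz p = 0%Z.
Proof. apply Vector.const_nth. Qed.

Ltac zvec_simpl := repeat (rewrite nth_zadd || rewrite nth_zsub || rewrite nth_zscal || rewrite nth_zz).
Ltac zvec := apply vec_ext; intros ?p; zvec_simpl; lia.

Lemma zeqb_eq {d} (u v : Zd d) : zeqb u v = true <-> u = v.
Proof. apply VectorEq.eqb_eq, Z.eqb_eq. Qed.

Lemma Zd_dec {d} (u v : Zd d) : {u = v} + {u <> v}.
Proof. apply (Vector.eq_dec Z Z.eqb Z.eqb_eq). Qed.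

Lemma znorm_cons {d} z (v : Zd d) : znorm (Vector.cons Z z d v) = (Z.abs z + znorm v)%Z.
Proof. unfold znorm; rewrite Vector.to_list_cons; reflexivity. Qed.

Lemma znorm_nil (v : Zd 0) : znorm v = 0%Z.
Proof. revert v; apply Vector.case0; reflexivity. Qed.

Lemma vec_eta {d} (v : Zd (Datatypes.S d)) : v = Vector.cons Z (Vector.hd v) d (Vector.tl v).
Proof. apply Vector.eta. Qed.

Lemma znorm_nonneg {d} (v : Zd d) : (0 <= znorm v)%Z.
Proof.
  induction v as [|z d v IH]; [rewrite znorm_nil; lia|]. rewrite znorm_cons; lia.
Qed.

Lemma znorm_triang {d} (u v : Zd d) : (znorm (zadd u v) <= znorm u + znorm v)%Z.
Proof.
  revert d u v. apply (Vector.rect2 (fun d u v => (znorm (zadd u v) <= znorm u + znorm v)%Z)).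
  - reflexivity.
  - intros n u v IH a b.
    rewrite zadd_cons, !znorm_cons; lia.
Qed.

Lemma znorm_scal {d} n (v : Zd d) : znorm (zscal n v) = (Z.abs n * znorm v)%Z.
Proof.
  induction v as [|z d v IH]; [unfold znorm; simpl; lia|].
  rewrite zscal_cons, !znorm_cons, IH, Z.abs_mul; ring.
Qed.

Lemma znorm_zz d : znorm (@zz d) = 0%Z.
Proof. replace (@zz d) with (zscal 0 (@zz d)) by zvec. rewrite znorm_scal; lia. Qed.

Lemma znorm_sub_sym {d} (u v : Zd d) : znorm (zsub u v) = znorm (zsub v u).
Proof. replace (zsub u v) with (zscal (-1) (zsub v u)) by zvec. rewrite znorm_scal; lia. Qed.

Lemma znorm_nth {d} (v : Zd d) p : (Z.abs (Vector.nth v p) <= znorm v)%Z.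
Proof.
  induction p as [d|d p IH]; rewrite (vec_eta v), znorm_cons; simpl.
  - pose proof (znorm_nonneg (Vector.tl v)); lia.
  - specialize (IH (Vector.tl v)); lia.
Qed.

Lemma znorm_0 {d} (v : Zd d) : znorm v = 0%Z -> v = zz.
Proof. intros H; apply vec_ext; intros p; rewrite nth_zz. pose proof (znorm_nth v p); lia. Qed.

Lemma znorm_descend {d} (v : Zd d) : (0 < znorm v)%Z ->
  exists u, znorm (zsub v u) = 1%Z /\ znorm u = (znorm v - 1)%Z.
Proof.
  induction v as [|z d v IH]; [rewrite znorm_nil; lia|]. rewrite znorm_cons; intros H.
  destruct (Z.eq_dec z 0) as [->|Hz].
  - destruct IH as (u & Hu & Hu'); [lia|]. exists (Vector.cons Z 0%Z d u).
    rewrite zsub_cons.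
    rewrite !znorm_cons; lia.
  - exists (Vector.cons Z (z - Z.sgn z)%Z d v).
    rewrite zsub_cons.
    rewrite !znorm_cons. replace (zsub v v) with (@zz d) by zvec. rewrite znorm_zz. lia.
Qed.

(** Every site is reached from [o] by unit steps. The property spread in this way is that two
    ordered configurations, or orbits, touch at a site; the strict twist condition passes it to
    neighbours. *)
Lemma lattice_connected {d} (Pr : Zd d -> Prop) (o : Zd d) :
  Pr o -> (forall i k, znorm (zsub i k) = 1%Z -> Pr i -> Pr k) -> forall i, Pr i.
Proof.
  intros H0 Hs.
  assert (forall n v, znorm v = Z.of_nat n -> Pr (zadd o v)) as H.
  { induction n as [|n IH]; intros v Hv.
    - rewrite (znorm_0 v Hv). replace (zadd o zz) with o by zvec. auto.
    - destruct (znorm_descend v) as (u & Hu & Hu'); [lia|].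
      apply (Hs (zadd o u)); [|apply IH; lia].
      rewrite znorm_sub_sym. replace (zsub (zadd o v) (zadd o u)) with (zsub v u) by zvec. auto. }
  intros i. replace i with (zadd o (zsub i o)) by zvec.
  apply (H (Z.to_nat (znorm (zsub i o)))). pose proof (znorm_nonneg (zsub i o)); lia.
Qed.

(** Arbitrary coordinate values let the centred [box] and the fundamental domain [tbox] share their
    lemmas. *)
Fixpoint grid (d : nat) (zs : list Z) : list (Zd d) :=
  match d with
  | O => [Vector.nil Z]
  | Datatypes.S d' => List.flat_map (fun z => List.map (fun v => Vector.cons Z z d' v) (grid d' zs)) zs
  end.

Lemma box_grid d n : box d n = grid d (zrange n).
Proof. induction d as [|d IH]; simpl; [reflexivity|]. now rewrite IH. Qed.

Lemma In_grid {d} zs (v : Zd d) : In v (grid d zs) <-> forall p, In (Vector.nth v p) zs.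
Proof.
  induction d as [|d IH].
  - split; [intros _ p; inversion p|]. intros _; left. symmetry; revert v; apply Vector.case0; reflexivity.
  - simpl; rewrite in_flat_map; split.
    + intros (z & Hz & Hv). apply in_map_iff in Hv as (u & <- & Hu). intros p.
      apply (Fin.caseS' p); [exact Hz|]. intros p'; simpl. now apply IH.
    + intros H. exists (Vector.hd v); rewrite (vec_eta v) in H |- *; split; [apply (H Fin.F1)|].
      simpl. apply in_map, IH. intros p; apply (H (Fin.FS p)).
Qed.

Lemma NoDup_flat_cons {d} (l : list (Zd d)) zs : NoDup l -> NoDup zs ->
  NoDup (List.flat_map (fun z => List.map (fun v => Vector.cons Z z d v) l) zs).
Proof.
  intros Hl; induction zs as [|z zs IH]; intros Hz; simpl; [constructor|].
  inversion Hz; subst. apply NoDup_app; [|auto|].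
  - apply FinFun.Injective_map_NoDup; auto.
    intros u v E. now apply (f_equal Vector.tl) in E.
  - intros v Hv Hv'. apply in_map_iff in Hv as (u & <- & _).
    apply in_flat_map in Hv' as (z' & Hz' & Hv'). apply in_map_iff in Hv' as (u' & E & _).
    apply (f_equal Vector.hd) in E; simpl in E; congruence.
Qed.

Lemma NoDup_grid d zs : NoDup zs -> NoDup (grid d zs).
Proof.
  intros Hz; induction d as [|d IH]; simpl; [constructor; [intros []|constructor]|].
  now apply NoDup_flat_cons.
Qed.

Lemma lsum_grid_S d zs (f : Zd (Datatypes.S d) -> R) :
  lsum f (grid (Datatypes.S d) zs) = lsum (fun z => lsum (fun v => f (Vector.cons Z z d v)) (grid d zs)) zs.
Proof. simpl; rewrite lsum_flat_map. apply lsum_ext; intros z _. now rewrite lsum_map. Qed.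

Lemma In_zrange n z : In z (zrange n) <-> (Z.abs z <= Z.of_nat n)%Z.
Proof.
  unfold zrange; rewrite in_map_iff; split.
  - intros (m & <- & Hm); apply in_seq in Hm; lia.
  - intros H; exists (Z.to_nat (z + Z.of_nat n)); split; [lia|]. apply in_seq; lia.
Qed.

Lemma NoDup_zrange n : NoDup (zrange n).
Proof. apply FinFun.Injective_map_NoDup; [intros a b; lia|apply seq_NoDup]. Qed.

Lemma zrange_S n : zrange (Datatypes.S n) = (- Z.of_nat (Datatypes.S n))%Z :: zrange n ++ [Z.of_nat (Datatypes.S n)].
Proof.
  unfold zrange. replace (2 * Datatypes.S n + 1)%nat with (Datatypes.S ((2 * n + 1) + 1)) by lia.
  rewrite <- cons_seq, seq_app, List.map_cons, List.map_app. f_equal; f_equal.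
  - rewrite <- seq_shift, List.map_map. apply List.map_ext; intros; lia.
  - cbn [List.map List.seq]. f_equal; lia.
Qed.

Lemma In_box {d} n (v : Zd d) : In v (box d n) <-> forall p, (Z.abs (Vector.nth v p) <= Z.of_nat n)%Z.
Proof. rewrite box_grid, In_grid. split; intros H p; apply In_zrange, H. Qed.

Lemma NoDup_box d n : NoDup (box d n).
Proof. rewrite box_grid; apply NoDup_grid, NoDup_zrange. Qed.

Lemma znorm_box {d} n (v : Zd d) : (znorm v <= Z.of_nat n)%Z -> In v (box d n).
Proof. intros H; apply In_box; intros p; pose proof (znorm_nth v p); lia. Qed.

(** * Fundamental domains modulo [Q] and periodic functions *)

Definition tbox (d Q : nat) : list (Zd d) := grid d (List.map Z.of_nat (List.seq 0 Q)).

Lemma In_tbox {d} Q (v : Zd d) :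
  In v (tbox d Q) <-> forall p, (0 <= Vector.nth v p < Z.of_nat Q)%Z.
Proof.
  unfold tbox; rewrite In_grid; split; intros H p; specialize (H p).
  - apply in_map_iff in H as (m & <- & Hm); apply in_seq in Hm; lia.
  - apply in_map_iff. exists (Z.to_nat (Vector.nth v p)); split; [lia|apply in_seq; lia].
Qed.

Lemma NoDup_tbox d Q : NoDup (tbox d Q).
Proof. apply NoDup_grid, FinFun.Injective_map_NoDup; [intros a b; lia|apply seq_NoDup]. Qed.

Definition zred {d} (Q : nat) (v : Zd d) : Zd d := Vector.map (fun z => (z mod Z.of_nat Q)%Z) v.
Definition zquo {d} (Q : nat) (v : Zd d) : Zd d := Vector.map (fun z => (z / Z.of_nat Q)%Z) v.

Lemma nth_zred {d} Q (v : Zd d) p : Vector.nth (zred Q v) p = (Vector.nth v p mod Z.of_nat Q)%Z.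
Proof. unfold zred; now rewrite (Vector.nth_map _ _ p p). Qed.
Lemma nth_zquo {d} Q (v : Zd d) p : Vector.nth (zquo Q v) p = (Vector.nth v p / Z.of_nat Q)%Z.
Proof. unfold zquo; now rewrite (Vector.nth_map _ _ p p). Qed.

Lemma zred_in {d} Q (v : Zd d) : (0 < Q)%nat -> In (zred Q v) (tbox d Q).
Proof. intros H; apply In_tbox; intros p; rewrite nth_zred. apply Z.mod_pos_bound; lia. Qed.

Lemma zred_quo {d} Q (v : Zd d) : (0 < Q)%nat -> v = zadd (zred Q v) (zscal (Z.of_nat Q) (zquo Q v)).
Proof.
  intros H; apply vec_ext; intros p; zvec_simpl; rewrite nth_zred, nth_zquo.
  pose proof (Z.div_mod (Vector.nth v p) (Z.of_nat Q)); lia.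
Qed.

Lemma zred_shift {d} Q (i v : Zd d) : zred Q (zadd i (zscal (Z.of_nat Q) v)) = zred Q i.
Proof.
  apply vec_ext; intros p. rewrite !nth_zred. zvec_simpl. rewrite Z.mul_comm. apply Z_mod_plus_full.
Qed.

Lemma zred_id {d} Q (i : Zd d) : In i (tbox d Q) -> zred Q i = i.
Proof. intros Hi. apply vec_ext; intros p. rewrite nth_zred. apply Z.mod_small, (proj1 (In_tbox Q i) Hi). Qed.

Definition Zperiodic {d} (Q : nat) (f : Zd d -> R) : Prop :=
  forall i v, f (zadd i (zscal (Z.of_nat Q) v)) = f i.

Lemma Zperiodic_red {d} Q (f : Zd d -> R) i : (0 < Q)%nat -> Zperiodic Q f -> f i = f (zred Q i).
Proof. intros HQ H. rewrite (zred_quo Q i HQ) at 1. apply H. Qed.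

Lemma Zperiodic_bounded {d} Q (f : Zd d -> R) : (0 < Q)%nat -> Zperiodic Q f ->
  exists M, forall i, Rabs (f i) <= M.
Proof.
  intros HQ Hf.
  destruct (list_bound (fun i r => Rabs (f i) <= r) (tbox d Q)) as (r & _ & Hr).
  - intros; lra.
  - intros i _; exists (Rabs (f i)); lra.
  - exists r; intros i; rewrite (Zperiodic_red Q f i HQ Hf); apply Hr, zred_in, HQ.
Qed.

Lemma sum_shift1 (Q : nat) (f : Z -> R) :
  (forall z, f (z + Z.of_nat Q)%Z = f z) ->
  lsum (fun z => f (z + 1)%Z) (List.map Z.of_nat (List.seq 0 Q)) = lsum f (List.map Z.of_nat (List.seq 0 Q)).
Proof.
  intros H. rewrite !lsum_map. destruct Q as [|Q]; [reflexivity|].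
  rewrite <- (cons_seq Q 0) at 2. rewrite seq_S, lsum_app. simpl.
  rewrite <- seq_shift, lsum_map.
  replace (Z.of_nat Q + 1)%Z with (0 + Z.of_nat (Datatypes.S Q))%Z by lia. rewrite (H 0%Z).
  rewrite (lsum_ext (fun a : nat => f (Z.of_nat a + 1)%Z) (fun a => f (Z.of_nat (Datatypes.S a)))).
  - simpl; lra.
  - intros a _; f_equal; lia.
Qed.

Lemma sum_shiftZ (Q : nat) (f : Z -> R) (a : Z) :
  (forall z, f (z + Z.of_nat Q)%Z = f z) ->
  lsum (fun z => f (z + a)%Z) (List.map Z.of_nat (List.seq 0 Q)) = lsum f (List.map Z.of_nat (List.seq 0 Q)).
Proof.
  revert a.
  assert (forall (n : nat) f, (forall z, f (z + Z.of_nat Q)%Z = f z) ->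
    lsum (fun z => f (z + Z.of_nat n)%Z) (List.map Z.of_nat (List.seq 0 Q)) = lsum f (List.map Z.of_nat (List.seq 0 Q))) as Hn.
  { induction n as [|n IH]; intros g Hg.
    - apply lsum_ext; intros; f_equal; lia.
    - rewrite <- (IH g Hg), <- (sum_shift1 Q (fun z => g (z + Z.of_nat n)%Z)).
      + apply lsum_ext; intros; f_equal; lia.
      + intros z. rewrite <- (Hg (z + Z.of_nat n)%Z); f_equal; lia. }
  intros a Hf. destruct (Z_le_gt_dec 0 a) as [Ha|Ha].
  - rewrite <- (Hn (Z.to_nat a) f Hf). apply lsum_ext; intros; f_equal; lia.
  - rewrite <- (Hn (Z.to_nat (- a)) (fun z => f (z + a)%Z)).
    + apply lsum_ext; intros; f_equal; lia.
    + intros z; rewrite <- (Hf (z + a)%Z); f_equal; lia.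
Qed.

Lemma Zperiodic_head {d} (Q : nat) (f : Zd (Datatypes.S d) -> R) z v : Zperiodic Q f ->
  f (Vector.cons Z (z + Z.of_nat Q)%Z d v) = f (Vector.cons Z z d v).
Proof.
  intros H. rewrite <- (H (Vector.cons Z z d v) (Vector.cons Z 1%Z d zz)), zscal_cons, zadd_cons.
  do 2 f_equal; [lia|zvec].
Qed.

Lemma Zperiodic_tail {d} (Q : nat) (f : Zd (Datatypes.S d) -> R) z : Zperiodic Q f ->
  Zperiodic Q (fun v => f (Vector.cons Z z d v)).
Proof.
  intros H i v. rewrite <- (H (Vector.cons Z z d i) (Vector.cons Z 0%Z d v)), zscal_cons, zadd_cons.
  do 2 f_equal; lia.
Qed.

(** The coordinates are shifted one at a time, each by the one-dimensional rearrangement. This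
    invariance is behind every reindexing of periodic energies, gradients and heights. *)
Lemma torus_shift {d} (Q : nat) (f : Zd d -> R) (a : Zd d) : Zperiodic Q f ->
  lsum (fun i => f (zadd i a)) (tbox d Q) = lsum f (tbox d Q).
Proof.
  unfold tbox. induction d as [|d IH]; intros H.
  - apply lsum_ext; intros v _; f_equal; apply vec_ext; intros p; inversion p.
  - rewrite !lsum_grid_S. rewrite (vec_eta a).
    rewrite (lsum_ext _ (fun z => lsum (fun v => f (Vector.cons Z (z + Vector.hd a)%Z d v))
       (grid d (List.map Z.of_nat (List.seq 0 Q))))).
    + apply (sum_shiftZ Q (fun z => lsum (fun v => f (Vector.cons Z z d v)) _)).
      intros z; apply lsum_ext; intros v _; now apply Zperiodic_head.
    + intros z _; cbv beta.
      etransitivity; [|apply (IH (fun v => f (Vector.cons Z (z + Vector.hd a)%Z d v)) (Vector.tl a))].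
      * apply lsum_ext; intros v _; reflexivity.
      * now apply Zperiodic_tail.
Qed.

Lemma sum_multZ (q N : nat) (f : Z -> R) : (forall z, f (z + Z.of_nat q)%Z = f z) ->
  lsum f (List.map Z.of_nat (List.seq 0 (N * q))) = INR N * lsum f (List.map Z.of_nat (List.seq 0 q)).
Proof.
  intros H. induction N as [|N IH]; [simpl; ring|].
  replace (Datatypes.S N * q)%nat with (N * q + q)%nat by lia.
  rewrite seq_app, List.map_app, lsum_app, IH, S_INR.
  replace (lsum f (List.map Z.of_nat (List.seq (0 + N * q) q)))
    with (lsum f (List.map Z.of_nat (List.seq 0 q))); [ring|].
  rewrite <- (sum_shiftZ q f (Z.of_nat (N * q)) H), !lsum_map.
  assert (forall k, List.seq k q = List.map (fun a => (a + k)%nat) (List.seq 0 q)) as Hs.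
  { clear; intros k; induction k as [|k IH].
    - rewrite <- (List.map_id (List.seq 0 q)) at 1. apply List.map_ext; intros; lia.
    - rewrite <- seq_shift, IH, List.map_map. apply List.map_ext; intros; lia. }
  rewrite (Hs (0 + N * q)%nat), lsum_map. apply lsum_ext; intros a _; f_equal; lia.
Qed.

(** The larger torus is tiled by [N ^ d] copies of the smaller one, counted one dimension at a
    time. *)
Lemma torus_mult {d} (q N : nat) (f : Zd d -> R) : Zperiodic q f ->
  lsum f (tbox d (N * q)) = INR N ^ d * lsum f (tbox d q).
Proof.
  unfold tbox. induction d as [|d IH]; intros H; [simpl; ring|].
  rewrite !lsum_grid_S.
  rewrite (lsum_ext _ (fun z => INR N ^ d * lsum (fun v => f (Vector.cons Z z d v))
       (grid d (List.map Z.of_nat (List.seq 0 q))))).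
  - rewrite lsum_scal. simpl pow. rewrite (sum_multZ q N (fun z => lsum (fun v => f (Vector.cons Z z d v)) _)); [ring|].
    intros z; apply lsum_ext; intros v _; now apply Zperiodic_head.
  - intros z _; cbv beta. now apply IH, Zperiodic_tail.
Qed.

Lemma tbox_nonempty d Q : (0 < Q)%nat -> In zz (tbox d Q).
Proof. intros H; apply In_tbox; intros p; rewrite nth_zz; lia. Qed.

(** * Calculus of the local potentials *)

Section Potentials.
Context {d : nat}.

Lemma bump_same (x : config d) i h : bump x i h i = x i + h.
Proof. unfold bump. now rewrite (proj2 (zeqb_eq i i) eq_refl). Qed.

Lemma bump_other (x : config d) i h k : k <> i -> bump x i h k = x k.
Proof.
  intros H; unfold bump. destruct (zeqb k i) eqn:E; [|reflexivity].
  now apply zeqb_eq in E.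
Qed.

Lemma bump_bump (x : config d) k a b : bump (bump x k a) k b = bump x k (a + b).
Proof.
  apply functional_extensionality; intros m. destruct (Zd_dec m k) as [->|H].
  - rewrite !bump_same; ring.
  - now rewrite !bump_other.
Qed.

Lemma bump_0 (x : config d) k : bump x k 0 = x.
Proof.
  apply functional_extensionality; intros m. destruct (Zd_dec m k) as [->|H].
  - rewrite bump_same; ring.
  - now rewrite bump_other.
Qed.

(** The hypothesis covers all base points, so the derivative at [h] is the one at 0 from the base
    point [bump x k h]. *)
Lemma bump_derivable (F DF : config d -> R) k :
  (forall x, derivable_pt_lim (fun h => F (bump x k h)) 0 (DF x)) ->
  forall x h, derivable_pt_lim (fun h => F (bump x k h)) h (DF (bump x k h)).
Proof.
  intros H x h eps He. destruct (H (bump x k h) eps He) as (delta & Hd).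
  exists delta; intros t Ht Ht'. specialize (Hd t Ht Ht').
  now rewrite !bump_bump, Rplus_0_l, Rplus_0_r in Hd.
Qed.

Lemma mvt_any (f f' : R -> R) a b : (forall c, derivable_pt_lim f c (f' c)) ->
  exists c, f b - f a = f' c * (b - a) /\ Rmin a b <= c <= Rmax a b.
Proof.
  intros H. destruct (Rtotal_order a b) as [Hab|[->|Hab]].
  - destruct (MVT_cor2 f f' a b Hab) as (c & Hc & Hc'); [intros; apply H|].
    exists c; split; [exact Hc|]. rewrite Rmin_left, Rmax_right; lra.
  - exists b; split; [ring|]. rewrite Rmin_left, Rmax_right; lra.
  - destruct (MVT_cor2 f f' b a Hab) as (c & Hc & Hc'); [intros; apply H|].
    exists c; split; [lra|]. rewrite Rmin_right, Rmax_left; lra.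
Qed.

Lemma bump_mvt (F DF : config d -> R) k :
  (forall x, derivable_pt_lim (fun h => F (bump x k h)) 0 (DF x)) ->
  forall x a, exists c, F (bump x k a) - F x = DF (bump x k c) * a /\ Rmin 0 a <= c <= Rmax 0 a.
Proof.
  intros H x a.
  destruct (mvt_any (fun h => F (bump x k h)) (fun h => DF (bump x k h)) 0 a) as (c & Hc & Hc').
  - intros; now apply bump_derivable.
  - exists c; split; [|auto]. rewrite bump_0, Rminus_0_r in Hc; auto.
Qed.

(** A stage on the way from [x] to [y], with the sites of [L] already moved. Adding a site is a
    [bump], so control of single partial derivatives suffices for estimates between arbitrary
    configurations. *)
Definition upd (L : list (Zd d)) (y x : config d) : config d :=
  fun i => if in_dec Zd_dec i L then y i else x i.

Lemma upd_cons k L (y x : config d) : ~ In k L ->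
  upd (k :: L) y x = bump (upd L y x) k (y k - x k).
Proof.
  intros H; apply functional_extensionality; intros m. unfold upd at 1.
  destruct (Zd_dec m k) as [->|Hm].
  - rewrite bump_same. unfold upd. destruct (in_dec Zd_dec k L); [tauto|].
    destruct (in_dec Zd_dec k (k :: L)) as [_|n0]; [ring|]. exfalso; apply n0; now left.
  - rewrite bump_other by auto. unfold upd.
    destruct (in_dec Zd_dec m (k :: L)) as [[E|Hi]|Hi], (in_dec Zd_dec m L); auto; try congruence; try tauto.
    exfalso; apply Hi; now right.
Qed.

Definition local_on (L : list (Zd d)) (F : config d -> R) : Prop :=
  forall x y, (forall k, In k L -> x k = y k) -> F x = F y.

(** A mean value inequality along a path that changes one site at a time. The step bound must hold
    whatever sites [L'] have moved before, and locality makes the path finite although [x] and [y]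
    may differ everywhere. *)
Lemma telescope_le (F : config d -> R) L (x y : config d) (c : Zd d -> R) :
  local_on L F -> NoDup L ->
  (forall L' k, In k L -> ~ In k L' ->
     F (bump (upd L' y x) k (y k - x k)) - F (upd L' y x) <= c k) ->
  F y - F x <= lsum c L.
Proof.
  intros Hl Hn Hs.
  assert (forall L', NoDup L' -> incl L' L -> F (upd L' y x) - F x <= lsum c L') as H.
  { induction L' as [|k L' IH]; intros Hn' Hi.
    - simpl. replace (upd [] y x) with x; [lra|]. apply functional_extensionality; reflexivity.
    - inversion Hn'; subst. rewrite upd_cons by auto. simpl.
      specialize (IH H2 (fun a h => Hi a (or_intror h))).
      specialize (Hs L' k (Hi k (or_introl eq_refl)) H1). lra. }
  specialize (H L Hn (fun a h => h)).
  replace (F y) with (F (upd L y x)); [auto|].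
  apply Hl; intros k Hk. unfold upd. destruct (in_dec Zd_dec k L); tauto.
Qed.

Lemma telescope_abs (F : config d -> R) L (x y : config d) (a c : Zd d -> R) :
  local_on L F -> NoDup L ->
  (forall L' k, In k L -> ~ In k L' ->
     Rabs (F (bump (upd L' y x) k (y k - x k)) - F (upd L' y x) - a k) <= c k) ->
  Rabs (F y - F x - lsum a L) <= lsum c L.
Proof.
  intros Hl Hn Hs. apply Rabs_le; split.
  - assert (- F y - - F x <= lsum (fun k => - a k + c k) L) as H.
    { apply (telescope_le (fun z => - F z)); auto.
      - intros u v H; f_equal; now apply Hl.
      - intros L' k H1 H2. specialize (Hs L' k H1 H2). apply Rabs_le_inv in Hs; lra. }
    rewrite lsum_plus in H.
    rewrite (lsum_ext (fun k => - a k) (fun k => -1 * a k)), lsum_scal in H; [lra|]. intros; ring.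
  - assert (F y - F x <= lsum (fun k => a k + c k) L) as H.
    { apply (telescope_le F); auto.
      intros L' k H1 H2. specialize (Hs L' k H1 H2). apply Rabs_le_inv in Hs; lra. }
    rewrite lsum_plus in H; lra.
Qed.

Variable P : LocalPotentials d.

Definition Bx : list (Zd d) := box d (Z.to_nat (up (rad P))).
Definition nB : R := INR (length Bx).
(** A cube of possible interaction partners of [j]. The form [zsub j v] lets a sum over pairs of
    sites be reindexed by the difference [v], which turns the differential of the energy into
    [gradW]. *)
Definition nb (j : Zd d) : list (Zd d) := List.map (fun v => zsub j v) Bx.

Lemma length_nb j : INR (length (nb j)) = nB.
Proof. unfold nb, nB; now rewrite List.length_map. Qed.

Lemma NoDup_nb j : NoDup (nb j).
Proof.
  apply FinFun.Injective_map_NoDup; [|apply NoDup_box].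
  intros u v E. replace u with (zsub j (zsub j u)) by zvec. rewrite E. zvec.
Qed.

Lemma ball_box (v : Zd d) : IZR (znorm v) <= rad P -> In v Bx.
Proof.
  intros H. apply znorm_box. destruct (archimed (rad P)) as (H1 & _).
  assert (IZR (znorm v) < IZR (up (rad P))) as H2 by lra. apply lt_IZR in H2.
  pose proof (znorm_nonneg v); lia.
Qed.

Lemma nB_ge1 : 1 <= nB.
Proof.
  unfold nB. assert (In zz Bx) as H.
  { apply ball_box. rewrite znorm_zz. pose proof (rad_pos d P); lra. }
  apply (le_INR 1). destruct Bx; [destruct H|simpl; lia].
Qed.

Lemma ball_nb j k : IZR (znorm (zsub k j)) <= rad P -> In k (nb j).
Proof.
  intros H. rewrite znorm_sub_sym in H. apply in_map_iff. exists (zsub j k); split; [zvec|].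
  now apply ball_box.
Qed.

Lemma S_local j : local_on (nb j) (S P j).
Proof. intros x y H. apply A_local. intros k Hk. apply H, ball_nb, Hk. Qed.

Lemma dS_local j i : local_on (nb j) (dS P j i).
Proof.
  intros x y H. apply (uniqueness_limite (fun h => S P j (bump x i h)) 0); [apply A_d1|].
  replace (fun h => S P j (bump x i h)) with (fun h => S P j (bump y i h)); [apply A_d1|].
  apply functional_extensionality; intros h. apply S_local. intros k Hk.
  unfold bump; destruct (zeqb k i); rewrite (H k Hk); auto.
Qed.

Lemma dS_far j i x : rad P < IZR (znorm (zsub i j)) -> dS P j i x = 0.
Proof.
  intros H. apply (uniqueness_limite (fun h => S P j (bump x i h)) 0); [apply A_d1|].
  replace (fun h => S P j (bump x i h)) with (fun _ : R => S P j x); [apply derivable_pt_lim_const|].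
  apply functional_extensionality; intros h. apply A_local. intros k Hk.
  rewrite bump_other; [auto|]. intros ->; lra.
Qed.

Lemma gradW_box x i : gradW P x i = lsum (fun v => dS P (zadd i v) i x) Bx.
Proof.
  unfold gradW. apply lsum_ext; intros v _.
  destruct (Rle_dec (IZR (znorm v)) (rad P)) as [H|H]; [reflexivity|].
  symmetry; apply dS_far. rewrite znorm_sub_sym.
  replace (zsub (zadd i v) i) with v by zvec. lra.
Qed.

Definition Cbd : R := epsilon (inhabits 0) (fun C => 0 < C /\ forall j i k x, Rabs (ddS P j i k x) <= C).

Lemma Cbd_spec : 0 < Cbd /\ forall j i k x, Rabs (ddS P j i k x) <= Cbd.
Proof.
  unfold Cbd; apply epsilon_spec. destruct (E_bound d P) as (C & HC).
  exists (Rabs C + 1); split; [pose proof (Rabs_pos C); lra|].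
  intros j i k x; specialize (HC j i k x); pose proof (Rle_abs C); lra.
Qed.

(** A Lipschitz constant of the gradient in the sup norm: at most [nB] potentials contribute at a
    site, and the derivative of each depends on at most [nB] coordinates, at rate at most [Cbd]. *)
Definition Kc : R := nB * (nB * Cbd).

Lemma Kc_pos : 0 < Kc.
Proof.
  pose proof nB_ge1; pose proof (proj1 Cbd_spec). unfold Kc.
  apply Rmult_lt_0_compat; [lra|]. apply Rmult_lt_0_compat; lra.
Qed.

Lemma dS_lip j i x y :
  Rabs (dS P j i y - dS P j i x) <= Cbd * lsum (fun k => Rabs (y k - x k)) (nb j).
Proof.
  rewrite <- lsum_scal. rewrite <- (Rminus_0_r (_ - _)).
  replace 0 with (lsum (fun _ : Zd d => 0) (nb j)) at 1 by (rewrite lsum_const; ring).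
  apply telescope_abs; [apply dS_local|apply NoDup_nb|].
  intros L k _ _. destruct (bump_mvt (dS P j i) (ddS P j i k) k (A_d2 d P j i k) (upd L y x) (y k - x k)) as (c & -> & _).
  rewrite Rminus_0_r, Rabs_mult. apply Rmult_le_compat_r; [apply Rabs_pos|apply Cbd_spec].
Qed.

(** By twist, raising a site other than [i] cannot raise the derivative in direction [i]; only
    raising [i] can, at rate at most [Cbd]. The factor [nB] is slack from using one bound for all
    steps of the telescope. *)
Lemma dS_quasimonotone j i x y : (forall k, x k <= y k) ->
  dS P j i y - dS P j i x <= nB * Cbd * (y i - x i).
Proof.
  intros H. destruct Cbd_spec as (HC & HC').
  replace (nB * Cbd * (y i - x i)) with (lsum (fun _ => Cbd * (y i - x i)) (nb j))
    by (rewrite lsum_const, length_nb; ring).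
  apply telescope_le; [apply dS_local|apply NoDup_nb|].
  intros L k _ _. destruct (bump_mvt (dS P j i) (ddS P j i k) k (A_d2 d P j i k) (upd L y x) (y k - x k)) as (c & -> & _).
  pose proof (H k); pose proof (H i).
  destruct (Zd_dec i k) as [<-|Hk].
  - apply Rmult_le_compat_r; [lra|]. eapply Rle_trans; [apply Rle_abs|apply HC'].
  - pose proof (D_twist d P j i k (bump (upd L y x) k c) Hk).
    apply Rle_trans with 0; [|apply Rmult_le_pos; lra].
    rewrite <- (Rmult_0_l (y k - x k)). apply Rmult_le_compat_r; lra.
Qed.

(** Raising only [k] gives a strict drop by [D_strict]; raising the remaining sites, with [i] fixed,
    gives no increase by quasimonotonicity. *)
Lemma dS_strict i k x y : (forall k, x k <= y k) -> x i = y i -> znorm (zsub i k) = 1%Z ->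
  x k < y k -> dS P i i y < dS P i i x.
Proof.
  intros H Hi Hk Hlt.
  assert (i <> k) as Hik.
  { intros <-. replace (zsub i i) with (@zz d) in Hk by zvec. rewrite znorm_zz in Hk; lia. }
  set (z := bump x k (y k - x k)).
  assert (dS P i i z < dS P i i x).
  { destruct (bump_mvt (dS P i i) (ddS P i i k) k (A_d2 d P i i k) x (y k - x k)) as (c & Hc & _).
    pose proof (D_strict d P i k (bump x k c) Hk) as Hs.
    assert (ddS P i i k (bump x k c) * (y k - x k) < 0 * (y k - x k)) by (apply Rmult_lt_compat_r; lra).
    fold z in Hc; lra. }
  assert (dS P i i y - dS P i i z <= nB * Cbd * (y i - z i)).
  { apply dS_quasimonotone. intros m. unfold z. destruct (Zd_dec m k) as [->|Hm].
    - rewrite bump_same; lra.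
    - rewrite bump_other; auto. }
  replace (z i) with (y i) in H1; [lra|]. unfold z; rewrite bump_other; auto.
Qed.

Definition V (x : config d) (i : Zd d) : R := - gradW P x i.

Lemma V_lip x y dl : (forall i, Rabs (y i - x i) <= dl) -> forall i, Rabs (V y i - V x i) <= Kc * dl.
Proof.
  intros H i. unfold V.
  replace (- gradW P y i - - gradW P x i) with (gradW P x i - gradW P y i) by ring.
  rewrite !gradW_box, <- lsum_minus. eapply Rle_trans; [apply lsum_abs|].
  replace (Kc * dl) with (lsum (fun _ => nB * Cbd * dl) Bx) by (rewrite lsum_const; unfold Kc, nB; ring).
  apply lsum_le; intros v _. rewrite Rabs_minus_sym.
  eapply Rle_trans; [apply dS_lip|].
  replace (nB * Cbd * dl) with (Cbd * lsum (fun _ => dl) (nb (zadd i v)))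
    by (rewrite lsum_const, length_nb; ring).
  apply Rmult_le_compat_l; [pose proof (proj1 Cbd_spec); lra|]. apply lsum_le; intros; apply H.
Qed.

(** A quantitative Kamke condition; all comparison results for the flow rest on it. *)
Lemma V_quasimonotone x y : (forall i, x i <= y i) -> forall i, V y i - V x i >= - Kc * (y i - x i).
Proof.
  intros H i. unfold V. rewrite !gradW_box.
  assert (lsum (fun v => dS P (zadd i v) i y) Bx - lsum (fun v => dS P (zadd i v) i x) Bx <= Kc * (y i - x i)); [|lra].
  rewrite <- lsum_minus.
  replace (Kc * (y i - x i)) with (lsum (fun _ => nB * Cbd * (y i - x i)) Bx)
    by (rewrite lsum_const; unfold Kc, nB; ring).
  apply lsum_le; intros; now apply dS_quasimonotone.
Qed.

(** When [x] and [y] agree at [i], all terms of the gradient difference have one sign, and the term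
    of the potential at [i] itself is strict unless they also agree at [k]. *)
Lemma V_strict x y i k : (forall i, x i <= y i) -> x i = y i -> V x i = V y i ->
  znorm (zsub i k) = 1%Z -> x k = y k.
Proof.
  intros H Hi HV Hk. destruct (Rtotal_order (x k) (y k)) as [Hl|[E|Hl]]; [|auto|specialize (H k); lra].
  exfalso. assert (gradW P y i < gradW P x i); [|unfold V in HV; lra].
  rewrite !gradW_box. apply Rminus_gt_0_lt, Rlt_gt.
  rewrite <- lsum_minus.
  eapply Rlt_le_trans; [|apply (lsum_mem_le (fun v => dS P (zadd i v) i x - dS P (zadd i v) i y) Bx zz)].
  - replace (zadd i zz) with i by zvec. pose proof (dS_strict i k x y H Hi Hk Hl); lra.
  - intros v _. pose proof (dS_quasimonotone (zadd i v) i x y H) as Hq.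
    replace (y i - x i) with 0 in Hq by lra. lra.
  - apply ball_box. rewrite znorm_zz. pose proof (rad_pos d P); lra.
Qed.

(** The strong maximum principle: contact spreads over the connected lattice. *)
Lemma V_touching x y : (forall i, x i <= y i) -> (forall i, x i = y i -> V x i = V y i) ->
  (exists i, x i = y i) -> x = y.
Proof.
  intros H HV (o & Ho). apply functional_extensionality.
  apply (lattice_connected (fun i => x i = y i) o Ho).
  intros i k Hk Hi. apply (V_strict x y i k); auto.
Qed.

Lemma bump_tau k l (x : config d) i h : bump (tau k l x) i h = tau k l (bump x (zadd i k) h).
Proof.
  apply functional_extensionality; intros m. unfold tau at 2. destruct (Zd_dec m i) as [->|Hm].
  - rewrite !bump_same. unfold tau; ring.
  - rewrite !bump_other; auto. intros E; apply Hm.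
    replace m with (zsub (zadd m k) k) by zvec. rewrite E; zvec.
Qed.

Lemma dS_tau j i k l x : dS P j i (tau k l x) = dS P (zadd j k) (zadd i k) x.
Proof.
  apply (uniqueness_limite (fun h => S P j (bump (tau k l x) i h)) 0); [apply A_d1|].
  replace (fun h => S P j (bump (tau k l x) i h)) with (fun h => S P (zadd j k) (bump x (zadd i k) h)).
  - apply A_d1.
  - apply functional_extensionality; intros h. now rewrite bump_tau, B_inv.
Qed.

Lemma V_tau k l x i : V (tau k l x) i = V x (zadd i k).
Proof.
  unfold V; f_equal. rewrite !gradW_box. apply lsum_ext; intros v _. rewrite dS_tau.
  f_equal; zvec.
Qed.

(** On the sites that matter, every stage of the telescope is within the l1 distance [s] of [x], so
    each partial derivative is off by at most [Cbd * s] and the errors add up to [Cbd * s^2]. *)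
Lemma S_taylor j x y :
  Rabs (S P j y - S P j x - lsum (fun k => dS P j k x * (y k - x k)) (nb j))
    <= Cbd * (lsum (fun k => Rabs (y k - x k)) (nb j))^2.
Proof.
  set (s := lsum (fun k => Rabs (y k - x k)) (nb j)).
  replace (Cbd * s^2) with (lsum (fun k => Cbd * s * Rabs (y k - x k)) (nb j))
    by (rewrite lsum_scal; fold s; ring).
  apply telescope_abs; [apply S_local|apply NoDup_nb|].
  intros L k _ HkL. destruct (bump_mvt (S P j) (dS P j k) k (A_d1 d P j k) (upd L y x) (y k - x k)) as (c & -> & Hc).
  rewrite <- Rmult_minus_distr_r, Rabs_mult. apply Rmult_le_compat_r; [apply Rabs_pos|].
  eapply Rle_trans; [apply dS_lip|]. apply Rmult_le_compat_l; [pose proof (proj1 Cbd_spec); lra|].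
  apply lsum_le; intros m _. destruct (Zd_dec m k) as [->|Hm].
  - rewrite bump_same. unfold upd. destruct (in_dec Zd_dec k L); [tauto|].
    replace (x k + c - x k) with c by ring.
    revert Hc; unfold Rmin, Rmax, Rabs; destruct (Rle_dec 0 (y k - x k)), (Rcase_abs c), (Rcase_abs (y k - x k)); lra.
  - rewrite bump_other by auto. unfold upd. destruct (in_dec Zd_dec m L); [lra|].
    replace (x m - x m) with 0 by ring. rewrite Rabs_R0; apply Rabs_pos.
Qed.

(* A function [h |-> S (Z + h e_k) - S (z + h e_k)] with [z <= Z] agreeing at [k] is
   nonincreasing by the twist condition. *)
Lemma S_submodular j x y :
  S P j (fun i => Rmax (x i) (y i)) + S P j (fun i => Rmin (x i) (y i)) <= S P j x + S P j y.
Proof.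
  set (M := fun i => Rmax (x i) (y i)); set (a := fun i => Rmin (x i) (y i)).
  (* Moving site by site takes the pair ([x], [a]) to ([M], [y]). Both members receive the same
     increment at each site, since [y k - a k = M k - x k]. *)
  assert (forall L, NoDup L -> S P j (upd L M x) - S P j (upd L y a) <= S P j x - S P j a) as H.
  { induction L as [|k L IH]; intros Hn.
    - replace (upd [] M x) with x by (apply functional_extensionality; reflexivity).
      replace (upd [] y a) with a by (apply functional_extensionality; reflexivity). lra.
    - inversion Hn; subst. specialize (IH H2). rewrite !upd_cons by auto.
      set (Z := upd L M x) in *; set (z := upd L y a) in *.
      assert (y k - a k = M k - x k) as E.
      { unfold M, a, Rmin, Rmax; destruct (Rle_dec (x k) (y k)); lra. }
      rewrite E.
      assert (Z k = x k /\ z k = a k) as (EZ & Ez).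
      { unfold Z, z, upd; destruct (in_dec Zd_dec k L); tauto. }
      assert (0 <= M k - x k) as H0 by (unfold M; pose proof (Rmax_l (x k) (y k)); lra).
      destruct H0 as [H0|H0].
      2:{ rewrite <- H0, !bump_0; auto. }
      destruct (mvt_any (fun h => S P j (bump Z k h) - S P j (bump z k h))
         (fun h => dS P j k (bump Z k h) - dS P j k (bump z k h)) 0 (M k - x k)) as (c & Hc & _).
      { intros c. apply derivable_pt_lim_minus; apply bump_derivable; apply A_d1. }
      rewrite !bump_0 in Hc.
      assert (dS P j k (bump Z k c) - dS P j k (bump z k c) <= nB * Cbd * (bump Z k c k - bump z k c k)) as Hq.
      { apply dS_quasimonotone. intros m. destruct (Zd_dec m k) as [->|Hm].
        - rewrite !bump_same, EZ, Ez. unfold a; pose proof (Rmin_l (x k) (y k)); lra.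
        - rewrite !bump_other by auto. unfold Z, z, upd, M, a.
          destruct (in_dec Zd_dec m L); [apply Rmax_r|apply Rmin_l]. }
      rewrite !bump_same, EZ, Ez in Hq.
      replace (x k + c - (a k + c)) with 0 in Hq.
      2:{ unfold M in H0. unfold a. revert H0; unfold Rmin, Rmax; destruct (Rle_dec (x k) (y k)); lra. }
      assert ((dS P j k (bump Z k c) - dS P j k (bump z k c)) * (M k - x k - 0) <= 0); [|lra].
      apply Rle_trans with (0 * (M k - x k - 0)); [apply Rmult_le_compat_r; lra|lra]. }
  specialize (H (nb j) (NoDup_nb j)).
  rewrite (S_local j (upd (nb j) M x) M), (S_local j (upd (nb j) y a) y) in H; [lra| |];
    intros k Hk; unfold upd; destruct (in_dec Zd_dec k (nb j)); tauto.
Qed.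

(** Periodic up to an integer height, which (B) makes invisible to the potentials and their
    derivatives. *)
Definition lattice_periodic (Q : nat) (x : config d) : Prop :=
  forall v, exists l : Z, tau (zscal (Z.of_nat Q) v) l x = x.

(** Summation by parts on the torus: exchanging the sums and translating by [v] collects, at each
    site, the derivatives of all potentials that feel it. *)
Lemma W_gradient Q x eta : lattice_periodic Q x -> Zperiodic Q eta ->
  lsum (fun j => lsum (fun k => dS P j k x * eta k) (nb j)) (tbox d Q)
  = lsum (fun j => gradW P x j * eta j) (tbox d Q).
Proof.
  intros Hx He. unfold nb.
  rewrite (lsum_ext _ (fun j => lsum (fun v => dS P j (zsub j v) x * eta (zsub j v)) Bx))
    by (intros; apply lsum_map).
  rewrite lsum_exchange.
  rewrite (lsum_ext _ (fun v => lsum (fun j => dS P (zadd j v) j x * eta j) (tbox d Q))).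
  - rewrite <- lsum_exchange. apply lsum_ext; intros j _. rewrite gradW_box, Rmult_comm, <- lsum_scal.
    apply lsum_ext; intros; ring.
  - intros v _. rewrite <- (torus_shift Q _ v).
    + apply lsum_ext; intros j _. replace (zsub (zadd j v) v) with j by zvec. reflexivity.
    + intros i u. destruct (Hx u) as (l & Hl). rewrite <- Hl at 2. rewrite dS_tau.
      rewrite <- (He (zsub i v) u). f_equal; f_equal; zvec.
Qed.

Lemma W_taylor Q x y dl : lattice_periodic Q x -> Zperiodic Q (fun i => y i - x i) ->
  (forall i, Rabs (y i - x i) <= dl) ->
  Rabs (WB P (tbox d Q) y - WB P (tbox d Q) x - lsum (fun j => gradW P x j * (y j - x j)) (tbox d Q))
    <= INR (length (tbox d Q)) * (Cbd * (nB * dl)^2).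
Proof.
  intros Hx He Hd. unfold WB. rewrite <- (W_gradient Q x (fun j => y j - x j)) by auto.
  rewrite <- !lsum_minus. eapply Rle_trans; [apply lsum_abs|]. rewrite <- lsum_const.
  apply lsum_le; intros j _. eapply Rle_trans; [apply S_taylor|].
  apply Rmult_le_compat_l; [pose proof (proj1 Cbd_spec); lra|].
  apply pow_incr; split; [apply lsum_ge0; intros; apply Rabs_pos|].
  rewrite <- (length_nb j), <- lsum_const. apply lsum_le; intros; apply Hd.
Qed.

Lemma half_pow_split (i a : Zd d) :
  (/2) ^ Z.to_nat (znorm i) <= 2 ^ Z.to_nat (znorm a) * (/2) ^ Z.to_nat (znorm (zadd i a)).
Proof.
  pose proof (znorm_triang i a); pose proof (znorm_nonneg i); pose proof (znorm_nonneg a);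
  pose proof (znorm_nonneg (zadd i a)).
  assert ((/2) ^ (Z.to_nat (znorm i) + Z.to_nat (znorm a)) <= (/2) ^ Z.to_nat (znorm (zadd i a))) as H3.
  { rewrite !pow_inv. apply Rinv_le_contravar; [apply pow_lt; lra|]. apply Rle_pow; [lra|lia]. }
  rewrite pow_add in H3.
  assert (2 ^ Z.to_nat (znorm a) * (/2) ^ Z.to_nat (znorm a) = 1) as H4.
  { rewrite <- Rpow_mult_distr. replace (2 * /2) with 1 by field. apply pow1. }
  apply (Rmult_le_compat_l (2 ^ Z.to_nat (znorm a))) in H3; [|apply pow_le; lra].
  eapply Rle_trans; [|exact H3]. right.
  transitivity ((/2) ^ Z.to_nat (znorm i) * (2 ^ Z.to_nat (znorm a) * (/2) ^ Z.to_nat (znorm a))); [rewrite H4|]; ring.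
Qed.

Lemma wsum_shift (e : config d) M a n : (forall N, wsum e N <= M) ->
  lsum (fun i => (/2) ^ Z.to_nat (znorm i) * Rabs (e (zadd i a))) (box d n)
    <= 2 ^ Z.to_nat (znorm a) * M.
Proof.
  intros H.
  apply Rle_trans with (2 ^ Z.to_nat (znorm a) *
     lsum (fun i => (/2) ^ Z.to_nat (znorm (zadd i a)) * Rabs (e (zadd i a))) (box d n)).
  - rewrite <- lsum_scal. apply lsum_le; intros i _. rewrite <- Rmult_assoc.
    apply Rmult_le_compat_r; [apply Rabs_pos|apply half_pow_split].
  - apply Rmult_le_compat_l; [apply pow_le; lra|].
    eapply Rle_trans; [|apply (H (n + Z.to_nat (znorm a))%nat)]. unfold wsum.
    rewrite <- (lsum_map (fun i => (/2) ^ Z.to_nat (znorm i) * Rabs (e i)) (fun i => zadd i a)).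
    apply lsum_incl.
    + apply FinFun.Injective_map_NoDup; [|apply NoDup_box].
      intros u v E. replace u with (zsub (zadd u a) a) by zvec. rewrite E; zvec.
    + intros i Hi. apply in_map_iff in Hi as (j & <- & Hj). apply In_box; intros p.
      pose proof (proj1 (In_box n j) Hj p). rewrite nth_zadd. pose proof (znorm_nth a p); lia.
    + intros i _. apply Rmult_le_pos; [apply pow_le; lra|apply Rabs_pos].
Qed.

Definition Kw : R := lsum (fun v => lsum (fun u => Cbd * 2 ^ Z.to_nat (znorm (zsub v u))) Bx) Bx.

(** Each site feels finitely many others, and moving the weight by a vector costs a factor 2 to the
    power of its norm. Bounding partial sums avoids infinite series. *)
Lemma V_wlip x y M n : (forall N, wsum (fun i => y i - x i) N <= M) ->
  lsum (fun i => (/2) ^ Z.to_nat (znorm i) * Rabs (V y i - V x i)) (box d n) <= Kw * M.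
Proof.
  intros H. destruct Cbd_spec as (HC & _).
  set (e := fun i => y i - x i) in *.
  apply Rle_trans with (lsum (fun i => lsum (fun v => lsum (fun u =>
     Cbd * ((/2) ^ Z.to_nat (znorm i) * Rabs (e (zadd i (zsub v u))))) Bx) Bx) (box d n)).
  - apply lsum_le; intros i _.
    rewrite (lsum_ext _ (fun v => ((/2) ^ Z.to_nat (znorm i)) * (Cbd * lsum (fun k => Rabs (y k - x k)) (nb (zadd i v))))).
    + rewrite lsum_scal. apply Rmult_le_compat_l; [apply pow_le; lra|].
      unfold V. replace (- gradW P y i - - gradW P x i) with (gradW P x i - gradW P y i) by ring.
      rewrite !gradW_box, <- lsum_minus. eapply Rle_trans; [apply lsum_abs|].
      apply lsum_le; intros v _. rewrite Rabs_minus_sym; apply dS_lip.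
    + intros v _. unfold nb. rewrite lsum_map, <- !lsum_scal. apply lsum_ext; intros u _.
      unfold e. replace (zsub (zadd i v) u) with (zadd i (zsub v u)) by zvec. ring.
  - rewrite lsum_exchange. unfold Kw. rewrite (Rmult_comm _ M), <- lsum_scal.
    apply lsum_le; intros v _. rewrite lsum_exchange, <- lsum_scal.
    apply lsum_le; intros u _. rewrite lsum_scal.
    replace (M * (Cbd * 2 ^ Z.to_nat (znorm (zsub v u)))) with (Cbd * (2 ^ Z.to_nat (znorm (zsub v u)) * M)) by ring.
    apply Rmult_le_compat_l; [lra|]. now apply wsum_shift.
Qed.

Lemma Kw_nonneg : 0 <= Kw.
Proof.
  apply lsum_ge0; intros; apply lsum_ge0; intros. destruct Cbd_spec as (HC & _).
  apply Rmult_le_pos; [lra|apply pow_le; lra].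
Qed.

End Potentials.

(** * Differential inequalities and Picard iteration *)

Lemma antiderivative_exists (f : R -> R) : (forall x, continuity_pt f x) ->
  exists F, F 0 = 0 /\ forall x, derivable_pt_lim F x (f x).
Proof.
  intros H. assert (forall x, continuous f x) as Hc.
  { intros x. now apply continuity_pt_filterlim. }
  exists (fun t => RInt f 0 t); split; [exact (RInt_point 0 f)|].
  intros x. apply is_derive_Reals.
  apply (is_derive_RInt f (fun t => RInt f 0 t) 0 x); [|apply Hc].
  apply filter_forall. intros b. apply (RInt_correct f), ex_RInt_continuous.
  intros; apply Hc.
Qed.

Lemma derivable_pt_lim_exp_lin K t : derivable_pt_lim (fun s => exp (K * s)) t (K * exp (K * t)).
Proof.
  replace (K * exp (K * t)) with (exp (K * t) * (K * 1)) by ring.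
  apply (derivable_pt_lim_comp (fun s => K * s) exp); [|apply derivable_pt_lim_exp].
  apply derivable_pt_lim_scal, derivable_pt_lim_id.
Qed.

Lemma derivable_pt_lim_reverse f l t : derivable_pt_lim f (- t) l ->
  derivable_pt_lim (fun s => f (- s)) t (- l).
Proof.
  intros H. replace (- l) with (l * (- 1)) by ring.
  apply (derivable_pt_lim_comp (fun s => - s) f); [|exact H].
  apply derivable_pt_lim_opp, derivable_pt_lim_id.
Qed.

Lemma derivable_pt_lim_shift f l a t : derivable_pt_lim f (t + a) l ->
  derivable_pt_lim (fun s => f (s + a)) t l.
Proof.
  intros H. replace l with (l * (1 + 0)) by ring.
  apply (derivable_pt_lim_comp (fun s => s + a) f); [|exact H].
  apply derivable_pt_lim_plus; [apply derivable_pt_lim_id|apply derivable_pt_lim_const].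
Qed.

Lemma exp_growth_le (f f' : R -> R) a K T : 0 < K -> 0 <= T ->
  (forall t, 0 <= t <= T -> derivable_pt_lim f t (f' t)) ->
  (forall t, 0 <= t <= T -> f' t <= a * exp (K * t)) ->
  f T <= f 0 + a / K * (exp (K * T) - 1).
Proof.
  intros HK [HT|<-] Hd Hb.
  2:{ rewrite Rmult_0_r, exp_0; lra. }
  destruct (MVT_cor2 (fun t => f t - a / K * exp (K * t)) (fun t => f' t - a / K * (K * exp (K * t))) 0 T HT)
    as (c & Hc & Hc').
  { intros c Hc. apply derivable_pt_lim_minus; [now apply Hd|].
    apply derivable_pt_lim_scal, derivable_pt_lim_exp_lin. }
  rewrite Rmult_0_r, exp_0 in Hc.
  assert (f' c - a / K * (K * exp (K * c)) <= 0) as H.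
  { replace (a / K * (K * exp (K * c))) with (a * exp (K * c)) by (field; lra).
    pose proof (Hb c ltac:(lra)); lra. }
  assert ((f' c - a / K * (K * exp (K * c))) * (T - 0) <= 0 * (T - 0)) by (apply Rmult_le_compat_r; lra).
  lra.
Qed.

Lemma exp_growth_abs (f f' : R -> R) a K : 0 < K -> 0 <= a -> f 0 = 0 ->
  (forall t, derivable_pt_lim f t (f' t)) ->
  (forall t, Rabs (f' t) <= a * exp (K * Rabs t)) ->
  forall t, Rabs (f t) <= a / K * exp (K * Rabs t).
Proof.
  intros HK Ha H0.
  assert (forall g g' : R -> R, g 0 = 0 -> (forall t, derivable_pt_lim g t (g' t)) ->
    (forall t, Rabs (g' t) <= a * exp (K * Rabs t)) -> forall t, 0 <= t -> Rabs (g t) <= a / K * exp (K * t)) as H.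
  { intros g g' Hg0 Hd Hb t Ht.
    assert (0 <= a / K) as Ha' by (apply Rmult_le_pos; [lra|left; now apply Rinv_0_lt_compat]).
    apply Rabs_le; split.
    - pose proof (exp_growth_le (fun t => - g t) (fun t => - g' t) a K t HK Ht) as H.
      cbv beta in H. rewrite Hg0 in H. assert (- g t <= - 0 + a / K * (exp (K * t) - 1)); [|lra].
      apply H; [intros; apply derivable_pt_lim_opp, Hd|].
      intros s Hs. specialize (Hb s). rewrite (Rabs_right s) in Hb by lra. apply Rabs_le_inv in Hb; lra.
    - pose proof (exp_growth_le g g' a K t HK Ht) as H.
      rewrite Hg0 in H. assert (g t <= 0 + a / K * (exp (K * t) - 1)); [|lra].
      apply H; [intros; apply Hd|].
      intros s Hs. specialize (Hb s). rewrite (Rabs_right s) in Hb by lra. apply Rabs_le_inv in Hb; lra. }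
  intros Hd Hb t. destruct (Rle_or_lt 0 t) as [Ht|Ht].
  - rewrite (Rabs_right t) by lra. now apply (H f f').
  - rewrite (Rabs_left t) by lra. rewrite <- (Ropp_involutive t) at 1.
    apply (H (fun s => f (- s)) (fun s => - f' (- s))); [now rewrite Ropp_0| | |lra].
    + intros s; now apply derivable_pt_lim_reverse.
    + intros s. rewrite Rabs_Ropp. specialize (Hb (- s)). now rewrite Rabs_Ropp in Hb.
Qed.

Lemma half_pow_small (B eps : R) : 0 < eps -> exists n : nat, B * (/2)^n < eps.
Proof.
  intros He. destruct (pow_lt_1_zero (/2) ltac:(rewrite Rabs_right; lra) (eps / (Rabs B + 1))) as (n & Hn).
  - apply Rdiv_lt_0_compat; [lra|]. pose proof (Rabs_pos B); lra.
  - exists n. specialize (Hn n (Nat.le_refl n)). assert (0 < (/2)^n) by (apply pow_lt; lra).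
    rewrite Rabs_right in Hn by lra. pose proof (Rle_abs B); pose proof (Rabs_pos B).
    apply Rle_lt_trans with ((Rabs B + 1) * (/2)^n); [apply Rmult_le_compat_r; lra|].
    apply (Rmult_lt_compat_l (Rabs B + 1)) in Hn; [|lra].
    replace ((Rabs B + 1) * (eps / (Rabs B + 1))) with eps in Hn by (field; lra). lra.
Qed.

(* Inserting the bound into the differential inequality halves its excess over
   [2 dl exp (2 K t)]; no integral or continuity of a supremum is needed. *)
Lemma gronwall {I : Type} (v v' : I -> R -> R) K T M0 dl : 0 < K -> 0 <= dl ->
  (forall i t, 0 <= t <= T -> derivable_pt_lim (v i) t (v' i t)) ->
  (forall t M, 0 <= t <= T -> 0 <= M -> (forall i, v i t <= M) -> forall i, v' i t <= K * M) ->
  (forall i, v i 0 <= dl) ->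
  (forall i t, 0 <= t <= T -> v i t <= M0) ->
  forall i t, 0 <= t <= T -> v i t <= 2 * dl * exp (2 * K * t).
Proof.
  intros HK Hdl Hd Hb H0 HM.
  assert (0 <= Rmax M0 0) as HM0 by apply Rmax_r.
  assert (forall n i t, 0 <= t <= T -> v i t <= (2 * dl + Rmax M0 0 * (/2)^n) * exp (2 * K * t)) as H.
  { induction n as [|n IH]; intros i t Ht.
    - eapply Rle_trans; [now apply HM|]. simpl.
      apply Rle_trans with (Rmax M0 0); [apply Rmax_l|].
      assert (1 <= exp (2 * K * t)).
      { rewrite <- exp_0. destruct (Rle_lt_or_eq_dec 0 t (proj1 Ht)) as [Hl|<-].
        - left; apply exp_increasing. apply Rmult_lt_0_compat; lra.
        - rewrite Rmult_0_r; lra. }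
      apply Rle_trans with ((2 * dl + Rmax M0 0 * 1) * 1); [lra|]. apply Rmult_le_compat_l; lra.
    - set (A := 2 * dl + Rmax M0 0 * (/2)^n) in *.
      assert (0 < (/2)^n) by (apply pow_lt; lra).
      assert (0 <= A) as HA by (unfold A; pose proof (Rmult_le_pos _ _ HM0 (Rlt_le _ _ H)); lra).
      pose proof (exp_growth_le (v i) (v' i) (K * A) (2 * K) t ltac:(lra) (proj1 Ht)) as Hg.
      assert (v i t <= v i 0 + K * A / (2 * K) * (exp (2 * K * t) - 1)) as Hg'.
      { apply Hg; intros s Hs; [apply Hd; lra|].
        rewrite Rmult_assoc. apply (Hb s); [lra| |].
        - apply Rmult_le_pos; [auto|left; apply exp_pos].
        - intros k; apply IH; lra. }
      replace (K * A / (2 * K)) with (A / 2) in Hg' by (field; lra).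
      specialize (H0 i). replace (2 * dl + Rmax M0 0 * (/2)^(Datatypes.S n)) with (dl + A / 2)
        by (unfold A; simpl; field).
      assert (dl * 1 <= dl * exp (2 * K * t)); [|unfold A in *; pose proof (Rmult_le_pos _ _ HM0 (Rlt_le _ _ H)); lra].
      apply Rmult_le_compat_l; [auto|]. rewrite <- exp_0.
      destruct (Rle_lt_or_eq_dec 0 t (proj1 Ht)) as [Hl|<-].
      + left; apply exp_increasing. apply Rmult_lt_0_compat; lra.
      + rewrite Rmult_0_r; lra. }
  intros i t Ht. apply Rnot_lt_le; intros Hlt.
  destruct (half_pow_small (Rmax M0 0 * exp (2 * K * t)) (v i t - 2 * dl * exp (2 * K * t))) as (n & Hn); [lra|].
  specialize (H n i t Ht). lra.
Qed.

Lemma geometric_limit (a : nat -> R) c : 0 <= c ->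
  (forall k, Rabs (a (Datatypes.S k) - a k) <= c * (/2)^k) ->
  exists l, forall k, Rabs (l - a k) <= 2 * c * (/2)^k.
Proof.
  intros Hc H.
  assert (forall k n, Rabs (a (k + n)%nat - a k) <= 2 * c * (/2)^k * (1 - (/2)^n)) as Hn.
  { intros k n; induction n as [|n IH].
    - rewrite Nat.add_0_r. rewrite Rabs_minus_self. simpl; lra.
    - rewrite <- plus_n_Sm. replace (a (Datatypes.S (k + n)) - a k) with
       ((a (Datatypes.S (k + n)) - a (k + n)%nat) + (a (k + n)%nat - a k)) by ring.
      eapply Rle_trans; [apply Rabs_triang|]. specialize (H (k + n)%nat). rewrite pow_add in H.
      simpl pow at 2. lra. }
  assert (forall k n, Rabs (a (k + n)%nat - a k) <= 2 * c * (/2)^k) as Hn'.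
  { intros k n; eapply Rle_trans; [apply Hn|].
    assert (0 < (/2)^n) by (apply pow_lt; lra). assert (0 < (/2)^k) by (apply pow_lt; lra).
    assert (0 <= 2 * c * (/2)^k) by (apply Rmult_le_pos; lra).
    rewrite <- Rmult_1_r. apply Rmult_le_compat_l; lra. }
  destruct (Rcomplete.R_complete a) as (l & Hl).
  { intros eps He. destruct (half_pow_small (4 * c) eps He) as (N & HN). exists N.
    intros n m Hn1 Hm1. unfold Rdist.
    replace n with (N + (n - N))%nat by lia. replace m with (N + (m - N))%nat by lia.
    pose proof (Hn' N (n - N)%nat) as H1. pose proof (Hn' N (m - N)%nat) as H2.
    replace (a (N + (n - N))%nat - a (N + (m - N))%nat) with
      ((a (N + (n - N))%nat - a N) + - (a (N + (m - N))%nat - a N)) by ring.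
    eapply Rle_lt_trans; [apply Rabs_triang|]. rewrite Rabs_Ropp. lra. }
  exists l; intros k. apply Rnot_lt_le; intros Hlt.
  destruct (Hl (Rabs (l - a k) - 2 * c * (/2)^k)) as (N & HN); [lra|].
  specialize (HN (k + N)%nat ltac:(lia)). unfold Rdist in HN.
  specialize (Hn' k N).
  pose proof (Rabs_triang (l - a (k + N)%nat) (a (k + N)%nat - a k)) as Ht.
  replace (l - a (k + N)%nat + (a (k + N)%nat - a k)) with (l - a k) in Ht by ring.
  rewrite (Rabs_minus_sym l (a (k + N)%nat)) in Ht. lra.
Qed.

(** * Picard iteration in a time-weighted sup norm *)

Section Picard.
Context {I : Type}.
Variables (F : (I -> R) -> I -> R) (K : R) (u0 : I -> R) (M : R).
Hypothesis HK : 0 < K.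
Hypothesis HM : 0 < M.
Hypothesis Flip : forall x y dl, (forall i, Rabs (y i - x i) <= dl) -> forall i, Rabs (F y i - F x i) <= K * dl.
Hypothesis FM : forall i, Rabs (F u0 i) <= M.

(** The rate is twice the Lipschitz constant: the field along [u] is then bounded by
    [2 * M * exp (2 * K * Rabs t)], whose integral satisfies the first bound again, so Picard steps
    preserve the class. The second bound is uniform in [i] and gives continuity of the field along
    [u] and, later, of flow lines in X. *)
Definition tame (u : R -> I -> R) : Prop :=
  (forall t i, Rabs (u t i - u0 i) <= M / K * exp (2 * K * Rabs t)) /\
  (forall t s i, Rabs (s - t) <= 1 -> Rabs (u s i - u t i) <= 2 * M * exp (2 * K * (Rabs t + 1)) * Rabs (s - t)).

Lemma exp_ge1 x : 0 <= x -> 1 <= exp x.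
Proof. intros [H|<-]; [rewrite <- exp_0; left; now apply exp_increasing|rewrite exp_0; lra]. Qed.

Lemma tame_field_bound u : tame u -> forall t i, Rabs (F (u t) i) <= 2 * M * exp (2 * K * Rabs t).
Proof.
  intros (H & _) t i. pose proof (Flip u0 (u t) _ (H t) i) as Hl.
  pose proof (FM i). pose proof (Rabs_triang (F (u t) i - F u0 i) (F u0 i)) as Ht.
  replace (F (u t) i - F u0 i + F u0 i) with (F (u t) i) in Ht by ring.
  replace (K * (M / K * exp (2 * K * Rabs t))) with (M * exp (2 * K * Rabs t)) in Hl by (field; lra).
  assert (1 <= exp (2 * K * Rabs t)).
  { apply exp_ge1. pose proof (Rabs_pos t); apply Rmult_le_pos; lra. }
  assert (M * 1 <= M * exp (2 * K * Rabs t)) by (apply Rmult_le_compat_l; lra). lra.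
Qed.

Lemma tame_field_continuous u i : tame u -> forall t, continuity_pt (fun s => F (u s) i) t.
Proof.
  intros (_ & H) t eps He.
  set (A := 2 * M * exp (2 * K * (Rabs t + 1))).
  assert (0 < A) as HA by (apply Rmult_lt_0_compat; [lra|apply exp_pos]).
  exists (Rmin 1 (eps / (2 * (K * A)))). assert (0 < K * A) by (apply Rmult_lt_0_compat; lra).
  split; [apply Rmin_pos; [lra|apply Rdiv_lt_0_compat; lra]|].
  intros s (_ & Hs). simpl in Hs |- *. unfold Rdist in *.
  assert (Rabs (s - t) <= 1) by (eapply Rle_trans; [left; exact Hs|apply Rmin_l]).
  assert (Rabs (s - t) <= eps / (2 * (K * A))) by (eapply Rle_trans; [left; exact Hs|apply Rmin_r]).
  eapply Rle_lt_trans; [apply (Flip (u t) (u s) (A * Rabs (s - t))); intros; now apply H|].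
  rewrite <- Rmult_assoc.
  apply Rle_lt_trans with (K * A * (eps / (2 * (K * A)))); [apply Rmult_le_compat_l; lra|].
  replace (K * A * (eps / (2 * (K * A)))) with (eps / 2) by (field; lra). lra.
Qed.

Definition picard_of (u w : R -> I -> R) : Prop :=
  (forall i, w 0 i = u0 i) /\ forall t i, derivable_pt_lim (fun s => w s i) t (F (u t) i).

Lemma picard_tame u w : tame u -> picard_of u w -> tame w.
Proof.
  intros Hu (H0 & Hd). split.
  - intros t i. replace (M / K) with (2 * M / (2 * K)) by (field; lra).
    apply (exp_growth_abs (fun s => w s i - u0 i) (fun s => F (u s) i) (2 * M) (2 * K)); [lra|lra| | |].
    + rewrite H0; ring.
    + intros s. rewrite <- (Rminus_0_r (F (u s) i)).
      apply (derivable_pt_lim_minus (fun s => w s i) (fun _ => u0 i)); [apply Hd|apply derivable_pt_lim_const].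
    + intros s; now apply tame_field_bound.
  - intros t s i Hts.
    destruct (mvt_any (fun s => w s i) (fun s => F (u s) i) t s) as (c & -> & Hc); [intros; apply Hd|].
    rewrite Rabs_mult. apply Rmult_le_compat_r; [apply Rabs_pos|].
    eapply Rle_trans; [now apply tame_field_bound|]. apply Rmult_le_compat_l; [lra|].
    assert (Rabs c <= Rabs t + 1) as Hct.
    { revert Hts Hc; unfold Rmin, Rmax, Rabs; destruct (Rle_dec t s), (Rcase_abs c), (Rcase_abs t), (Rcase_abs (s - t)); lra. }
    destruct Hct as [Hl|Hl]; [left; apply exp_increasing; apply Rmult_lt_compat_l; lra|rewrite Hl; lra].
Qed.

(** The hypothesis [tame u] stands under the existential, so that [picard_next] can be a total
    function chosen by [epsilon]. *)
Lemma picard_step u : exists w, tame u -> picard_of u w.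
Proof.
  destruct (classic (tame u)) as [Hu|Hu]; [|exists u; tauto].
  exists (fun t i => u0 i + epsilon (inhabits (fun _ : R => 0))
     (fun G => G 0 = 0 /\ forall x, derivable_pt_lim G x (F (u x) i)) t).
  intros _.
  assert (forall i, let G := epsilon (inhabits (fun _ : R => 0))
     (fun G => G 0 = 0 /\ forall x, derivable_pt_lim G x (F (u x) i)) in
     G 0 = 0 /\ forall x, derivable_pt_lim G x (F (u x) i)) as H.
  { intros i; cbv zeta. apply (epsilon_spec (inhabits (fun _ : R => 0))).
    apply (antiderivative_exists (fun s => F (u s) i)). now apply tame_field_continuous. }
  split.
  - intros i. rewrite (proj1 (H i)); ring.
  - intros t i. rewrite <- (Rplus_0_l (F (u t) i)).
    apply (derivable_pt_lim_plus (fun _ => u0 i)); [apply derivable_pt_lim_const|apply H].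
Qed.

Definition picard_next (u : R -> I -> R) : R -> I -> R :=
  epsilon (inhabits u) (fun w => tame u -> picard_of u w).

Lemma picard_next_spec u : tame u -> picard_of u (picard_next u).
Proof.
  apply (epsilon_spec (inhabits u) (fun w => tame u -> picard_of u w)), picard_step.
Qed.

(** Integrating [K * c * exp (2 * K * s)] yields the factor 1/2 for all times at once, so the
    iteration converges globally and no solution has to be continued. *)
Lemma picard_contract u w u' w' c : 0 <= c -> picard_of u u' -> picard_of w w' ->
  (forall t i, Rabs (w t i - u t i) <= c * exp (2 * K * Rabs t)) ->
  forall t i, Rabs (w' t i - u' t i) <= c * (/2) * exp (2 * K * Rabs t).
Proof.
  intros Hc (Hu0 & Hud) (Hw0 & Hwd) H t i.
  replace (c * /2) with (K * c / (2 * K)) by (field; lra).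
  apply (exp_growth_abs (fun s => w' s i - u' s i) (fun s => F (w s) i - F (u s) i)).
  - lra.
  - apply Rmult_le_pos; lra.
  - rewrite Hu0, Hw0; ring.
  - intros s; now apply derivable_pt_lim_minus.
  - intros s. rewrite Rmult_assoc. apply Flip; intros; apply H.
Qed.

Fixpoint picard_iter (n : nat) : R -> I -> R :=
  match n with O => fun _ => u0 | Datatypes.S n => picard_next (picard_iter n) end.

Lemma picard_iter_tame n : tame (picard_iter n).
Proof.
  induction n as [|n IH]; simpl.
  - split.
    + intros t i. rewrite Rabs_minus_self.
      apply Rmult_le_pos; [apply Rmult_le_pos; [lra|left; now apply Rinv_0_lt_compat]|left; apply exp_pos].
    + intros t s i _. rewrite Rabs_minus_self.
      apply Rmult_le_pos; [|apply Rabs_pos]. apply Rmult_le_pos; [lra|left; apply exp_pos].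
  - apply (picard_tame _ _ IH), picard_next_spec, IH.
Qed.

Lemma picard_iter_diff n t i :
  Rabs (picard_iter (Datatypes.S n) t i - picard_iter n t i) <= M / K * (/2)^n * exp (2 * K * Rabs t).
Proof.
  assert (0 <= M / K) as HMK by (apply Rmult_le_pos; [lra|left; now apply Rinv_0_lt_compat]).
  revert t i; induction n as [|n IH]; intros t i.
  - rewrite Rmult_1_r. apply (proj1 (picard_iter_tame 1)).
  - replace (M / K * (/2)^(Datatypes.S n)) with (M / K * (/2)^n * /2) by (simpl; ring).
    apply (picard_contract (picard_iter n) (picard_iter (Datatypes.S n))).
    + apply Rmult_le_pos; [auto|apply pow_le; lra].
    + apply picard_next_spec, picard_iter_tame.
    + apply (picard_next_spec (picard_iter (Datatypes.S n))), picard_iter_tame.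
    + apply IH.
Qed.

Lemma picard_solution : exists u : R -> I -> R, tame u /\ (forall i, u 0 i = u0 i) /\
  forall t i, derivable_pt_lim (fun s => u s i) t (F (u t) i).
Proof.
  assert (0 <= M / K) as HMK by (apply Rmult_le_pos; [lra|left; now apply Rinv_0_lt_compat]).
  set (E := fun t => exp (2 * K * Rabs t)).
  assert (forall t, 0 < E t) as HE by (intros; apply exp_pos).
  assert (forall t i, exists l, forall k, Rabs (l - picard_iter k t i) <= 2 * (M / K * E t) * (/2)^k) as H.
  { intros t i. apply geometric_limit.
    - apply Rmult_le_pos; [auto|left; apply HE].
    - intros k. replace (M / K * E t * (/2)^k) with (M / K * (/2)^k * E t) by ring. apply picard_iter_diff. }
  destruct (choice_fun _ (fun t => choice_fun _ (H t))) as (u & Hu).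
  assert (tame u) as Htame.
  { assert (forall t i eps, 0 < eps -> exists n, Rabs (u t i - picard_iter n t i) < eps) as Happ.
    { intros t i eps He. destruct (half_pow_small (2 * (M / K * E t)) eps He) as (n & Hn).
      exists n. eapply Rle_lt_trans; [apply Hu|auto]. }
    split.
    - intros t i. apply Rnot_lt_le; intros Hlt.
      destruct (Happ t i (Rabs (u t i - u0 i) - M / K * exp (2 * K * Rabs t))) as (n & Hn); [lra|].
      pose proof (proj1 (picard_iter_tame n) t i).
      pose proof (Rabs_triang (u t i - picard_iter n t i) (picard_iter n t i - u0 i)) as Ht.
      replace (u t i - picard_iter n t i + (picard_iter n t i - u0 i)) with (u t i - u0 i) in Ht by ring. lra.
    - intros t s i Hts. apply Rnot_lt_le; intros Hlt.
      set (A := 2 * M * exp (2 * K * (Rabs t + 1)) * Rabs (s - t)) in *.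
      destruct (half_pow_small (2 * (M / K * E t) + 2 * (M / K * E s)) (Rabs (u s i - u t i) - A)) as (n & Hn); [lra|].
      pose proof (proj2 (picard_iter_tame n) t s i Hts) as Hp. fold A in Hp.
      pose proof (Hu t i n); pose proof (Hu s i n).
      pose proof (Rabs_triang (u s i - picard_iter n s i) (picard_iter n s i - picard_iter n t i)) as T1.
      replace (u s i - picard_iter n s i + (picard_iter n s i - picard_iter n t i)) with (u s i - picard_iter n t i) in T1 by ring.
      pose proof (Rabs_triang (u s i - picard_iter n t i) (picard_iter n t i - u t i)) as T2.
      replace (u s i - picard_iter n t i + (picard_iter n t i - u t i)) with (u s i - u t i) in T2 by ring.
      rewrite (Rabs_minus_sym (picard_iter n t i) (u t i)) in T2. lra. }
  (* The limit [u] is tame, so it has a Picard successor [w]. By contraction the iterates converge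
     to [w] as well, hence [w = u] and [u] solves the equation. *)
  pose proof (picard_next_spec u Htame) as Hw. set (w := picard_next u) in *.
  assert (forall t i, w t i = u t i) as E1.
  { intros t i. apply NNPP; intros Hne.
    assert (0 < Rabs (w t i - u t i)) as Hp by (apply Rabs_pos_lt; lra).
    destruct (half_pow_small (2 * (M / K * E t)) _ Hp) as (n & Hn).
    assert (Rabs (w t i - picard_iter (Datatypes.S n) t i) <= 2 * (M / K) * (/2)^n * (/2) * E t) as H1.
    { apply (picard_contract (picard_iter n) u).
      - apply Rmult_le_pos; [lra|apply pow_le; lra].
      - apply picard_next_spec, picard_iter_tame.
      - exact Hw.
      - intros s k. eapply Rle_trans; [apply Hu|]. unfold E; right; ring. }
    pose proof (Hu t i (Datatypes.S n)) as H2.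
    replace ((/2)^(Datatypes.S n)) with (/2 * (/2)^n) in H2 by reflexivity.
    pose proof (Rabs_triang (w t i - picard_iter (Datatypes.S n) t i) (picard_iter (Datatypes.S n) t i - u t i)) as T2.
    replace (w t i - picard_iter (Datatypes.S n) t i + (picard_iter (Datatypes.S n) t i - u t i)) with (w t i - u t i) in T2 by ring.
    rewrite (Rabs_minus_sym (picard_iter (Datatypes.S n) t i) (u t i)) in T2. lra. }
  exists u; split; [auto|split].
  - intros i. rewrite <- E1. apply Hw.
  - intros t i. replace (fun s => u s i) with (fun s => w s i); [apply Hw|].
    apply functional_extensionality; intros; apply E1.
Qed.

End Picard.

(** * Rotation vectors *)

Section Rotation.

Lemma dotQ_cons {d} a (w : Vector.t Q d) z (k : Zd d) :
  dotQ (Vector.cons Q a d w) (Vector.cons Z z d k) = (a * inject_Z z + dotQ w k)%Q.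
Proof. unfold dotQ. now rewrite !Vector.to_list_cons. Qed.

Definition om {d} (w : Vector.t Q d) (k : Zd d) : R := Q2R (dotQ w k).

Lemma Q2R_inject_Z z : Q2R (inject_Z z) = IZR z.
Proof. unfold Q2R; simpl; field. Qed.

Lemma om_nil (w : Vector.t Q 0) k : om w k = 0.
Proof.
  revert w k. apply (Vector.case0 (fun w => forall k, om w k = 0)). apply Vector.case0.
  unfold om, dotQ, Q2R; simpl; lra.
Qed.

Lemma om_cons {d} a (w : Vector.t Q d) z (k : Zd d) :
  om (Vector.cons Q a d w) (Vector.cons Z z d k) = Q2R a * IZR z + om w k.
Proof. unfold om. now rewrite dotQ_cons, Q2R_plus, Q2R_mult, Q2R_inject_Z. Qed.

Lemma om_add {d} (w : Vector.t Q d) u v : om w (zadd u v) = om w u + om w v.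
Proof.
  induction w as [|a d w IH]; [rewrite !om_nil; ring|].
  rewrite (vec_eta u), (vec_eta v).
  rewrite zadd_cons.
  rewrite !om_cons, IH, plus_IZR; ring.
Qed.

Lemma om_scal {d} (w : Vector.t Q d) n v : om w (zscal n v) = IZR n * om w v.
Proof.
  induction w as [|a d w IH]; [rewrite !om_nil; ring|].
  rewrite (vec_eta v).
  rewrite zscal_cons.
  rewrite !om_cons, IH, mult_IZR; ring.
Qed.

Lemma om_bound {d} (w : Vector.t Q d) : exists c, 0 <= c /\ forall k, Rabs (om w k) <= c * IZR (znorm k).
Proof.
  induction w as [|a d w (c & Hc & IH)].
  - exists 0; split; [lra|]. intros k; rewrite om_nil, Rabs_R0; lra.
  - exists (Rabs (Q2R a) + c). pose proof (Rabs_pos (Q2R a)). split; [lra|].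
    intros k. rewrite (vec_eta k), om_cons, znorm_cons, plus_IZR, abs_IZR.
    eapply Rle_trans; [apply Rabs_triang|]. rewrite Rabs_mult.
    pose proof (IH (Vector.tl k)). pose proof (IZR_le _ _ (znorm_nonneg (Vector.tl k))).
    pose proof (Rabs_pos (IZR (Vector.hd k))).
    pose proof (Rmult_le_pos _ _ H H1). pose proof (Rmult_le_pos _ _ Hc H2). nra.
Qed.

(** [Q] is a common denominator of the entries of [w]. *)
Definition integral_period {d} (w : Vector.t Q d) (Q : nat) : Prop :=
  (0 < Q)%nat /\ forall v, exists l : Z, INR Q * om w v = IZR l.

Lemma integral_period_exists {d} (w : Vector.t Q d) : exists q, integral_period w q.
Proof.
  induction w as [|a d w (q & Hq & IH)].
  - exists 1%nat; split; [lia|]. intros v; exists 0%Z. rewrite om_nil; lra.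
  - exists (q * Pos.to_nat (Qden a))%nat; split; [pose proof (Pos2Nat.is_pos (Qden a)); nia|].
    intros v. destruct (IH (Vector.tl v)) as (l & Hl).
    exists (Z.of_nat q * (Qnum a * Vector.hd v) + Z.pos (Qden a) * l)%Z.
    rewrite (vec_eta v), om_cons, mult_INR, plus_IZR, !mult_IZR, <- Hl, <- INR_IZR_INZ. simpl.
    rewrite INR_IZR_INZ with (n := Pos.to_nat _), positive_nat_Z. unfold Q2R.
    field. apply not_0_IZR; discriminate.
Qed.

Lemma integral_period_mult {d} (w : Vector.t Q d) q N : (0 < N)%nat ->
  integral_period w q -> integral_period w (N * q).
Proof.
  intros HN (Hq & H); split; [nia|]. intros v; destruct (H v) as (l & Hl).
  exists (Z.of_nat N * l)%Z. rewrite mult_INR, mult_IZR, <- Hl, <- INR_IZR_INZ; ring.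
Qed.

Lemma dotQ_zero {d} (w : Vector.t Q d) k l :
  Qeq (dotQ w k + inject_Z l)%Q 0%Q <-> om w k + IZR l = 0.
Proof.
  unfold om. rewrite <- Q2R_inject_Z, <- Q2R_plus. split; intros H.
  - rewrite (Qeq_eqR _ _ H). unfold Q2R; simpl; lra.
  - apply eqR_Qeq. rewrite H. unfold Q2R; simpl; lra.
Qed.

(** The ratio 3/4, rather than 1/2, leaves room for the linear growth of configurations, see
    [linear_half_pow]. The exact sum is 7 - 6 (3/4)^n, so 8 per dimension suffices. *)
Lemma geometric_box1 n : lsum (fun z => (3/4) ^ Z.to_nat (Z.abs z)) (zrange n) <= 8 - 6 * (3/4)^n.
Proof.
  induction n as [|n IH].
  - unfold zrange; simpl; lra.
  - set (f := fun z => (3/4) ^ Z.to_nat (Z.abs z)) in *.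
    rewrite zrange_S. set (m := Z.of_nat (Datatypes.S n)).
    change (lsum f (- m :: zrange n ++ [m])%Z) with (f (- m)%Z + lsum f (zrange n ++ [m])).
    rewrite lsum_app. change (lsum f [m]) with (f m + 0).
    assert (f (- m)%Z = (3/4)^(Datatypes.S n) /\ f m = (3/4)^(Datatypes.S n)) as (-> & ->).
    { unfold f; split; f_equal; lia. }
    simpl pow. lra.
Qed.

Lemma geometric_box d n : lsum (fun i => (3/4) ^ Z.to_nat (znorm i)) (box d n) <= 8 ^ d.
Proof.
  rewrite box_grid. induction d as [|d IH].
  - simpl; lra.
  - rewrite lsum_grid_S.
    rewrite (lsum_ext _ (fun z => lsum (fun i => (3/4) ^ Z.to_nat (znorm i)) (grid d (zrange n)) * (3/4) ^ Z.to_nat (Z.abs z))).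
    + rewrite lsum_scal. pose proof (geometric_box1 n) as H1.
      assert (0 < (3/4)^n) by (apply pow_lt; lra).
      simpl pow. rewrite (Rmult_comm 8).
      apply Rmult_le_compat; [|  |auto|lra]; apply lsum_ge0; intros; apply pow_le; lra.
    + intros z _. rewrite Rmult_comm, <- lsum_scal. apply lsum_ext; intros v _.
      rewrite znorm_cons, <- pow_add. f_equal. pose proof (znorm_nonneg v); lia.
Qed.

Lemma half_le_geometric n : (/2)^n <= (3/4)^n.
Proof. apply pow_incr; lra. Qed.

(** Bernoulli's inequality for the base 3/2, together with 3/4 = 3/2 times 1/2. *)
Lemma linear_half_pow n : INR n * (/2)^n <= 2 * (3/4)^n.
Proof.
  assert (INR n <= 2 * (3/2)^n) as H.
  { pose proof (poly n (1/2) ltac:(lra)) as H. replace (1 + 1/2) with (3/2) in H by field. lra. }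
  replace (3/4) with (3/2 * /2) by field. rewrite Rpow_mult_distr, <- Rmult_assoc.
  apply Rmult_le_compat_r; [apply pow_le; lra|auto].
Qed.

End Rotation.

(** * The weighted norm and configurations near the linear one *)

Section WeightedSums.
Context {d : nat}.

Lemma wsum_triang (a b c : config d) n : (forall i, Rabs (a i) <= Rabs (b i) + Rabs (c i)) ->
  wsum a n <= wsum b n + wsum c n.
Proof.
  intros H. unfold wsum. rewrite <- lsum_plus. apply lsum_le; intros i _.
  rewrite <- Rmult_plus_distr_l. apply Rmult_le_compat_l; [apply pow_le; lra|auto].
Qed.

Lemma wsum_sup (a : config d) dl n : 0 <= dl -> (forall i, Rabs (a i) <= dl) -> wsum a n <= 8 ^ d * dl.
Proof.
  intros Hd H. unfold wsum. apply Rle_trans with (dl * lsum (fun i => (3/4) ^ Z.to_nat (znorm i)) (box d n)).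
  - rewrite <- lsum_scal. apply lsum_le; intros i _. rewrite Rmult_comm.
    apply Rmult_le_compat; [apply Rabs_pos|apply pow_le; lra|auto|apply half_le_geometric].
  - rewrite Rmult_comm. apply Rmult_le_compat_r; [auto|apply geometric_box].
Qed.

Lemma wsum_zero (a : config d) : (forall n, wsum a n <= 0) -> forall i, a i = 0.
Proof.
  intros H i. specialize (H (Z.to_nat (znorm i))). apply NNPP; intros Hne.
  assert ((/2) ^ Z.to_nat (znorm i) * Rabs (a i) <= 0) as H1.
  { eapply Rle_trans; [|exact H]. apply (lsum_mem_le (fun i => (/2) ^ Z.to_nat (znorm i) * Rabs (a i))).
    - intros; apply Rmult_le_pos; [apply pow_le; lra|apply Rabs_pos].
    - apply znorm_box. pose proof (znorm_nonneg i); lia. }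
  assert (0 < (/2) ^ Z.to_nat (znorm i) * Rabs (a i)); [|lra].
  apply Rmult_lt_0_compat; [apply pow_lt; lra|now apply Rabs_pos_lt].
Qed.

Variable w : Vector.t Q d.

(** Bounded perturbations of the linear configuration. They lie in X, any two are at finite sup
    distance, and translations and the flow preserve them. *)
Definition Lin (x : config d) : Prop := exists M, forall i, Rabs (x i - om w i) <= M.

Lemma Lin_inX x : Lin x -> inX x.
Proof.
  intros (M & HM). destruct (om_bound w) as (c & Hc & Ho).
  exists (2 * c * 8 ^ d + 8 ^ d * Rabs M). intros n.
  eapply Rle_trans; [apply (wsum_triang x (om w) (fun i => x i - om w i))|].
  - intros i. pose proof (Rabs_triang (om w i) (x i - om w i)) as H.
    replace (om w i + (x i - om w i)) with (x i) in H by ring. auto.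
  - apply Rplus_le_compat.
    + unfold wsum. apply Rle_trans with (2 * c * lsum (fun i => (3/4) ^ Z.to_nat (znorm i)) (box d n)).
      * rewrite <- lsum_scal. apply lsum_le; intros i _.
        apply Rle_trans with (c * (INR (Z.to_nat (znorm i)) * (/2) ^ Z.to_nat (znorm i))).
        -- rewrite INR_IZR_INZ, Z2Nat.id by apply znorm_nonneg.
           rewrite <- Rmult_assoc, Rmult_comm. apply Rmult_le_compat_r; [apply pow_le; lra|apply Ho].
        -- rewrite (Rmult_comm 2 c), Rmult_assoc. apply Rmult_le_compat_l; [auto|apply linear_half_pow].
      * apply Rmult_le_compat_l; [lra|apply geometric_box].
    + apply wsum_sup; [apply Rabs_pos|]. intros i; eapply Rle_trans; [apply HM|apply Rle_abs].
Qed.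

Lemma Lin_tau x k l : Lin x -> Lin (tau k l x).
Proof.
  intros (M & HM). exists (M + Rabs (om w k + IZR l)). intros i. unfold tau.
  replace (x (zadd i k) + IZR l - om w i) with ((x (zadd i k) - om w (zadd i k)) + (om w k + IZR l))
    by (rewrite om_add; ring).
  eapply Rle_trans; [apply Rabs_triang|]. specialize (HM (zadd i k)); lra.
Qed.

(** At the linear configuration [o] the field is bounded because translating by [i] changes [o] by
    [om w i], an integer shift brings this within 1, and the field does not see integer shifts. The
    Lipschitz bound covers the rest. *)
Lemma V_Lin_bounded P x : Lin x -> exists M, 0 < M /\ forall i, Rabs (V P x i) <= M.
Proof.
  intros (M & HM). pose proof (Kc_pos P) as HK.
  set (o := fun i : Zd d => om w i).
  exists (Rabs (V P o zz) + Kc P * 1 + Kc P * Rabs M + 1).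
  pose proof (Rabs_pos (V P o zz)); pose proof (Rabs_pos M).
  pose proof (Rmult_le_pos _ _ (Rlt_le _ _ HK) H0).
  split; [lra|]. intros i.
  assert (Rabs (V P x i - V P o i) <= Kc P * Rabs M) as H2.
  { apply V_lip. intros j; eapply Rle_trans; [apply HM|apply Rle_abs]. }
  destruct (archimed (om w i)) as (Ha & Hb).
  set (l := (- up (om w i))%Z).
  assert (Rabs (V P (tau i l o) zz - V P o zz) <= Kc P * 1) as H3.
  { apply V_lip. intros j. unfold tau, o, l. rewrite om_add, opp_IZR. apply Rabs_le; lra. }
  rewrite V_tau in H3. replace (zadd zz i) with i in H3 by zvec.
  pose proof (Rabs_triang (V P x i - V P o i) (V P o i)) as T1.
  replace (V P x i - V P o i + V P o i) with (V P x i) in T1 by ring.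
  pose proof (Rabs_triang (V P o i - V P o zz) (V P o zz)) as T2.
  replace (V P o i - V P o zz + V P o zz) with (V P o i) in T2 by ring. lra.
Qed.

End WeightedSums.

(** * The gradient flow *)

Section FlowLines.
Context {d : nat}.
Variable P : LocalPotentials d.
Variable w : Vector.t Q d.

Lemma lsum_derivable {A} (f : A -> R -> R) (f' : A -> R) t l :
  (forall a, derivable_pt_lim (f a) t (f' a)) ->
  derivable_pt_lim (fun s => lsum (fun a => f a s) l) t (lsum f' l).
Proof.
  intros H. induction l as [|a l IH]; simpl; [apply derivable_pt_lim_const|].
  now apply (derivable_pt_lim_plus (f a)).
Qed.

(** Compactness of [[0, T]], by the supremum of the endpoints up to which one bound holds. It
    supplies the a priori bound that [gronwall] asks for. *)
Lemma locally_bounded_above (f : nat -> R -> R) T : 0 <= T ->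
  (forall t, exists dl M, 0 < dl /\ forall s, Rabs (s - t) < dl -> forall n, f n s <= M) ->
  exists M, forall s, 0 <= s <= T -> forall n, f n s <= M.
Proof.
  intros HT H.
  set (E := fun s => 0 <= s <= T /\ exists M, forall r, 0 <= r <= s -> forall n, f n r <= M).
  destruct (completeness E) as (m & Hm1 & Hm2).
  - exists T; intros s Hs; apply Hs.
  - exists 0; split; [lra|]. destruct (H 0) as (dl & M & Hd & HM). exists M; intros r Hr n.
    apply HM. replace r with 0 by lra. rewrite Rabs_minus_self; lra.
  - destruct (H m) as (dl & M & Hd & HM).
    assert (exists s, E s /\ m - dl < s) as (s & Hs & Hsm).
    { apply NNPP; intros Hn. assert (m <= m - dl); [|lra]. apply Hm2. intros s Hs.
      apply Rnot_lt_le; intros Hlt. apply Hn; exists s; auto. }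
    assert (s <= m) as Hsm' by now apply Hm1.
    destruct Hs as (Hs & M' & HM').
    set (s' := Rmin T (m + dl / 2)).
    assert (E s') as Hs'.
    { unfold s'; split; [split; [apply Rmin_glb; lra|apply Rmin_l]|].
      exists (Rmax M M'). intros r Hr n. pose proof (Rmin_r T (m + dl/2)).
      destruct (Rle_or_lt r s) as [Hrs|Hrs].
      - eapply Rle_trans; [apply HM'; lra|apply Rmax_r].
      - eapply Rle_trans; [apply HM; apply Rabs_def1; lra|apply Rmax_l]. }
    assert (s' = T) as E1.
    { pose proof (Hm1 _ Hs'). unfold s' in *. revert H0; unfold Rmin; destruct (Rle_dec T (m + dl/2)); lra. }
    rewrite E1 in Hs'. apply Hs'.
Qed.

Lemma flow_line_derivable g : flow_line P g ->
  forall t i, derivable_pt_lim (fun s => g s i) t (V P (g t) i).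
Proof. intros (_ & _ & H); exact H. Qed.

Lemma derivable_pt_lim_rescale (f : R -> R) e t l : derivable_pt_lim f (e * t) l ->
  derivable_pt_lim (fun s => f (e * s)) t (e * l).
Proof.
  intros H. replace (e * l) with (l * (e * 1)) by ring.
  apply (derivable_pt_lim_comp (fun s => e * s) f); [|exact H].
  apply derivable_pt_lim_scal, derivable_pt_lim_id.
Qed.

Lemma sign_abs e s : e = 1 \/ e = -1 -> Rabs (e * s) = Rabs s.
Proof. intros [->| ->]; unfold Rabs; do 2 destruct Rcase_abs; lra. Qed.

(** Negative times are reduced to positive ones by running curves as [e * s]; Lipschitz bounds do
    not see the sign. *)
Lemma sign_decomposition t : exists e, (e = 1 \/ e = -1) /\ 0 <= e * t /\ e * (e * t) = t.
Proof.
  destruct (Rle_or_lt 0 t); [exists 1|exists (-1)]; (split; [auto|split; lra]).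
Qed.

Lemma flow_line_diff_bounded g h e T : 0 <= T -> e = 1 \/ e = -1 -> flow_line P g -> flow_line P h ->
  exists M, forall s, 0 <= s <= T -> forall n, wsum (fun i => g (e * s) i - h (e * s) i) n <= M.
Proof.
  intros HT He (Hg1 & Hg2 & _) (Hh1 & Hh2 & _).
  apply (locally_bounded_above (fun n s => wsum (fun i => g (e * s) i - h (e * s) i) n) T HT).
  intros t. destruct (Hg2 (e * t) 1 ltac:(lra)) as (d1 & Hd1 & H1).
  destruct (Hh2 (e * t) 1 ltac:(lra)) as (d2 & Hd2 & H2).
  destruct (Hg1 (e * t)) as (M1 & HM1). destruct (Hh1 (e * t)) as (M2 & HM2).
  exists (Rmin d1 d2), (1 + (1 + (M1 + M2))). split; [now apply Rmin_pos|].
  intros s Hs n.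
  assert (Rabs (e * s - e * t) < Rmin d1 d2) as Hs'.
  { rewrite <- Rmult_minus_distr_l, sign_abs; auto. }
  assert (Rabs (e * s - e * t) < d1) by (eapply Rlt_le_trans; [exact Hs'|apply Rmin_l]).
  assert (Rabs (e * s - e * t) < d2) by (eapply Rlt_le_trans; [exact Hs'|apply Rmin_r]).
  eapply Rle_trans; [apply (wsum_triang _ (fun i => g (e * s) i - g (e * t) i) (fun i => h (e * s) i - g (e * t) i))|].
  { intros i. rewrite <- (Rabs_Ropp (h (e * s) i - _)). eapply Rle_trans; [|apply Rabs_triang]. right; f_equal; ring. }
  apply Rplus_le_compat; [now apply H1|].
  eapply Rle_trans; [apply (wsum_triang _ (fun i => h (e * s) i - h (e * t) i) (fun i => h (e * t) i - g (e * t) i))|].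
  { intros i. eapply Rle_trans; [|apply Rabs_triang]. right; f_equal; ring. }
  apply Rplus_le_compat; [now apply H2|].
  eapply Rle_trans; [apply (wsum_triang _ (g (e * t)) (h (e * t)))|].
  { intros i. rewrite <- (Rabs_Ropp (g (e * t) i)), Rplus_comm. eapply Rle_trans; [|apply Rabs_triang]. right; f_equal; ring. }
  apply Rplus_le_compat; auto.
Qed.

(** Two flow lines are not known to be at finite sup distance, so Gronwall is run in the weighted
    norm. *)
Lemma flow_line_unique g h : flow_line P g -> flow_line P h -> g 0 = h 0 -> forall t, g t = h t.
Proof.
  intros Hg Hh H0 t0. destruct (sign_decomposition t0) as (e & He & Hpos & Het).
  set (T := e * t0) in *. rewrite <- Het.
  destruct (flow_line_diff_bounded g h e T Hpos He Hg Hh) as (M & HM).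
  pose proof (flow_line_derivable g Hg) as Dg. pose proof (flow_line_derivable h Hh) as Dh.
  pose proof (Kw_nonneg P) as HK.
  set (sg := fun (s : Zd d -> bool) i => if s i then 1 else -1).
  set (wt := fun i : Zd d => (/2) ^ Z.to_nat (znorm i)).
  assert (forall i, 0 <= wt i) as Hwt by (intros; apply pow_le; lra).
  (* A partial weighted norm need not be differentiable, but it is the maximum of linear functionals
     over all sign patterns. The index therefore carries a box size and a pattern, and each member
     of the family is differentiable. *)
  set (v := fun (p : nat * (Zd d -> bool)) t =>
     lsum (fun i => wt i * sg (snd p) i * (g (e * t) i - h (e * t) i)) (box d (fst p))).
  assert (forall s i r, sg s i * r <= Rabs r) as Hsg.
  { intros s i r; unfold sg, Rabs; destruct (s i), Rcase_abs; lra. }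
  assert (forall p t, 0 <= t <= T -> v p t <= 2 * 0 * exp (2 * (Kw P + 1) * t)) as Hv.
  { apply (gronwall v (fun p t => lsum (fun i => wt i * sg (snd p) i *
       (e * (V P (g (e * t)) i) - e * V P (h (e * t)) i)) (box d (fst p))) (Kw P + 1) T M 0).
    - lra.
    - lra.
    - intros p t _. apply (lsum_derivable (fun i t => wt i * sg (snd p) i * (g (e * t) i - h (e * t) i))).
      intros i. apply (derivable_pt_lim_scal (fun t => g (e * t) i - h (e * t) i)).
      apply (derivable_pt_lim_minus (fun t => g (e * t) i) (fun t => h (e * t) i));
        apply (derivable_pt_lim_rescale (fun t => _ t i)); auto.
    - intros t N Ht HN Hall p.
      assert (forall n, wsum (fun i => g (e * t) i - h (e * t) i) n <= N) as Hn.
      { intros n. set (s := fun i => if Rle_dec 0 (g (e * t) i - h (e * t) i) then true else false).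
        eapply Rle_trans; [|apply (Hall (n, s))]. right. unfold v, wsum; simpl.
        apply lsum_ext; intros i _. rewrite Rmult_assoc. f_equal. unfold sg, s.
        destruct (Rle_dec 0 _); unfold Rabs; destruct Rcase_abs; lra. }
      apply Rle_trans with (Kw P * N); [|lra].
      eapply Rle_trans; [|apply (V_wlip P _ _ N (fst p) Hn)].
      apply lsum_le; intros i _. rewrite Rmult_assoc. fold (wt i). apply Rmult_le_compat_l; [auto|].
      rewrite <- Rmult_minus_distr_l, <- Rmult_assoc.
      destruct He as [->| ->]; unfold sg, Rabs; destruct (snd p i), Rcase_abs; lra.
    - intros p. unfold v. rewrite Rmult_0_r, H0. right. rewrite (lsum_ext _ (fun _ => 0)); [rewrite lsum_const; ring|].
      intros; ring.
    - intros p t Ht. eapply Rle_trans; [|apply (HM t Ht (fst p))]. unfold v, wsum.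
      apply lsum_le; intros i _. rewrite Rmult_assoc. apply Rmult_le_compat_l; [apply Hwt|apply Hsg]. }
  apply functional_extensionality; intros i. apply Rminus_diag_uniq. revert i. apply wsum_zero.
  intros n. set (s := fun i => if Rle_dec 0 (g (e * T) i - h (e * T) i) then true else false).
  specialize (Hv (n, s) T ltac:(lra)). replace 0 with (2 * 0 * exp (2 * (Kw P + 1) * T)) by ring.
  eapply Rle_trans; [|exact Hv]. right. unfold v, wsum; simpl.
  apply lsum_ext; intros i _. rewrite Rmult_assoc. unfold wt; f_equal. unfold sg, s.
  destruct (Rle_dec 0 _); unfold Rabs; destruct Rcase_abs; lra.
Qed.

Definition locally_Lin (g : R -> config d) : Prop :=
  forall T, exists M, forall t, Rabs t <= T -> forall i, Rabs (g t i - om w i) <= M.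

Lemma flow_line_exists x : Lin w x -> exists g, (flow_line P g /\ locally_Lin g) /\ g 0 = x.
Proof.
  intros Hx. destruct (V_Lin_bounded w P x Hx) as (M & HM & HV).
  pose proof (Kc_pos P) as HK.
  destruct (picard_solution (V P) (Kc P) x M HK HM (V_lip P) HV) as (u & (T1 & T2) & H0 & Hd).
  exists u. assert (locally_Lin u) as HL.
  { intros T. destruct Hx as (M' & HM'). exists (M / Kc P * exp (2 * Kc P * Rabs T) + M'). intros t Ht i.
    pose proof (Rabs_triang (u t i - x i) (x i - om w i)) as Htr.
    replace (u t i - x i + (x i - om w i)) with (u t i - om w i) in Htr by ring.
    specialize (T1 t i). specialize (HM' i).
    assert (M / Kc P * exp (2 * Kc P * Rabs t) <= M / Kc P * exp (2 * Kc P * Rabs T)); [|lra].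
    apply Rmult_le_compat_l; [apply Rmult_le_pos; [lra|left; now apply Rinv_0_lt_compat]|].
    assert (Rabs t <= Rabs T) as Hle by (pose proof (Rle_abs T); lra).
    destruct Hle as [Hl|E]; [left; apply exp_increasing, Rmult_lt_compat_l; lra|rewrite E; lra]. }
  split; [split; [split; [|split]|auto]|now apply functional_extensionality].
  - intros t. apply (Lin_inX w). destruct (HL (Rabs t)) as (M' & HM'). exists M'; apply HM'; lra.
  - intros t eps He. set (A := 2 * M * exp (2 * Kc P * (Rabs t + 1))).
    assert (0 < A) as HA by (apply Rmult_lt_0_compat; [lra|apply exp_pos]).
    assert (0 < 8 ^ d) as H8 by (apply pow_lt; lra).
    assert (0 < 8 ^ d * A) by (apply Rmult_lt_0_compat; lra).
    exists (Rmin 1 (eps / (8 ^ d * A))). split; [apply Rmin_pos; [lra|now apply Rdiv_lt_0_compat]|].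
    intros s Hs n.
    assert (Rabs (s - t) < 1) by (eapply Rlt_le_trans; [exact Hs|apply Rmin_l]).
    assert (Rabs (s - t) < eps / (8 ^ d * A)) by (eapply Rlt_le_trans; [exact Hs|apply Rmin_r]).
    apply Rle_trans with (8 ^ d * (A * Rabs (s - t))).
    + apply wsum_sup; [apply Rmult_le_pos; [lra|apply Rabs_pos]|]. intros i; apply T2; lra.
    + apply Rle_trans with (8 ^ d * A * (eps / (8 ^ d * A))).
      * rewrite <- Rmult_assoc. apply Rmult_le_compat_l; lra.
      * right; field; lra.
  - exact Hd.
Qed.

(** Total by [epsilon], and meaningful for [Lin] starting points, where [flow_line_unique] leaves a
    single candidate. *)
Definition Phi (x : config d) : R -> config d :=
  epsilon (inhabits (fun _ => x)) (fun g => (flow_line P g /\ locally_Lin g) /\ g 0 = x).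

Lemma Phi_spec x : Lin w x -> (flow_line P (Phi x) /\ locally_Lin (Phi x)) /\ Phi x 0 = x.
Proof.
  intros H. apply (epsilon_spec (inhabits (fun _ => x))
    (fun g => (flow_line P g /\ locally_Lin g) /\ g 0 = x)), flow_line_exists, H.
Qed.

Lemma Phi_flow x : Lin w x -> flow_line P (Phi x).
Proof. intros H; apply (Phi_spec x H). Qed.

Lemma Phi_0 x : Lin w x -> Phi x 0 = x.
Proof. intros H; apply (Phi_spec x H). Qed.

Lemma Phi_Lin x t : Lin w x -> Lin w (Phi x t).
Proof.
  intros H. destruct (proj2 (proj1 (Phi_spec x H)) (Rabs t)) as (M & HM). exists M; apply HM; lra.
Qed.

Lemma Phi_derivable x : Lin w x -> forall t i, derivable_pt_lim (fun s => Phi x s i) t (V P (Phi x t) i).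
Proof. intros H; apply flow_line_derivable, Phi_flow, H. Qed.

Lemma Phi_unique g x t : flow_line P g -> g 0 = x -> Lin w x -> Phi x t = g t.
Proof.
  intros Hg H0 Hx. apply flow_line_unique; [now apply Phi_flow|auto|]. now rewrite Phi_0.
Qed.

Lemma flow_line_shift g s : flow_line P g -> flow_line P (fun t => g (t + s)).
Proof.
  intros (H1 & H2 & H3). split; [|split].
  - intros t; apply H1.
  - intros t eps He. destruct (H2 (t + s) eps He) as (dl & Hd & H). exists dl; split; [auto|].
    intros r Hr. apply H. replace (r + s - (t + s)) with (r - t) by ring. auto.
  - intros t i. apply (derivable_pt_lim_shift (fun t => g t i)), H3.
Qed.

Lemma Phi_add x s t : Lin w x -> Phi (Phi x s) t = Phi x (t + s).
Proof.
  intros H. apply (Phi_unique (fun t => Phi x (t + s))).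
  - now apply flow_line_shift, Phi_flow.
  - now rewrite Rplus_0_l.
  - now apply Phi_Lin.
Qed.

Lemma flow_line_tau g k l : (forall t, Lin w (g t)) -> flow_line P g -> flow_line P (fun t => tau k l (g t)).
Proof.
  intros HL (H1 & H2 & H3). split; [|split].
  - intros t; apply (Lin_inX w), Lin_tau, HL.
  - intros t eps He. set (A := 2 ^ Z.to_nat (znorm k)). assert (0 < A) as HA by (apply pow_lt; lra).
    destruct (H2 t (eps / A)) as (dl & Hd & H); [now apply Rdiv_lt_0_compat|].
    exists dl; split; [auto|]. intros s Hs n.
    apply Rle_trans with (A * (eps / A)); [|right; field; lra].
    eapply Rle_trans; [|apply (wsum_shift (fun i => g s i - g t i) (eps / A) k n (H s Hs))].
    right. apply lsum_ext; intros i _. f_equal; f_equal. unfold tau; ring.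
  - intros t i. unfold tau at 1. change (- gradW P (tau k l (g t)) i) with (V P (tau k l (g t)) i).
    rewrite V_tau. rewrite <- (Rplus_0_r (V P (g t) (zadd i k))).
    apply (derivable_pt_lim_plus (fun s => g s (zadd i k)) (fun _ => IZR l)); [apply H3|apply derivable_pt_lim_const].
Qed.

Lemma Phi_tau x k l t : Lin w x -> Phi (tau k l x) t = tau k l (Phi x t).
Proof.
  intros H. apply (Phi_unique (fun t => tau k l (Phi x t))).
  - apply flow_line_tau; [intros; now apply Phi_Lin|now apply Phi_flow].
  - now rewrite Phi_0.
  - now apply Lin_tau.
Qed.

Lemma Phi_equilibrium x t : Lin w x -> (forall i, V P x i = 0) -> Phi x t = x.
Proof.
  intros H HV. apply (Phi_unique (fun _ => x)); auto. split; [|split].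
  - intros; now apply (Lin_inX w).
  - intros t0 eps He. exists 1; split; [lra|]. intros s _ n. eapply Rle_trans; [apply wsum_sup with (dl := 0)|]; [lra| |lra].
    intros i. replace (x i - x i) with 0 by ring. rewrite Rabs_R0; lra.
  - intros t0 i. change (- gradW P x i) with (V P x i). rewrite HV. apply derivable_pt_lim_const.
Qed.

Lemma equilibrium_of_Phi x : Lin w x -> (forall t, 0 < t -> Phi x t = x) -> forall i, V P x i = 0.
Proof.
  (* The derivative is taken at time 1, inside the positive times at which [x] is assumed fixed. *)
  intros H HP i. apply (uniqueness_limite (fun s => Phi x s i) 1).
  - pose proof (Phi_derivable x H 1 i) as Hd. now rewrite HP in Hd by lra.
  - intros eps He. exists (mkposreal (1/2) ltac:(lra)). intros h Hh Hh'. simpl in Hh'.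
    apply Rabs_def2 in Hh'. rewrite !HP by lra.
    replace ((x i - x i) / h - 0) with 0 by (field; auto). rewrite Rabs_R0; auto.
Qed.

Lemma Phi_lipschitz x y dl t : Lin w x -> Lin w y -> 0 <= dl ->
  (forall i, Rabs (y i - x i) <= dl) -> forall i, Rabs (Phi y t i - Phi x t i) <= 2 * dl * exp (2 * Kc P * Rabs t).
Proof.
  intros Hx Hy Hdl H. destruct (sign_decomposition t) as (e & He & Hpos & Het).
  set (T := e * t) in *. replace (Rabs t) with T.
  2:{ rewrite <- (sign_abs e t He). fold T. rewrite Rabs_right; lra. }
  rewrite <- Het.
  destruct (proj2 (proj1 (Phi_spec x Hx)) T) as (M1 & HM1).
  destruct (proj2 (proj1 (Phi_spec y Hy)) T) as (M2 & HM2).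
  pose proof (Kc_pos P) as HK.
  (* Bounding both signed differences from above bounds the absolute value; [gronwall] itself is
     one-sided. *)
  set (sg := fun b : bool => if b then 1 else -1).
  assert (forall b r, sg b * r <= Rabs r) as Hsg.
  { intros b r; unfold sg, Rabs; destruct b, Rcase_abs; lra. }
  assert (forall p s, 0 <= s <= T -> sg (snd p) * (Phi y (e * s) (fst p) - Phi x (e * s) (fst p)) <= 2 * dl * exp (2 * Kc P * s)) as Hv.
  { apply (gronwall (fun (p : Zd d * bool) s => sg (snd p) * (Phi y (e * s) (fst p) - Phi x (e * s) (fst p)))
      (fun p s => sg (snd p) * (e * V P (Phi y (e * s)) (fst p) - e * V P (Phi x (e * s)) (fst p))) (Kc P) T (M2 + M1)); auto.
    - intros p s _. apply (derivable_pt_lim_scal (fun s => Phi y (e * s) (fst p) - Phi x (e * s) (fst p))).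
      apply (derivable_pt_lim_minus (fun s => Phi y (e * s) (fst p)) (fun s => Phi x (e * s) (fst p)));
        apply (derivable_pt_lim_rescale (fun s => Phi _ s (fst p))); auto; now apply Phi_derivable.
    - intros s M _ HM Hall p.
      assert (forall i, Rabs (Phi y (e * s) i - Phi x (e * s) i) <= M) as Hall'.
      { intros i. apply Rabs_le. pose proof (Hall (i, true)) as A1; pose proof (Hall (i, false)) as A2.
        unfold sg in A1, A2; simpl in A1, A2. lra. }
      eapply Rle_trans; [|apply (V_lip P _ _ M Hall' (fst p))].
      rewrite <- Rmult_minus_distr_l, <- Rmult_assoc.
      destruct He as [->| ->]; unfold sg, Rabs; destruct (snd p), Rcase_abs; lra.
    - intros p. rewrite Rmult_0_r, !Phi_0 by auto. eapply Rle_trans; [apply Hsg|apply H].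
    - intros p s Hs. eapply Rle_trans; [apply Hsg|].
      assert (Rabs (e * s) <= T) as Hes by (rewrite sign_abs by auto; rewrite Rabs_right; lra).
      specialize (HM1 (e * s) Hes (fst p)). specialize (HM2 (e * s) Hes (fst p)).
      rewrite Rabs_minus_sym in HM1.
      eapply Rle_trans; [|apply Rplus_le_compat; [exact HM2|exact HM1]].
      eapply Rle_trans; [|apply Rabs_triang]. right; f_equal; ring. }
  intros i. apply Rabs_le. pose proof (Hv (i, true) T ltac:(lra)) as A1; pose proof (Hv (i, false) T ltac:(lra)) as A2.
  unfold sg in A1, A2; simpl in A1, A2. lra.
Qed.

(* [v -> V v + Kc v] is order preserving, so [exp (Kc t) (g - h)] satisfies a one-sided linear inequality. *)
Lemma comparison (g h g' h' : R -> config d) T M0 :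
  (forall t i, 0 <= t <= T -> derivable_pt_lim (fun s => g s i) t (g' t i)) ->
  (forall t i, 0 <= t <= T -> derivable_pt_lim (fun s => h s i) t (h' t i)) ->
  (forall t i, 0 <= t <= T -> g' t i <= V P (g t) i) ->
  (forall t i, 0 <= t <= T -> V P (h t) i <= h' t i) ->
  (forall t i, 0 <= t <= T -> g t i - h t i <= M0) ->
  (forall i, g 0 i <= h 0 i) -> forall t i, 0 <= t <= T -> g t i <= h t i.
Proof.
  intros Dg Dh Sg Sh HM H0 t0 i0 Ht0. pose proof (Kc_pos P) as HK. set (K := Kc P) in *.
  assert (exp (K * t0) * (g t0 i0 - h t0 i0) <= 2 * 0 * exp (2 * (2 * K) * t0)) as Hv.
  { revert t0 Ht0. revert i0.
    apply (gronwall (fun i t => exp (K * t) * (g t i - h t i))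
      (fun i t => K * exp (K * t) * (g t i - h t i) + exp (K * t) * (g' t i - h' t i)) (2 * K) T (exp (K * T) * Rabs M0)).
    - lra.
    - lra.
    - intros i t Ht. apply (derivable_pt_lim_mult (fun t => exp (K * t)) (fun t => g t i - h t i)).
      + apply derivable_pt_lim_exp_lin.
      + apply (derivable_pt_lim_minus (fun s => g s i) (fun s => h s i)); auto.
    - intros t M Ht HM' Hall i. set (E := exp (K * t)) in *.
      assert (0 < E) as HE by apply exp_pos.
      set (D := M / E).
      assert (0 <= D) as HD by (apply Rmult_le_pos; [auto|left; now apply Rinv_0_lt_compat]).
      assert (E * D = M) as HED by (unfold D; field; lra).
      (* [D] undoes the exponential weight. The field at [g] is compared with that at [h + D] by
         quasimonotonicity, and the latter with that at [h] by the Lipschitz bound; this is where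
         the constant [2 * K] comes from. *)
      assert (forall j, g t j <= h t j + D) as Hle.
      { intros j. apply Rmult_le_reg_l with E; [auto|]. specialize (Hall j). lra. }
      pose proof (V_quasimonotone P (g t) (fun j => h t j + D) Hle i) as Hq. fold K in Hq.
      assert (Rabs (V P (fun j => h t j + D) i - V P (h t) i) <= K * D) as Hl.
      { apply V_lip. intros j. replace (h t j + D - h t j) with D by ring. rewrite Rabs_right; lra. }
      apply Rabs_le_inv in Hl. specialize (Sg t i Ht). specialize (Sh t i Ht). cbv beta in Hq.
      assert (g' t i - h' t i <= K * (h t i - g t i) + 2 * K * D) as Hf by lra.
      apply Rle_trans with (K * E * (g t i - h t i) + E * (K * (h t i - g t i) + 2 * K * D)).
      + apply Rplus_le_compat_l, Rmult_le_compat_l; lra.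
      + rewrite <- HED. right; ring.
    - intros i. rewrite Rmult_0_r, exp_0. specialize (H0 i); lra.
    - intros i t Ht. specialize (HM t i Ht).
      assert (exp (K * t) <= exp (K * T)) as Hexp.
      { destruct (Rle_lt_or_eq_dec t T (proj2 Ht)) as [Hl| ->]; [left; apply exp_increasing, Rmult_lt_compat_l; auto|lra]. }
      pose proof (exp_pos (K * t)).
      apply Rle_trans with (exp (K * t) * Rabs M0).
      + apply Rmult_le_compat_l; [lra|]. pose proof (Rle_abs M0); lra.
      + apply Rmult_le_compat_r; [apply Rabs_pos|auto]. }
  rewrite Rmult_0_r, Rmult_0_l in Hv.
  apply Rnot_lt_le; intros Hlt. pose proof (exp_pos (K * t0)).
  assert (0 < exp (K * t0) * (g t0 i0 - h t0 i0)) by (apply Rmult_lt_0_compat; lra). lra.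
Qed.

Lemma Phi_diff_bounded x y T : Lin w x -> Lin w y ->
  exists M, forall t i, 0 <= t <= T -> Phi x t i - Phi y t i <= M.
Proof.
  intros Hx Hy. destruct (proj2 (proj1 (Phi_spec x Hx)) T) as (M1 & HM1).
  destruct (proj2 (proj1 (Phi_spec y Hy)) T) as (M2 & HM2).
  exists (M1 + M2). intros t i Ht. specialize (HM1 t ltac:(rewrite Rabs_right; lra) i).
  specialize (HM2 t ltac:(rewrite Rabs_right; lra) i). apply Rabs_le_inv in HM1, HM2. lra.
Qed.

Lemma Phi_mono x y t : Lin w x -> Lin w y -> (forall i, x i <= y i) -> 0 <= t ->
  forall i, Phi x t i <= Phi y t i.
Proof.
  intros Hx Hy H Ht i. destruct (Phi_diff_bounded x y t Hx Hy) as (M & HM).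
  apply (comparison (Phi x) (Phi y) (fun t => V P (Phi x t)) (fun t => V P (Phi y t)) t M);
    try (intros; lra); try (intros; now apply Phi_derivable).
  - intros; now apply HM.
  - rewrite !Phi_0; auto.
Qed.

(** The constant curve at [x] is a subsolution, so [comparison] applies to it. *)
Lemma Phi_subsolution x t : Lin w x -> (forall i, 0 <= V P x i) -> 0 <= t -> forall i, x i <= Phi x t i.
Proof.
  intros Hx H Ht i. destruct (proj2 (proj1 (Phi_spec x Hx)) t) as (M & HM).
  destruct Hx as (M' & HM').
  apply (comparison (fun _ => x) (Phi x) (fun _ _ => 0) (fun t => V P (Phi x t)) t (M' + M));
    try (intros; lra).
  - intros; apply derivable_pt_lim_const.
  - intros; apply Phi_derivable; now exists M'.
  - intros; apply H.
  - intros s j Hs. specialize (HM s ltac:(rewrite Rabs_right; lra) j). specialize (HM' j).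
    apply Rabs_le_inv in HM, HM'; lra.
  - rewrite Phi_0; [intros; lra|]. now exists M'.
Qed.

Lemma Phi_supersolution x t : Lin w x -> (forall i, V P x i <= 0) -> 0 <= t -> forall i, Phi x t i <= x i.
Proof.
  intros Hx H Ht i. destruct (proj2 (proj1 (Phi_spec x Hx)) t) as (M & HM).
  destruct Hx as (M' & HM').
  apply (comparison (Phi x) (fun _ => x) (fun t => V P (Phi x t)) (fun _ _ => 0) t (M' + M));
    try (intros; lra).
  - intros; apply Phi_derivable; now exists M'.
  - intros; apply derivable_pt_lim_const.
  - intros; apply H.
  - intros s j Hs. specialize (HM s ltac:(rewrite Rabs_right; lra) j). specialize (HM' j).
    apply Rabs_le_inv in HM, HM'; lra.
  - rewrite Phi_0; [intros; lra|]. now exists M'.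
Qed.

(** The difference u of ordered orbits satisfies u' >= - Kc u, so its product with exp (Kc t) never
    decreases: contact at a site forces contact there at all earlier nonnegative times. *)
Lemma Phi_gap_persists x y i s t : Lin w x -> Lin w y -> (forall i, x i <= y i) -> 0 <= s <= t ->
  exp (Kc P * s) * (Phi y s i - Phi x s i) <= exp (Kc P * t) * (Phi y t i - Phi x t i).
Proof.
  intros Hx Hy H (Hs & [Hst|<-]); [|lra]. set (K := Kc P).
  destruct (MVT_cor2 (fun t => exp (K * t) * (Phi y t i - Phi x t i))
    (fun t => K * exp (K * t) * (Phi y t i - Phi x t i) + exp (K * t) * (V P (Phi y t) i - V P (Phi x t) i)) s t Hst) as (c & Hc & Hc').
  - intros c _. apply (derivable_pt_lim_mult (fun t => exp (K * t)) (fun t => Phi y t i - Phi x t i)).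
    + apply derivable_pt_lim_exp_lin.
    + apply (derivable_pt_lim_minus (fun t => Phi y t i) (fun t => Phi x t i)); now apply Phi_derivable.
  - assert (V P (Phi y c) i - V P (Phi x c) i >= - K * (Phi y c i - Phi x c i)) as Hq.
    { apply V_quasimonotone. intros j; apply Phi_mono; auto; lra. }
    pose proof (exp_pos (K * c)) as HE.
    assert (0 <= exp (K * c) * (K * (Phi y c i - Phi x c i) + (V P (Phi y c) i - V P (Phi x c) i))) as Hp
      by (apply Rmult_le_pos; lra).
    assert (0 <= (K * exp (K * c) * (Phi y c i - Phi x c i) + exp (K * c) * (V P (Phi y c) i - V P (Phi x c) i)) * (t - s)); [|lra].
    apply Rmult_le_pos; lra.
Qed.

(** Contact at one site at time [t] goes back to all of [[0, t)], where equal derivatives and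
    [V_strict] pass it to the neighbours and so to the whole lattice. At time 0 this says
    [x = y]. *)
Lemma Phi_strong x y t : Lin w x -> Lin w y -> (forall i, x i <= y i) -> x <> y -> 0 < t ->
  forall i, Phi x t i < Phi y t i.
Proof.
  intros Hx Hy H Hne Ht o.
  destruct (Phi_mono x y t Hx Hy H (Rlt_le _ _ Ht) o) as [Hlt|Heq]; [auto|exfalso].
  apply Hne, functional_extensionality.
  assert (forall i s r, 0 <= s <= r -> Phi y r i = Phi x r i -> Phi y s i = Phi x s i) as Hback.
  { intros i s r Hsr E. pose proof (Phi_gap_persists x y i s r Hx Hy H Hsr) as Hg.
    replace (Phi y r i - Phi x r i) with 0 in Hg by lra. rewrite Rmult_0_r in Hg.
    pose proof (Phi_mono x y s Hx Hy H ltac:(lra) i) as [Hl|Hl]; [|auto].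
    pose proof (exp_pos (Kc P * s)).
    assert (0 < exp (Kc P * s) * (Phi y s i - Phi x s i)) by (apply Rmult_lt_0_compat; lra). lra. }
  assert (forall i s, 0 <= s < t -> Phi y s i = Phi x s i) as Hall.
  { apply (lattice_connected (fun i => forall s, 0 <= s < t -> Phi y s i = Phi x s i) o).
    - intros s Hs. apply (Hback o s t); [lra|auto].
    - intros i k Hk Hi.
      assert (forall s, 0 < s < t -> Phi y s k = Phi x s k) as Hin.
      { intros s Hs. symmetry. apply (V_strict P (Phi x s) (Phi y s) i k); auto.
        - intros j; apply Phi_mono; auto; lra.
        - symmetry; apply Hi; lra.
        - apply Rminus_diag_uniq. apply (uniqueness_limite (fun r => Phi x r i - Phi y r i) s).
          + apply (derivable_pt_lim_minus (fun r => Phi x r i) (fun r => Phi y r i)); now apply Phi_derivable.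
          + intros eps He. exists (mkposreal (Rmin s (t - s)) ltac:(apply Rmin_pos; lra)).
            intros h Hh Hh'. simpl in Hh'.
            assert (Rabs h < s) as A1 by (eapply Rlt_le_trans; [exact Hh'|apply Rmin_l]).
            assert (Rabs h < t - s) as A2 by (eapply Rlt_le_trans; [exact Hh'|apply Rmin_r]).
            apply Rabs_def2 in A1, A2. rewrite !Hi by lra.
            match goal with |- Rabs ?e < _ => replace e with 0 by (field; auto) end. rewrite Rabs_R0; auto. }
      intros s [[Hs|<-] Hs']; [apply Hin; lra|]. apply (Hback k 0 (t/2)); [lra|apply Hin; lra]. }
  intros i. specialize (Hall i 0 ltac:(lra)). rewrite !Phi_0 in Hall; auto.
Qed.

End FlowLines.

(** * Compactness *)

Lemma subsequence_real (u : nat -> R) M : (forall n, Rabs (u n) <= M) ->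
  exists phi l, (forall n, (phi n < phi (Datatypes.S n))%nat) /\ Un_cv (fun n => u (phi n)) l.
Proof.
  intros H.
  destruct (Bolzano_Weierstrass u (fun c => - M <= c <= M)) as (l & Hl).
  - apply compact_P3.
  - intros n; apply Rabs_le_inv, H.
  - assert (forall N k : nat, exists p, (N <= p)%nat /\ Rabs (u p - l) < / INR (Datatypes.S k)) as Hp.
    { intros N k. assert (0 < / INR (Datatypes.S k)) as Hk by (apply Rinv_0_lt_compat, lt_0_INR; lia).
      destruct (Hl (fun x => Rabs (x - l) < / INR (Datatypes.S k)) N) as (p & Hp & Hp').
      - exists (mkposreal _ Hk). intros x Hx. exact Hx.
      - exists p; auto. }
    destruct (choice_fun _ (fun N => choice_fun _ (Hp N))) as (pick & Hpick).
    set (phi := fix phi n := match n with O => pick O O | Datatypes.S n => pick (Datatypes.S (phi n)) (Datatypes.S n) end).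
    exists phi, l. split.
    + intros n. simpl. pose proof (proj1 (Hpick (Datatypes.S (phi n)) (Datatypes.S n))); lia.
    + intros eps He. destruct (archimed_cor1 eps He) as (N & HN & HN0). exists N. intros n Hn. unfold Rdist.
      assert (Rabs (u (phi n) - l) < / INR (Datatypes.S n)) as Hb by (destruct n; apply Hpick).
      eapply Rlt_trans; [exact Hb|]. eapply Rle_lt_trans; [|exact HN].
      apply Rinv_le_contravar; [apply lt_0_INR; lia|apply le_INR; lia].
Qed.

Lemma subsequence_ge phi : (forall n, (phi n < phi (Datatypes.S n))%nat) -> forall n, (n <= phi n)%nat.
Proof. intros H n; induction n as [|n IH]; [lia|]. specialize (H n); lia. Qed.

Lemma subsequence_mono phi : (forall n, (phi n < phi (Datatypes.S n))%nat) ->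
  forall n m, (n < m)%nat -> (phi n < phi m)%nat.
Proof. intros H n m Hm; induction Hm as [|m _ IH]; [apply H|]. specialize (H m); lia. Qed.

Lemma subsequence_list {A} (x : nat -> A -> R) L M : (forall n j, In j L -> Rabs (x n j) <= M) ->
  exists phi, (forall n, (phi n < phi (Datatypes.S n))%nat) /\
    forall j, In j L -> exists l, Un_cv (fun n => x (phi n) j) l.
Proof.
  revert x; induction L as [|a L IH]; intros x H.
  - exists (fun n => n); split; [intros; lia|intros j []].
  - destruct (subsequence_real (fun n => x n a) M) as (phi & l & Hphi & Hl); [intros; apply H; now left|].
    destruct (IH (fun n => x (phi n))) as (psi & Hpsi & Hc); [intros; apply H; now right|].
    exists (fun n => phi (psi n)); split.
    + intros n; now apply subsequence_mono.
    + intros j [<-|Hj]; [|now apply Hc]. exists l. intros eps He. destruct (Hl eps He) as (N & HN).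
      exists N; intros n Hn; apply HN. pose proof (subsequence_ge psi Hpsi n); lia.
Qed.

(** * Periodic configurations and minimizers *)

Section Periodic.
Context {d : nat}.
Variable P : LocalPotentials d.
Variable w : Vector.t Q d.

(** The last clause of [Bbar]. It forces periodicity modulo any [integral_period], so these
    configurations form a finite-dimensional affine space. *)
Definition Xw (x : config d) : Prop := forall k l, om w k + IZR l = 0 -> tau k l x = x.
Definition per (Q : nat) (x : config d) : Prop := Zperiodic Q (fun i => x i - om w i).
Definition total (Q : nat) (x : config d) : R := lsum x (tbox d Q).

Lemma tau_tau k l k' l' (x : config d) : tau k l (tau k' l' x) = tau (zadd k k') (l + l') x.
Proof.
  apply functional_extensionality; intros i. unfold tau. rewrite plus_IZR.
  replace (zadd (zadd i k) k') with (zadd i (zadd k k')) by zvec. ring.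
Qed.

Lemma tau_comm k l k' l' (x : config d) : tau k l (tau k' l' x) = tau k' l' (tau k l x).
Proof. rewrite !tau_tau. f_equal; [zvec|ring]. Qed.

Lemma tau_inv k l (x : config d) : tau (zscal (-1) k) (- l) (tau k l x) = x.
Proof.
  rewrite tau_tau. apply functional_extensionality; intros i. unfold tau.
  replace (zadd i (zadd (zscal (-1) k) k)) with i by zvec.
  replace (- l + l)%Z with 0%Z by ring. simpl; ring.
Qed.

Lemma tau_le k l (x y : config d) : (forall i, x i <= y i) -> forall i, tau k l x i <= tau k l y i.
Proof. intros H i; unfold tau; specialize (H (zadd i k)); lra. Qed.

Lemma per_lattice Q x : integral_period w Q -> per Q x -> lattice_periodic Q x.
Proof.
  intros (_ & HQ) Hx v. destruct (HQ v) as (l & Hl). exists (- l)%Z.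
  apply functional_extensionality; intros i. unfold tau.
  specialize (Hx i v). cbv beta in Hx. rewrite om_add, om_scal, <- INR_IZR_INZ in Hx.
  rewrite opp_IZR, <- Hl. lra.
Qed.

Lemma Xw_per Q x : integral_period w Q -> Xw x -> per Q x.
Proof.
  intros (_ & HQ) Hx i v. destruct (HQ v) as (l & Hl).
  rewrite om_add, om_scal, <- INR_IZR_INZ, Hl.
  assert (tau (zscal (Z.of_nat Q) v) (- l) x i = x i) as E.
  { rewrite Hx; [auto|]. rewrite om_scal, <- INR_IZR_INZ, Hl, opp_IZR; ring. }
  unfold tau in E. rewrite opp_IZR in E. lra.
Qed.

Lemma per_Lin Q x : (0 < Q)%nat -> per Q x -> Lin w x.
Proof. intros HQ Hx. apply (Zperiodic_bounded Q (fun i => x i - om w i) HQ Hx). Qed.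

Lemma Xw_Lin x : Xw x -> Lin w x.
Proof.
  intros Hx. destruct (integral_period_exists w) as (q & Hq).
  apply (per_Lin q); [apply Hq|now apply Xw_per].
Qed.

Lemma Xw_tau k l x : Xw x -> Xw (tau k l x).
Proof. intros Hx k' l' H. rewrite tau_comm. now rewrite Hx. Qed.

Lemma Xw_Phi x t : Xw x -> Xw (Phi P w x t).
Proof. intros Hx k l H. rewrite <- Phi_tau by now apply Xw_Lin. now rewrite Hx. Qed.

Lemma per_om Q : per Q (fun i => om w i).
Proof. intros i v; ring. Qed.

Lemma per_diff Q x y : per Q x -> per Q y -> Zperiodic Q (fun i => y i - x i).
Proof. intros Hx Hy i v. specialize (Hx i v); specialize (Hy i v). cbv beta in *. lra. Qed.

Lemma per_add Q x e : per Q x -> Zperiodic Q e -> per Q (fun i => x i + e i).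
Proof. intros Hx He i v. specialize (Hx i v); specialize (He i v). cbv beta in *. lra. Qed.

Lemma per_tau Q x k l : per Q x -> per Q (tau k l x).
Proof.
  intros Hx i v. specialize (Hx (zadd i k) v). cbv beta in *. unfold tau.
  replace (zadd (zadd i (zscal (Z.of_nat Q) v)) k) with (zadd (zadd i k) (zscal (Z.of_nat Q) v)) by zvec.
  rewrite !om_add in *. lra.
Qed.

Lemma per_close Q x y e : (0 < Q)%nat -> per Q x -> per Q y ->
  (forall i, In i (tbox d Q) -> Rabs (y i - x i) <= e) -> forall i, Rabs (y i - x i) <= e.
Proof.
  intros HQ Hx Hy H i. rewrite (Zperiodic_red Q (fun i => y i - x i) i HQ (per_diff Q x y Hx Hy)).
  apply H, zred_in, HQ.
Qed.

(** For ordered configurations the differences are nonnegative, so each is at most their sum over a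
    period. This makes [total] a faithful height on chains. *)
Lemma per_le_gap Q x y : (0 < Q)%nat -> per Q x -> per Q y -> (forall i, x i <= y i) ->
  forall i, y i - x i <= total Q y - total Q x.
Proof.
  intros HQ Hx Hy H i. rewrite (Zperiodic_red Q (fun i => y i - x i) i HQ (per_diff Q x y Hx Hy)).
  unfold total. rewrite <- lsum_minus.
  apply (lsum_mem_le (fun i => y i - x i)); [intros b _; specialize (H b); lra|apply zred_in, HQ].
Qed.

Lemma per_le_eq Q x y : (0 < Q)%nat -> per Q x -> per Q y -> (forall i, x i <= y i) ->
  total Q y <= total Q x -> x = y.
Proof.
  intros HQ Hx Hy H Ht. apply functional_extensionality; intros i.
  pose proof (per_le_gap Q x y HQ Hx Hy H i); specialize (H i); lra.
Qed.

Lemma total_le Q (x y : config d) : (forall i, x i <= y i) -> total Q x <= total Q y.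
Proof. intros H; apply lsum_le; intros; apply H. Qed.

Lemma total_tau Q x k l : per Q x ->
  total Q (tau k l x) = total Q x + INR (length (tbox d Q)) * (om w k + IZR l).
Proof.
  intros Hx. unfold total, tau.
  pose proof (torus_shift Q _ k Hx) as E. cbv beta in E.
  rewrite <- lsum_const, <- (Rplus_0_r (lsum _ _)).
  replace 0 with (lsum (fun i => x i - om w i) (tbox d Q) - lsum (fun i => x (zadd i k) - om w (zadd i k)) (tbox d Q)) by lra.
  rewrite <- lsum_minus, <- !lsum_plus. apply lsum_ext; intros i _. rewrite om_add; ring.
Qed.

Lemma length_tbox_pos Q : (0 < Q)%nat -> 0 < INR (length (tbox d Q)).
Proof.
  intros H. apply lt_0_INR. pose proof (tbox_nonempty d Q H).
  destruct (tbox d Q); [destruct H0|simpl; lia].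
Qed.

Lemma total_close Q (x y : config d) e : (forall i, Rabs (y i - x i) <= e) ->
  Rabs (total Q y - total Q x) <= INR (length (tbox d Q)) * e.
Proof.
  intros H. unfold total. rewrite <- lsum_minus. eapply Rle_trans; [apply lsum_abs|].
  rewrite <- lsum_const. apply lsum_le; intros; apply H.
Qed.

(** Uniform approximation. Among periodic configurations, closeness on one period already gives
    it. *)
Definition adherent (K : config d -> Prop) (x : config d) : Prop :=
  forall e, 0 < e -> exists y, K y /\ forall i, Rabs (y i - x i) <= e.

Lemma per_closed Q x : adherent (per Q) x -> per Q x.
Proof.
  intros H i v. apply NNPP; intros Hne.
  set (a := x (zadd i (zscal (Z.of_nat Q) v)) - om w (zadd i (zscal (Z.of_nat Q) v))) in *.
  destruct (H (Rabs (a - (x i - om w i)) / 4)) as (y & Hy & Hc).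
  { assert (0 < Rabs (a - (x i - om w i))) by (apply Rabs_pos_lt; lra). lra. }
  specialize (Hy i v). cbv beta in Hy.
  pose proof (Hc i) as H1. pose proof (Hc (zadd i (zscal (Z.of_nat Q) v))) as H2. unfold a in *.
  revert H1 H2; unfold Rabs; repeat destruct Rcase_abs; lra.
Qed.

Lemma Xw_closed x : adherent Xw x -> Xw x.
Proof.
  intros H k l Hkl. apply functional_extensionality; intros i. apply NNPP; intros Hne.
  destruct (H (Rabs (tau k l x i - x i) / 4)) as (y & Hy & Hc).
  { assert (0 < Rabs (tau k l x i - x i)) by (apply Rabs_pos_lt; lra). lra. }
  assert (tau k l y i = y i) as E by now rewrite Hy.
  unfold tau in *. pose proof (Hc i) as H1. pose proof (Hc (zadd i k)) as H2.
  revert H1 H2; unfold Rabs; repeat destruct Rcase_abs; lra.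
Qed.

Lemma per_cluster Q (x : nat -> config d) M : (0 < Q)%nat -> (forall n, per Q (x n)) ->
  (forall n j, In j (tbox d Q) -> Rabs (x n j) <= M) ->
  exists y, per Q y /\ forall e, 0 < e -> forall N, exists n, (N <= n)%nat /\ forall i, Rabs (x n i - y i) <= e.
Proof.
  intros HQ Hx HM. destruct (subsequence_list x (tbox d Q) M HM) as (phi & Hphi & Hc).
  set (l := fun j => epsilon (inhabits 0) (fun l => Un_cv (fun n => x (phi n) j) l)).
  assert (forall j, In j (tbox d Q) -> Un_cv (fun n => x (phi n) j) (l j)) as Hl.
  { intros j Hj. apply (epsilon_spec (inhabits 0) (fun l => Un_cv (fun n => x (phi n) j) l)), Hc, Hj. }
  set (y := fun i => l (zred Q i) + (om w i - om w (zred Q i))).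
  assert (per Q y) as Hy by (intros i v; unfold y; rewrite zred_shift; ring).
  exists y; split; [auto|]. intros e He N.
  assert (forall L, incl L (tbox d Q) -> exists N', forall n, (N' <= n)%nat -> forall i, In i L -> Rabs (x (phi n) i - y i) <= e) as HL.
  { induction L as [|a L IH]; intros Hi; [exists 0%nat; intros n _ i []|].
    destruct IH as (N1 & HN1); [intros b Hb; apply Hi; now right|].
    assert (In a (tbox d Q)) as Ha by (apply Hi; now left).
    destruct (Hl a Ha e He) as (N2 & HN2). exists (max N1 N2). intros n Hn i [<-|Hi'].
    - specialize (HN2 n ltac:(lia)). unfold Rdist in HN2. unfold y. rewrite zred_id by auto.
      replace (l a + (om w a - om w a)) with (l a) by ring. lra.
    - apply HN1; [lia|auto]. }
  destruct (HL (tbox d Q) (fun a h => h)) as (N' & HN').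
  exists (phi (max N N')). split; [pose proof (subsequence_ge phi Hphi (max N N')); lia|].
  apply (per_close Q y (x (phi (max N N'))) e HQ Hy (Hx _)). apply HN'; lia.
Qed.

(** Continuity for the sup norm at each point of [K]; [dl] may depend on [x]. *)
Definition ucontinuous_on (K : config d -> Prop) (f : config d -> R) : Prop :=
  forall x, K x -> forall e, 0 < e -> exists dl, 0 < dl /\
    forall y, (forall i, Rabs (y i - x i) <= dl) -> Rabs (f y - f x) < e.

Lemma min_exists Q (K : config d -> Prop) (f : config d -> R) M m : (0 < Q)%nat ->
  (forall x, K x -> per Q x) -> (forall x j, K x -> In j (tbox d Q) -> Rabs (x j) <= M) ->
  (forall x, adherent K x -> K x) -> ucontinuous_on K f ->
  (forall x, K x -> m <= f x) -> (exists x, K x) ->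
  exists x, K x /\ forall y, K y -> f x <= f y.
Proof.
  intros HQ HKp HKb HKc Hf Hm (x0 & Hx0).
  (* [completeness] provides suprema, so the infimum of [f] is handled as the supremum of [- f]. *)
  destruct (completeness (fun r => exists x, K x /\ r = - f x)) as (s & Hs1 & Hs2).
  { exists (- m). intros r (x & Hx & ->). specialize (Hm x Hx); lra. }
  { exists (- f x0); eauto. }
  assert (forall n : nat, exists x, K x /\ f x <= - s + / INR (Datatypes.S n)) as Hn.
  { intros n. assert (0 < / INR (Datatypes.S n)) by (apply Rinv_0_lt_compat, lt_0_INR; lia).
    apply NNPP; intros Hno. assert (s <= s - / INR (Datatypes.S n)); [|lra].
    apply Hs2. intros r (x & Hx & ->). apply Rnot_lt_le; intros Hlt. apply Hno. exists x; split; [auto|lra]. }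
  destruct (choice_fun _ Hn) as (x & Hx).
  destruct (per_cluster Q x M HQ) as (y & Hy & Hc).
  { intros n; apply HKp, Hx. }
  { intros n j Hj; apply HKb; [apply Hx|auto]. }
  assert (K y) as HKy.
  { apply HKc. intros e He. destruct (Hc e He 0%nat) as (n & _ & Hn'). exists (x n); split; [apply Hx|auto]. }
  exists y; split; [auto|]. intros z Hz.
  assert (- f z <= s) as Hz' by (apply Hs1; eauto).
  apply Rnot_lt_le; intros Hlt. destruct (Hf y HKy ((f y - f z) / 2)) as (dl & Hd & Hfy); [lra|].
  destruct (archimed_cor1 ((f y - f z) / 2) ltac:(lra)) as (N & HN & HN0).
  destruct (Hc dl Hd N) as (n & HnN & Hn'). specialize (Hfy (x n) Hn').
  apply Rabs_def2 in Hfy. destruct (Hx n) as (_ & Hxn).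
  assert (/ INR (Datatypes.S n) <= / INR N) by (apply Rinv_le_contravar; [apply lt_0_INR; lia|apply le_INR; lia]).
  lra.
Qed.

Lemma WB_continuous B (K : config d -> Prop) : ucontinuous_on K (WB P B).
Proof.
  intros x _. induction B as [|j B IH]; intros e He.
  - exists 1; split; [lra|]. intros y _. unfold WB; simpl. rewrite Rminus_0_r, Rabs_R0; auto.
  - destruct (IH (e / 2) ltac:(lra)) as (d1 & Hd1 & H1).
    destruct (A_cont0 d P j x (e / 2) ltac:(lra)) as (L & d2 & Hd2 & H2).
    exists (Rmin d1 (d2 / 2)); split; [apply Rmin_pos; lra|]. intros y Hy.
    change (WB P (j :: B) y) with (S P j y + WB P B y). change (WB P (j :: B) x) with (S P j x + WB P B x).
    assert (Rabs (WB P B y - WB P B x) < e / 2).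
    { apply H1; intros i; eapply Rle_trans; [apply Hy|apply Rmin_l]. }
    assert (Rabs (S P j y - S P j x) < e / 2).
    { apply H2; intros i _. eapply Rle_lt_trans; [apply Hy|].
      eapply Rle_lt_trans; [apply Rmin_r|lra]. }
    replace (S P j y + WB P B y - (S P j x + WB P B x)) with
      ((S P j y - S P j x) + (WB P B y - WB P B x)) by ring.
    eapply Rle_lt_trans; [apply Rabs_triang|]. lra.
Qed.

(** * Minimizers of the periodic action *)

Lemma S_translate j x : S P j x = S P zz (tau j 0 x).
Proof. rewrite B_inv. f_equal; zvec. Qed.

Lemma S_bounded_below : exists m, forall j x, m <= S P j x.
Proof. destruct (C_below d P zz) as (m & Hm). exists m; intros j x; rewrite S_translate; apply Hm. Qed.

Lemma S_periodic Q x : integral_period w Q -> per Q x -> Zperiodic Q (fun j => S P j x).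
Proof.
  intros HQ Hx i v. destruct (per_lattice Q x HQ Hx v) as (l & Hl).
  rewrite <- Hl at 2. now rewrite B_inv.
Qed.

Lemma W_tau Q x k l : integral_period w Q -> per Q x ->
  WB P (tbox d Q) (tau k l x) = WB P (tbox d Q) x.
Proof.
  intros HQ Hx. unfold WB. rewrite <- (torus_shift Q (fun j => S P j x) k (S_periodic Q x HQ Hx)).
  apply lsum_ext; intros j _. apply B_inv.
Qed.

(** By (B) the finitely many coercivity constants at the origin serve at all sites; a lattice path
    from the origin to [j] then has increments of size at most [r]. *)
Lemma neighbour_gap_bound M : exists r, 0 < r /\ forall x, (forall j, S P j x <= M) ->
  forall j, Rabs (x j - x zz) <= r * IZR (znorm j).
Proof.
  destruct (list_bound (fun e r => znorm (zsub e zz) = 1%Z -> forall x, S P zz x <= M -> Rabs (x e - x zz) <= r) (box d 1))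
    as (r & Hr & H).
  - intros a r r' Hrr H E x Hx; specialize (H E x Hx); lra.
  - intros e _. destruct (Z.eq_dec (znorm (zsub e zz)) 1) as [E|E]; [|exists 0; tauto].
    destruct (C_coerc d P zz e E M) as (r & Hr). exists r. intros _ x Hx.
    apply Rnot_lt_le; intros Hlt. specialize (Hr x Hlt); lra.
  - exists r; split; [auto|]. intros x Hx.
    assert (forall n v, znorm v = Z.of_nat n -> Rabs (x v - x zz) <= r * INR n) as Hn.
    { induction n as [|n IH]; intros v Hv.
      - rewrite (znorm_0 v Hv). rewrite Rabs_minus_self. simpl; lra.
      - destruct (znorm_descend v) as (u & Hu & Hu'); [lia|]. specialize (IH u ltac:(lia)).
        rewrite S_INR. replace (x v - x zz) with ((x v - x u) + (x u - x zz)) by ring.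
        eapply Rle_trans; [apply Rabs_triang|].
        assert (Rabs (x v - x u) <= r); [|lra].
        assert (In (zsub v u) (box d 1)) as Hb by (apply znorm_box; lia).
        specialize (H (zsub v u) Hb). replace (zsub (zsub v u) zz) with (zsub v u) in H by zvec.
        specialize (H Hu (tau u 0 x)). rewrite <- S_translate in H. specialize (H (Hx u)).
        unfold tau in H. replace (zadd (zsub v u) u) with v in H by zvec. replace (zadd zz u) with u in H by zvec.
        eapply Rle_trans; [|exact H]. right; f_equal; ring. }
    intros j. pose proof (znorm_nonneg j). rewrite <- (Z2Nat.id (znorm j)) by auto. rewrite <- INR_IZR_INZ.
    apply Hn. lia.
Qed.

Lemma minimizer_exists Q : integral_period w Q ->
  exists z, per Q z /\ forall y, per Q y -> WB P (tbox d Q) z <= WB P (tbox d Q) y.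
Proof.
  intros HQ. assert (0 < Q)%nat as HQ0 by apply HQ.
  set (W := WB P (tbox d Q)). set (o := fun i : Zd d => om w i).
  (* Coercivity bounds differences only. The value at the origin is pinned to [[0, 1]] by an integer
     translation, which leaves [W] unchanged, and the energy of the linear configuration [o] serves
     as the bound for a sublevel set. *)
  set (K := fun x => per Q x /\ W x <= W o /\ 0 <= x zz <= 1).
  assert (forall x, per Q x -> exists l : Z, 0 <= tau zz l x zz <= 1) as Hnorm.
  { intros x _. exists (- (up (x zz) - 1))%Z. unfold tau. replace (zadd zz zz) with (@zz d) by zvec.
    destruct (archimed (x zz)). rewrite opp_IZR, minus_IZR; lra. }
  destruct S_bounded_below as (m & Hm).
  assert (forall x, INR (length (tbox d Q)) * m <= W x) as HWm.
  { intros x. rewrite <- lsum_const. apply lsum_le; intros; apply Hm. }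
  (* All potentials are at least [m], so a single one exceeds [m] by at most the excess of the whole
     energy over its lower bound. *)
  destruct (neighbour_gap_bound (m + (W o - INR (length (tbox d Q)) * m))) as (r & Hr & Hgap).
  destruct (min_exists Q K W (1 + lsum (fun j => r * IZR (znorm j)) (tbox d Q)) (INR (length (tbox d Q)) * m))
    as (z & (Hz1 & Hz2 & Hz3) & Hmin); auto.
  - intros x Hx; apply Hx.
  - intros x j (Hx1 & Hx2 & Hx3) Hj.
    assert (Rabs (x j - x zz) <= r * IZR (znorm j)) as Hg.
    { apply Hgap. intros i. rewrite (Zperiodic_red Q (fun j => S P j x) i HQ0 (S_periodic Q x HQ Hx1)).
      assert (S P (zred Q i) x - m <= W x - INR (length (tbox d Q)) * m); [|lra].
      rewrite <- lsum_const. unfold W, WB. rewrite <- lsum_minus.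
      apply (lsum_mem_le (fun j => S P j x - m)); [intros b _; specialize (Hm b x); lra|now apply zred_in]. }
    pose proof (lsum_mem_le (fun j => r * IZR (znorm j)) (tbox d Q) j) as Hle.
    assert (r * IZR (znorm j) <= lsum (fun j => r * IZR (znorm j)) (tbox d Q)) as Hle'.
    { apply Hle; [|auto]. intros b _. apply Rmult_le_pos; [lra|]. apply (IZR_le 0), znorm_nonneg. }
    revert Hg; unfold Rabs; repeat destruct Rcase_abs; lra.
  - intros x Ha. split; [|split].
    + apply per_closed. intros e He. destruct (Ha e He) as (y & Hy & Hc). exists y; split; [apply Hy|auto].
    + apply Rnot_lt_le; intros Hlt.
      destruct (WB_continuous (tbox d Q) (fun _ => True) x I (W x - W o)) as (dl & Hd & Hc); [lra|].
      destruct (Ha dl Hd) as (y & (_ & Hy & _) & Hyx). specialize (Hc y Hyx). fold W in Hc.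
      apply Rabs_def2 in Hc. lra.
    + split; apply Rnot_lt_le; intros Hlt.
      * destruct (Ha (- x zz / 2)) as (y & (_ & _ & Hy) & Hyx); [lra|]. specialize (Hyx zz).
        apply Rabs_le_inv in Hyx; lra.
      * destruct (Ha ((x zz - 1) / 2)) as (y & (_ & _ & Hy) & Hyx); [lra|]. specialize (Hyx zz).
        apply Rabs_le_inv in Hyx; lra.
  - apply WB_continuous.
  - destruct (Hnorm o (per_om Q)) as (l & Hl). exists (tau zz l o). split; [apply per_tau, per_om|split; [|auto]].
    unfold W. rewrite W_tau; [lra|auto|apply per_om].
  - exists z; split; [auto|]. intros y Hy. destruct (Rle_or_lt (W o) (W y)) as [Hle|Hlt]; [lra|].
    destruct (Hnorm y Hy) as (l & Hl). fold W. unfold W at 2. rewrite <- (W_tau Q y zz l HQ Hy).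
    apply Hmin. split; [now apply per_tau|split; [|auto]]. unfold W; rewrite W_tau; auto. fold W; lra.
Qed.

Definition minimizes (Q : nat) (z : config d) : Prop :=
  per Q z /\ forall y, per Q y -> WB P (tbox d Q) z <= WB P (tbox d Q) y.

(** Only small positive [h] are required, because the variations of a constrained minimizer are
    one-sided. *)
Lemma slope_nonneg g C h0 : 0 <= C -> 0 < h0 -> (forall h, 0 < h <= h0 -> 0 <= h * g + C * h^2) -> 0 <= g.
Proof.
  intros HC Hh H. apply Rnot_lt_le; intros Hg.
  set (h := Rmin h0 (- g / (2 * (C + 1)))).
  assert (0 < - g / (2 * (C + 1))) by (apply Rdiv_lt_0_compat; lra).
  assert (0 < h) by (apply Rmin_pos; lra).
  assert (h <= - g / (2 * (C + 1))) as Hh1 by apply Rmin_r.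
  specialize (H h (conj H1 (Rmin_l _ _))).
  assert (h * (2 * (C + 1)) <= - g) as Hh2.
  { apply (Rmult_le_compat_r (2 * (C + 1))) in Hh1; [|lra].
    replace (- g / (2 * (C + 1)) * (2 * (C + 1))) with (- g) in Hh1 by (field; lra). lra. }
  assert (0 <= g + C * h).
  { apply Rmult_le_reg_l with h; [auto|]. rewrite Rmult_0_r. replace (h * (g + C * h)) with (h * g + C * h^2) by ring. auto. }
  nra.
Qed.

Lemma W_variation Q z eta b : integral_period w Q -> per Q z -> Zperiodic Q eta -> (forall i, Rabs (eta i) <= b) ->
  exists C, 0 <= C /\ forall h, WB P (tbox d Q) (fun i => z i + h * eta i) <=
    WB P (tbox d Q) z + h * lsum (fun j => gradW P z j * eta j) (tbox d Q) + C * h^2.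
Proof.
  intros HQ Hz He Hb. exists (INR (length (tbox d Q)) * (Cbd P * (nB P * b)^2)). split.
  - apply Rmult_le_pos; [apply pos_INR|]. apply Rmult_le_pos; [left; apply Cbd_spec|apply pow2_ge_0].
  - intros h. pose proof (W_taylor P Q z (fun i => z i + h * eta i) (Rabs h * b) (per_lattice Q z HQ Hz)) as H.
    assert (Rabs (WB P (tbox d Q) (fun i => z i + h * eta i) - WB P (tbox d Q) z
      - h * lsum (fun j => gradW P z j * eta j) (tbox d Q)) <= INR (length (tbox d Q)) * (Cbd P * (nB P * b)^2) * h^2) as H'.
    { rewrite <- lsum_scal.
      replace (INR (length (tbox d Q)) * (Cbd P * (nB P * b)^2) * h^2) with (INR (length (tbox d Q)) * (Cbd P * (nB P * (Rabs h * b))^2)).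
      - rewrite (lsum_ext (fun j => h * (gradW P z j * eta j)) (fun j => gradW P z j * (z j + h * eta j - z j))) by (intros; ring).
        apply H.
        + intros i v. specialize (He i v). rewrite He. ring.
        + intros i. replace (z i + h * eta i - z i) with (h * eta i) by ring. rewrite Rabs_mult.
          apply Rmult_le_compat_l; [apply Rabs_pos|apply Hb].
      - rewrite !Rpow_mult_distr, <- (pow2_abs h). ring. }
    apply Rabs_le_inv in H'. lra.
Qed.

Lemma gradW_periodic Q z : integral_period w Q -> per Q z -> Zperiodic Q (gradW P z).
Proof.
  intros HQ Hz i v. destruct (per_lattice Q z HQ Hz v) as (l & Hl).
  pose proof (V_tau P (zscal (Z.of_nat Q) v) l z i) as E. rewrite Hl in E. unfold V in E. lra.
Qed.

Lemma minimizer_critical Q z : integral_period w Q -> minimizes Q z -> forall i, V P z i = 0.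
Proof.
  intros HQ (Hz & Hmin) i. assert (0 < Q)%nat as HQ0 by apply HQ.
  (* The variation must be periodic, so it moves all translates of [i] by the period at once. *)
  set (eta := fun j : Zd d => if Zd_dec (zred Q j) (zred Q i) then 1 else 0).
  assert (Zperiodic Q eta) as He by (intros j v; unfold eta; now rewrite zred_shift).
  assert (forall j, Rabs (eta j) <= 1) as Hb.
  { intros j; unfold eta; destruct Zd_dec; [rewrite Rabs_R1|rewrite Rabs_R0]; lra. }
  assert (lsum (fun j => gradW P z j * eta j) (tbox d Q) = gradW P z i) as Hs.
  { rewrite (Zperiodic_red Q (gradW P z) i HQ0 (gradW_periodic Q z HQ Hz)).
    rewrite <- (lsum_support (fun j => gradW P z j * eta j) [zred Q i] (tbox d Q)).
    - simpl. unfold eta. rewrite (zred_id Q (zred Q i)) by now apply zred_in.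
      destruct Zd_dec; [ring|tauto].
    - constructor; [intros []|constructor].
    - apply NoDup_tbox.
    - intros a [<-|[]]. now apply zred_in.
    - intros a Ha Hn. unfold eta. destruct Zd_dec as [E|]; [|ring].
      exfalso; apply Hn; left. rewrite <- E. now apply zred_id. }
  destruct (W_variation Q z eta 1 HQ Hz He Hb) as (C & HC & HW). rewrite Hs in HW.
  assert (forall h, 0 <= h * gradW P z i + C * h^2) as Hh.
  { intros h. specialize (HW h). assert (WB P (tbox d Q) z <= WB P (tbox d Q) (fun j => z j + h * eta j)); [|lra].
    apply Hmin, per_add; auto. intros j v; now rewrite He. }
  assert (0 <= gradW P z i) by (apply (slope_nonneg _ C 1); auto; lra).
  assert (0 <= - gradW P z i); [|unfold V; lra].
  apply (slope_nonneg _ C 1); auto; [lra|]. intros h _. specialize (Hh (- h)).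
  replace ((- h)^2) with (h^2) in Hh by ring. lra.
Qed.

(** Submodularity makes the minimum [a] of two minimizers a minimizer. It lies below [x] and both
    are critical, so by the strong maximum principle it equals [x] or never meets it; in the second
    case [a] is [y]. *)
Lemma minimizers_comparable Q x y : integral_period w Q -> minimizes Q x -> minimizes Q y ->
  (forall i, x i <= y i) \/ (forall i, y i <= x i).
Proof.
  intros HQ Hx Hy.
  set (a := fun i => Rmin (x i) (y i)). set (M := fun i => Rmax (x i) (y i)).
  assert (per Q a /\ per Q M) as (Ha & HM).
  { destruct Hx as (Hx & _), Hy as (Hy & _).
    split; intros i v; specialize (Hx i v); specialize (Hy i v); cbv beta in *; unfold a, M, Rmin, Rmax;
      repeat destruct Rle_dec; lra. }
  assert (WB P (tbox d Q) M + WB P (tbox d Q) a <= WB P (tbox d Q) x + WB P (tbox d Q) y) as Hsub.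
  { unfold WB. rewrite <- !lsum_plus. apply lsum_le; intros j _. apply S_submodular. }
  assert (minimizes Q a) as Hmin.
  { split; [auto|]. intros z Hz. pose proof (proj2 Hx M HM). pose proof (proj2 Hy z Hz).
    pose proof (proj2 Hx y (proj1 Hy)). pose proof (proj2 Hy x (proj1 Hx)). lra. }
  pose proof (minimizer_critical Q a HQ Hmin) as Ca. pose proof (minimizer_critical Q x HQ Hx) as Cx.
  destruct (classic (exists i, a i = x i)) as [Ht|Ht].
  - left. replace x with a.
    + intros i; apply Rmin_r.
    + apply (V_touching P); auto; [intros i; apply Rmin_l|]. intros i _; now rewrite Ca, Cx.
  - right. intros i. destruct (Rle_or_lt (y i) (x i)) as [|Hlt]; [auto|].
    exfalso; apply Ht; exists i. unfold a; apply Rmin_left; lra.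
Qed.

Lemma minimizes_tau Q x k l : integral_period w Q -> minimizes Q x -> minimizes Q (tau k l x).
Proof.
  intros HQ (Hx & Hmin). split; [now apply per_tau|]. intros y Hy. rewrite W_tau; auto.
Qed.

Lemma minimizer_Xw Q x : integral_period w Q -> minimizes Q x -> Xw x.
Proof.
  intros HQ Hx k l Hkl. assert (0 < Q)%nat as HQ0 by apply HQ.
  assert (total Q (tau k l x) = total Q x) as E.
  { rewrite total_tau by apply Hx. rewrite Hkl; ring. }
  pose proof (minimizes_tau Q x k l HQ Hx) as Ht.
  destruct (minimizers_comparable Q _ _ HQ Ht Hx) as [H|H].
  - apply (per_le_eq Q); auto; [apply Ht|apply Hx|lra].
  - symmetry; apply (per_le_eq Q); auto; [apply Hx|apply Ht|lra].
Qed.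

(** A minimizer on the larger torus is again in [Xw], hence already [q]-periodic, and so it competes
    with [m] on the small torus; both energies are multiplied by [N ^ d]. *)
Lemma minimizer_multiple q N m : integral_period w q -> (0 < N)%nat -> minimizes q m ->
  forall z, per (N * q) z -> WB P (tbox d (N * q)) m <= WB P (tbox d (N * q)) z.
Proof.
  intros Hq HN (Hm & Hmin) z Hz.
  assert (integral_period w (N * q)) as HQ by now apply integral_period_mult.
  destruct (minimizer_exists (N * q) HQ) as (u & Hu).
  assert (per q u) as Hpu by (apply Xw_per; auto; now apply (minimizer_Xw (N * q))).
  eapply Rle_trans; [|now apply Hu]. unfold WB.
  rewrite !(torus_mult q N (fun j => S P j _)) by now apply S_periodic.
  apply Rmult_le_compat_l; [apply pow_le, pos_INR|]. now apply Hmin.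
Qed.

(* A competitor is periodised over a torus much larger than its support; on that torus
   the minimizer [m] is still minimal. *)
Lemma minimizer_global q m : integral_period w q -> minimizes q m -> global_minimizer P m.
Proof.
  intros Hq Hm B y HB Hy.
  assert (exists K : nat, forall i, In i B -> (znorm i <= Z.of_nat K)%Z) as (K & HK).
  { clear HB Hy. induction B as [|a B (K & IH)]; [exists 0%nat; intros i []|].
    exists (K + Z.to_nat (znorm a))%nat. pose proof (znorm_nonneg a).
    intros i [<-|Hi]; [lia|]. specialize (IH i Hi); lia. }
  set (r := Z.to_nat (up (rad P))).
  assert (forall v : Zd d, IZR (znorm v) <= rad P -> (znorm v <= Z.of_nat r)%Z) as Hr.
  { intros v Hv. destruct (archimed (rad P)) as (H1 & _).
    assert (IZR (znorm v) < IZR (up (rad P))) as H2 by lra. apply lt_IZR in H2. unfold r; lia. }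
  (* [KK] bounds [B] enlarged by the interaction range, and the period [Q] exceeds [2 * KK], so the
     periodic copies of the box of radius [KK] are disjoint. *)
  set (KK := (K + r)%nat). set (N := (2 * KK + 1)%nat). set (Q := (N * q)%nat).
  assert (0 < q)%nat as Hq0 by apply Hq.
  assert (2 * KK < Q)%nat as HQK by (unfold Q, N; nia).
  assert (0 < Q)%nat as HQ0 by lia.
  (* [D] is the fundamental domain translated so as to contain the box of radius [KK]; [cred] gives
     the representative of a site in [D]. *)
  set (a := @Vector.const Z (- Z.of_nat KK)%Z d).
  assert (forall p, Vector.nth a p = - Z.of_nat KK)%Z as Ha by (intros; apply Vector.const_nth).
  set (D := List.map (fun i => zadd i a) (tbox d Q)).
  assert (forall i, In i D <-> forall p, (- Z.of_nat KK <= Vector.nth i p < Z.of_nat Q - Z.of_nat KK)%Z) as HD.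
  { intros i. unfold D. rewrite in_map_iff. split.
    - intros (j & <- & Hj) p. rewrite nth_zadd, Ha. pose proof (proj1 (In_tbox Q j) Hj p). lia.
    - intros H. exists (zsub i a). split; [zvec|]. apply In_tbox. intros p. rewrite nth_zsub, Ha. specialize (H p); lia. }
  assert (NoDup D) as HND.
  { apply FinFun.Injective_map_NoDup; [|apply NoDup_tbox]. intros u v E.
    replace u with (zsub (zadd u a) a) by zvec. rewrite E; zvec. }
  set (cred := fun i => zadd (zred Q (zsub i a)) a).
  assert (forall i, (znorm i <= Z.of_nat KK)%Z -> cred i = i) as Hcred.
  { intros i Hi. unfold cred. rewrite zred_id; [zvec|]. apply In_tbox. intros p. rewrite nth_zsub, Ha.
    pose proof (znorm_nth i p); lia. }
  assert (forall i, i = zadd (cred i) (zscal (Z.of_nat Q) (zquo Q (zsub i a)))) as Hquo.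
  { intros i. unfold cred. pose proof (zred_quo Q (zsub i a) HQ0) as E.
    replace i with (zadd (zsub i a) a) at 1 by zvec. rewrite E at 1. zvec. }
  set (z := fun i => m i + y (cred i)).
  assert (per Q m) as HmQ.
  { apply Xw_per; [apply integral_period_mult; [lia|auto]|]. now apply (minimizer_Xw q). }
  assert (per Q z) as Hz.
  { apply per_add; [auto|]. intros i v. unfold cred. f_equal. f_equal.
    rewrite <- (zred_shift Q (zsub i a) v). f_equal. zvec. }
  pose proof (minimizer_multiple q N m Hq ltac:(lia) Hm z Hz) as Hle. fold Q in Hle.
  assert (integral_period w Q) as HQ by (apply integral_period_mult; [lia|auto]).
  (* Outside [B] the potentials of [D] do not feel the periodised competitor: a site within range of
     a copy of the support has a translate [j'] in [B], and two points of [D] that differ by a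
     multiple of [Q] coincide. *)
  assert (lsum (fun j => S P j z - S P j m) (tbox d Q) = lsum (fun j => S P j z - S P j m) B) as E1.
  { rewrite <- (torus_shift Q (fun j => S P j z - S P j m) a).
    - rewrite <- (lsum_map (fun j => S P j z - S P j m) (fun i => zadd i a)). fold D.
      symmetry; apply lsum_support; auto.
      + intros i Hi. apply HD. intros p. specialize (HK i Hi). pose proof (znorm_nth i p). lia.
      + intros j Hj HjB. apply Rminus_diag_eq. apply A_local. intros k Hk.
        unfold z. assert (y (cred k) = 0) as ->; [|ring].
        apply NNPP; intros Hne. destruct (Hy _ Hne) as (HkB & Hball). apply HjB.
        set (v := zquo Q (zsub k a)). assert (k = zadd (cred k) (zscal (Z.of_nat Q) v)) as Ek by apply Hquo.
        set (j' := zsub j (zscal (Z.of_nat Q) v)).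
        assert (In j' B) as Hj'.
        { apply Hball. replace (zsub j' (cred k)) with (zsub j k).
          - rewrite znorm_sub_sym. auto.
          - rewrite Ek at 1. unfold j'. zvec. }
        replace j with j'; [auto|]. specialize (HK j' Hj'). apply vec_ext; intros p.
        pose proof (znorm_nth j' p) as Hn. pose proof (proj1 (HD j) Hj p) as Hjp.
        assert (Vector.nth j' p = Vector.nth j p - Z.of_nat Q * Vector.nth v p)%Z as En
          by (unfold j'; rewrite nth_zsub, nth_zscal; reflexivity).
        assert (Vector.nth v p = 0)%Z as Ev; [|rewrite En, Ev; lia].
        assert (Z.of_nat K <= Z.of_nat KK)%Z by lia.
        assert (Z.of_nat Q * Vector.nth v p < Z.of_nat Q)%Z by lia.
        assert (- Z.of_nat Q < Z.of_nat Q * Vector.nth v p)%Z by lia. nia.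
    - intros i v. pose proof (S_periodic Q z HQ Hz i v) as A1. pose proof (S_periodic Q m HQ HmQ i v) as A2.
      cbv beta in A1, A2. now rewrite A1, A2. }
  assert (lsum (fun j => S P j z - S P j m) B = WB P B (fun i => m i + y i) - WB P B m) as E2.
  { unfold WB. rewrite <- lsum_minus. apply lsum_ext; intros j Hj. f_equal. apply A_local. intros k Hk.
    unfold z. rewrite Hcred; [auto|]. specialize (HK j Hj). apply Hr in Hk.
    pose proof (znorm_triang (zsub k j) j) as Ht. replace (zadd (zsub k j) j) with k in Ht by zvec. lia. }
  rewrite lsum_minus in E1. unfold WB in Hle. lra.
Qed.

End Periodic.

(** * Ordered orbits between two equilibria *)

(** Serves to differentiate the energy along an orbit from its Taylor inequality, without a chain
    rule in many variables. *)
Lemma derivable_quadratic_error (f g : R -> R) t l eta C : 0 < eta -> 0 <= C ->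
  derivable_pt_lim g t l ->
  (forall h, Rabs h < eta -> Rabs (f (t + h) - f t - (g (t + h) - g t)) <= C * h^2) ->
  derivable_pt_lim f t l.
Proof.
  intros He HC Hg Hr eps Heps.
  destruct (Hg (eps / 2) ltac:(lra)) as (dl & Hd).
  assert (0 < eps / (2 * (C + 1))) as H1 by (apply Rdiv_lt_0_compat; lra).
  assert (0 < Rmin (Rmin dl eta) (eps / (2 * (C + 1)))) as Hp.
  { apply Rmin_pos; [apply Rmin_pos; [apply cond_pos|auto]|auto]. }
  exists (mkposreal _ Hp). intros h Hh Hh'. simpl in Hh'.
  assert (Rabs h < dl) as A1 by (eapply Rlt_le_trans; [exact Hh'|]; eapply Rle_trans; [apply Rmin_l|apply Rmin_l]).
  assert (Rabs h < eta) as A2 by (eapply Rlt_le_trans; [exact Hh'|]; eapply Rle_trans; [apply Rmin_l|apply Rmin_r]).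
  assert (Rabs h < eps / (2 * (C + 1))) as A3 by (eapply Rlt_le_trans; [exact Hh'|apply Rmin_r]).
  specialize (Hd h Hh A1). specialize (Hr h A2).
  set (r := f (t + h) - f t - (g (t + h) - g t)) in *.
  replace ((f (t + h) - f t) / h - l) with (((g (t + h) - g t) / h - l) + r / h) by (unfold r; field; auto).
  eapply Rle_lt_trans; [apply Rabs_triang|].
  assert (0 < Rabs h) as Hh0 by now apply Rabs_pos_lt.
  assert (Rabs (r / h) <= C * Rabs h) as Hrh.
  { unfold Rdiv. rewrite Rabs_mult, Rabs_inv. apply Rmult_le_reg_r with (Rabs h); [auto|].
    rewrite Rmult_assoc, Rinv_l by lra. rewrite Rmult_1_r. eapply Rle_trans; [exact Hr|].
    rewrite <- (pow2_abs h). right; ring. }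
  assert (Rabs h * (2 * (C + 1)) < eps) as A4.
  { apply (Rmult_lt_compat_r (2 * (C + 1))) in A3; [|lra].
    replace (eps / (2 * (C + 1)) * (2 * (C + 1))) with eps in A3 by (field; lra). auto. }
  pose proof (Rmult_le_pos _ _ HC (Rlt_le _ _ Hh0)). lra.
Qed.

Section Heteroclinic.
Context {d : nat}.
Variable P : LocalPotentials d.
Variable w : Vector.t Q d.
Variable q : nat.
Hypothesis Hq : integral_period w q.

Notation Flow := (Phi P w).
Notation T := (total q).

Definition comparable (x y : config d) : Prop := (forall i, x i <= y i) \/ (forall i, y i <= x i).
Definition between (x y z : config d) : Prop := forall i, x i <= z i <= y i.
Definition equilibrium (x : config d) : Prop := Xw w x /\ forall i, V P x i = 0.
Definition one_signed (z : config d) : Prop := (forall i, 0 <= V P z i) \/ (forall i, V P z i <= 0).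
Definition tends_to (z e : config d) : Prop :=
  forall eps, 0 < eps -> exists t0, 0 <= t0 /\ forall t, t0 <= t -> forall i, Rabs (Flow z t i - e i) <= eps.

Lemma period_pos : (0 < q)%nat.
Proof. apply Hq. Qed.

Lemma Xw_perq x : Xw w x -> per w q x.
Proof. now apply Xw_per. Qed.

Lemma Xw_gap x y : Xw w x -> Xw w y -> (forall i, x i <= y i) -> forall i, y i - x i <= T y - T x.
Proof. intros; apply (per_le_gap w q); auto using period_pos, Xw_perq. Qed.

Lemma Xw_eq x y : Xw w x -> Xw w y -> (forall i, x i <= y i) -> T y <= T x -> x = y.
Proof. intros; apply (per_le_eq w q); auto using period_pos, Xw_perq. Qed.

Lemma Xw_total_lt x y : Xw w x -> Xw w y -> (forall i, x i <= y i) -> x <> y -> T x < T y.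
Proof. intros Hx Hy H Hne. apply Rnot_le_lt; intros Hle. apply Hne. now apply Xw_eq. Qed.

Lemma Xw_segment x y th : Xw w x -> Xw w y -> Xw w (fun i => x i + th * (y i - x i)).
Proof.
  intros Hx Hy k l E. pose proof (Hx k l E) as E1. pose proof (Hy k l E) as E2.
  apply functional_extensionality; intros i. apply (f_equal (fun f => f i)) in E1, E2. unfold tau in *.
  replace (x (zadd i k)) with (x i - IZR l) by lra. replace (y (zadd i k)) with (y i - IZR l) by lra. ring.
Qed.

Lemma between_bound x y z j : between x y z -> In j (tbox d q) ->
  Rabs (z j) <= lsum (fun j => Rabs (x j) + Rabs (y j)) (tbox d q).
Proof.
  intros Hb Hj. eapply Rle_trans; [|apply (lsum_mem_le (fun j => Rabs (x j) + Rabs (y j)) (tbox d q) j); auto].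
  - specialize (Hb j). unfold Rabs; repeat destruct Rcase_abs; lra.
  - intros b _; pose proof (Rabs_pos (x b)); pose proof (Rabs_pos (y b)); lra.
Qed.

Lemma total_approx (x : config d) s :
  (forall e, 0 < e -> exists y, (forall i, Rabs (y i - x i) <= e) /\ T y <= s) -> T x <= s.
Proof.
  intros H. apply Rnot_lt_le; intros Hlt. set (L := INR (length (tbox d q))).
  assert (0 < L) as HL by apply length_tbox_pos, period_pos.
  destruct (H ((T x - s) / (2 * L)) ltac:(apply Rdiv_lt_0_compat; lra)) as (y & Hc & Hy).
  apply (total_close q) in Hc. fold L in Hc.
  replace (L * ((T x - s) / (2 * L))) with ((T x - s) / 2) in Hc by (field; lra).
  apply Rabs_le_inv in Hc; lra.
Qed.

Lemma total_approx_ge (x : config d) s :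
  (forall e, 0 < e -> exists y, (forall i, Rabs (y i - x i) <= e) /\ s <= T y) -> s <= T x.
Proof.
  intros H. apply Rnot_lt_le; intros Hlt. set (L := INR (length (tbox d q))).
  assert (0 < L) as HL by apply length_tbox_pos, period_pos.
  destruct (H ((s - T x) / (2 * L)) ltac:(apply Rdiv_lt_0_compat; lra)) as (y & Hc & Hy).
  apply (total_close q) in Hc. fold L in Hc.
  replace (L * ((s - T x) / (2 * L))) with ((s - T x) / 2) in Hc by (field; lra).
  apply Rabs_le_inv in Hc; lra.
Qed.

Lemma comparable_sym x y : comparable x y -> comparable y x.
Proof. intros [H|H]; [right|left]; auto. Qed.

(** Failure is an open condition: it is witnessed by strict opposite inequalities at two sites. *)
Lemma comparable_closed x y :
  (forall e, 0 < e -> exists x' y', comparable x' y' /\ (forall i, Rabs (x' i - x i) <= e) /\ (forall i, Rabs (y' i - y i) <= e)) ->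
  comparable x y.
Proof.
  intros H. destruct (classic (forall i, x i <= y i)) as [|H1]; [now left|].
  destruct (classic (forall i, y i <= x i)) as [|H2]; [now right|].
  apply not_all_ex_not in H1 as (i & Hi). apply not_all_ex_not in H2 as (j & Hj).
  apply Rnot_le_lt in Hi, Hj.
  destruct (H (Rmin (x i - y i) (y j - x j) / 4)) as (x' & y' & Hc & Hx & Hy).
  { assert (0 < Rmin (x i - y i) (y j - x j)) by (apply Rmin_pos; lra). lra. }
  pose proof (Rmin_l (x i - y i) (y j - x j)). pose proof (Rmin_r (x i - y i) (y j - x j)).
  pose proof (Rabs_le_inv _ _ (Hx i)). pose proof (Rabs_le_inv _ _ (Hx j)).
  pose proof (Rabs_le_inv _ _ (Hy i)). pose proof (Rabs_le_inv _ _ (Hy j)).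
  destruct Hc as [Hc|Hc]; pose proof (Hc i); pose proof (Hc j); lra.
Qed.

Lemma between_closed x y z :
  (forall e, 0 < e -> exists z', between x y z' /\ forall i, Rabs (z' i - z i) <= e) -> between x y z.
Proof.
  intros H i. split; apply Rnot_lt_le; intros Hlt.
  - destruct (H ((x i - z i) / 2)) as (z' & Hb & Hc); [lra|].
    specialize (Hb i); specialize (Hc i); apply Rabs_le_inv in Hc; lra.
  - destruct (H ((z i - y i) / 2)) as (z' & Hb & Hc); [lra|].
    specialize (Hb i); specialize (Hc i); apply Rabs_le_inv in Hc; lra.
Qed.

Lemma exp_mult_small t e : 0 < e -> exists dl, 0 < dl /\ 2 * dl * exp (2 * Kc P * Rabs t) <= e.
Proof.
  intros He. pose proof (exp_pos (2 * Kc P * Rabs t)) as Hp.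
  exists (e / (2 * exp (2 * Kc P * Rabs t))). split; [apply Rdiv_lt_0_compat; lra|]. right; field; lra.
Qed.

Lemma Flow_continuous t e : 0 < e -> exists dl, 0 < dl /\ forall x y, Lin w x -> Lin w y ->
  (forall i, Rabs (y i - x i) <= dl) -> forall i, Rabs (Flow y t i - Flow x t i) <= e.
Proof.
  intros He. destruct (exp_mult_small t e He) as (dl & Hd & Hdl). exists dl; split; [auto|].
  intros x y Hx Hy H i. eapply Rle_trans; [apply (Phi_lipschitz P w x y dl); auto; lra|auto].
Qed.

(** The sign orders [z] against its later positions; the monotone flow for time [a] carries this to
    any two positions. *)
Lemma one_signed_order z : Lin w z -> one_signed z ->
  (forall a b, 0 <= a <= b -> forall i, Flow z a i <= Flow z b i) \/
  (forall a b, 0 <= a <= b -> forall i, Flow z b i <= Flow z a i).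
Proof.
  intros Hz [H|H]; [left|right]; intros a b Hab i;
    (replace b with (a + (b - a)) by ring; rewrite <- Phi_add by auto; apply Phi_mono; auto using Phi_Lin; [|lra]);
    intros j; [apply Phi_subsolution|apply Phi_supersolution]; auto; lra.
Qed.

Lemma one_signed_chain z : Lin w z -> one_signed z ->
  forall a b, 0 <= a -> 0 <= b -> comparable (Flow z a) (Flow z b).
Proof.
  intros Hz H a b Ha Hb. destruct (one_signed_order z Hz H) as [Ho|Ho];
    destruct (Rle_or_lt a b) as [Hab|Hab]; unfold comparable.
  - left; apply Ho; lra.
  - right; apply Ho; lra.
  - right; apply Ho; lra.
  - left; apply Ho; lra.
Qed.

Lemma cluster_between x y (z : nat -> config d) : (forall n, Xw w (z n)) -> (forall n, between x y (z n)) ->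
  exists e, Xw w e /\ between x y e /\
    forall eps, 0 < eps -> forall N, exists n, (N <= n)%nat /\ forall i, Rabs (z n i - e i) <= eps.
Proof.
  intros Hz Hb.
  destruct (per_cluster w q z (lsum (fun j => Rabs (x j) + Rabs (y j)) (tbox d q)) period_pos) as (e & He & Hc).
  - intros n; apply Xw_perq, Hz.
  - intros n j; now apply between_bound.
  - exists e; split; [|split; [|auto]].
    + apply Xw_closed. intros eps Hp. destruct (Hc eps Hp 0%nat) as (n & _ & Hn). exists (z n); auto.
    + apply between_closed. intros eps Hp. destruct (Hc eps Hp 0%nat) as (n & _ & Hn). exists (z n); auto.
Qed.

Lemma tends_to_equilibrium z e : Xw w z -> Xw w e -> tends_to z e -> equilibrium e.
Proof.
  intros Hz He H. split; [auto|]. apply (equilibrium_of_Phi P w); [now apply Xw_Lin|].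
  intros s Hs. apply functional_extensionality; intros i. apply NNPP; intros Hne.
  set (a := Rabs (Flow e s i - e i)). assert (0 < a) as Ha by (apply Rabs_pos_lt; lra).
  destruct (Flow_continuous s (a / 4)) as (dl & Hd & Hf); [lra|].
  assert (0 < Rmin dl (a / 4)) as Hm by (apply Rmin_pos; lra).
  destruct (H _ Hm) as (t0 & Ht0 & Ht).
  pose proof (Ht t0 ltac:(lra)) as H1. pose proof (Ht (s + t0) ltac:(lra) i) as H2.
  assert (Rabs (Flow (Flow z t0) s i - Flow e s i) <= a / 4) as H3.
  { apply Hf; auto using Phi_Lin, Xw_Lin. intros j; eapply Rle_trans; [apply H1|apply Rmin_l]. }
  rewrite Phi_add in H3 by now apply Xw_Lin.
  pose proof (Rmin_r dl (a / 4)).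
  unfold a in *. revert H2 H3 Ha H0. unfold Rabs at 1 3. unfold Rabs. repeat destruct Rcase_abs; lra.
Qed.

Lemma one_signed_converges x y z : Xw w z -> one_signed z ->
  (forall t, 0 <= t -> between x y (Flow z t)) -> exists e, equilibrium e /\ between x y e /\ tends_to z e.
Proof.
  intros Hz H Hb.
  destruct (cluster_between x y (fun n => Flow z (INR n))) as (e & He & Hbe & Hc).
  - intros n; now apply Xw_Phi.
  - intros n; apply Hb, pos_INR.
  - assert (tends_to z e) as Ht.
    { intros eps Hp. destruct (Hc (eps / 4) ltac:(lra) 0%nat) as (n & _ & Hn).
      exists (INR n); split; [apply pos_INR|]. intros t Htn i.
      destruct (archimed t) as (Hat & _).
      (* The orbit is monotone, so at time [t] it is squeezed between its positions at the times [n]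
         and [k], both close to the cluster point. *)
      destruct (Hc (eps / 4) ltac:(lra) (Z.to_nat (up t))) as (k & Hk & Hk').
      pose proof (pos_INR n).
      assert (t <= INR k) as Htk.
      { assert (INR (Z.to_nat (up t)) <= INR k) as Hi by now apply le_INR.
        rewrite INR_IZR_INZ, Z2Nat.id in Hi; [lra|]. apply le_IZR; lra. }
      specialize (Hn i). specialize (Hk' i). apply Rabs_le_inv in Hn, Hk'. apply Rabs_le.
      destruct (one_signed_order z (Xw_Lin w z Hz) H) as [Ho|Ho];
        pose proof (Ho (INR n) t ltac:(lra) i); pose proof (Ho t (INR k) ltac:(lra) i); lra. }
    exists e; split; [|auto]. now apply (tends_to_equilibrium z).
Qed.

(** On a class, the values of a member of [Xw] are determined by the value at [a]. A variation that
    stays in [Xw] must be constant on classes, hence the use of [class_ind] instead of a single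
    site. *)
Definition same_class (a i : Zd d) : Prop := exists l : Z, om w i - om w a = IZR l.
Definition class_ind (a i : Zd d) : R := if excluded_middle_informative (same_class a i) then 1 else 0.
Definition class_size (a : Zd d) : R := lsum (class_ind a) (tbox d q).

Lemma class_ind_shift a i k l : om w k + IZR l = 0 -> class_ind a (zadd i k) = class_ind a i.
Proof.
  intros H. unfold class_ind.
  destruct (excluded_middle_informative (same_class a (zadd i k))) as [(m & Hm)|N1],
    (excluded_middle_informative (same_class a i)) as [(m' & Hm')|N2]; auto; exfalso; rewrite ?om_add in *.
  - apply N2. exists (m + l)%Z. rewrite plus_IZR, <- Hm. lra.
  - apply N1. exists (m' - l)%Z. rewrite om_add, minus_IZR, <- Hm'. lra.
Qed.

Lemma class_ind_bounds a i : 0 <= class_ind a i <= 1.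
Proof. unfold class_ind; destruct excluded_middle_informative; lra. Qed.

Lemma class_ind_periodic a : Zperiodic q (class_ind a).
Proof.
  intros i v. destruct (proj2 Hq v) as (l & Hl). apply (class_ind_shift a i _ (- l)).
  rewrite om_scal, <- INR_IZR_INZ, Hl, opp_IZR. ring.
Qed.

Lemma class_size_pos a : 0 < class_size a.
Proof.
  apply Rlt_le_trans with (class_ind a (zred q a)).
  - rewrite <- (Zperiodic_red q (class_ind a) a period_pos (class_ind_periodic a)).
    unfold class_ind. destruct excluded_middle_informative as [|N]; [lra|].
    exfalso; apply N. exists 0%Z; ring.
  - apply lsum_mem_le; [intros; apply class_ind_bounds|apply zred_in, period_pos].
Qed.

Lemma class_value z a i (g : config d -> Zd d -> R) :
  (forall k l x i, g (tau k l x) i = g x (zadd i k)) -> Xw w z -> same_class a i -> g z i = g z a.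
Proof.
  intros Hg Hz (l & Hl). specialize (Hz (zsub i a) (- l)%Z).
  rewrite <- Hz at 2.
  - rewrite Hg. f_equal; zvec.
  - rewrite opp_IZR, <- Hl. replace i with (zadd (zsub i a) a) at 2 by zvec. rewrite om_add. ring.
Qed.

Lemma class_diff x z a i : Xw w x -> Xw w z -> same_class a i -> z i - x i = z a - x a.
Proof.
  intros Hx Hz (l & Hl).
  assert (om w (zsub i a) + IZR (- l) = 0) as E.
  { rewrite opp_IZR, <- Hl. replace i with (zadd (zsub i a) a) at 2 by zvec. rewrite om_add. ring. }
  pose proof (f_equal (fun f => f a) (Hx _ _ E)) as E1. pose proof (f_equal (fun f => f a) (Hz _ _ E)) as E2.
  cbv beta in E1, E2. unfold tau in E1, E2. replace (zadd a (zsub i a)) with i in E1, E2 by zvec. lra.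
Qed.

(* On the slice, the Euler-Lagrange inequalities say that mass cannot be moved
   profitably from a site with [gradW > 0] to one with [gradW < 0]; the constraints
   [x <= z <= y] are harmless since [x] and [y] are equilibria. *)
Lemma slice_minimizer x y s : equilibrium x -> equilibrium y -> (forall i, x i <= y i) -> x <> y ->
  T x <= s <= T y -> exists z, Xw w z /\ between x y z /\ T z = s /\ one_signed z.
Proof.
  intros (Hx & Vx) (Hy & Vy) Hxy Hne Hs.
  pose proof (Xw_total_lt x y Hx Hy Hxy Hne) as HT.
  set (K := fun z => Xw w z /\ between x y z /\ T z = s).
  set (L := INR (length (tbox d q))).
  assert (0 < L) as HL by apply length_tbox_pos, period_pos.
  destruct (S_bounded_below P) as (m & Hm).
  destruct (min_exists w q K (WB P (tbox d q)) (lsum (fun j => Rabs (x j) + Rabs (y j)) (tbox d q)) (L * m) period_pos)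
    as (z & (Hz & Hb & HTz) & Hmin).
  - intros z Hz; apply Xw_perq, Hz.
  - intros z j (_ & Hb & _); now apply between_bound.
  - intros z Hz. split; [|split].
    + apply Xw_closed. intros e He. destruct (Hz e He) as (z' & Hz' & Hc). exists z'; split; [apply Hz'|auto].
    + apply between_closed. intros e He. destruct (Hz e He) as (z' & Hz' & Hc). exists z'; split; [apply Hz'|auto].
    + apply Rle_antisym; [apply total_approx|apply total_approx_ge]; intros e He;
        destruct (Hz e He) as (z' & (_ & _ & Hz') & Hc); exists z'; split; auto; lra.
  - apply WB_continuous.
  - intros z _. unfold L. rewrite <- lsum_const. apply lsum_le; intros; apply Hm.
  - set (th := (s - T x) / (T y - T x)).
    assert (0 <= th <= 1) as Hth.
    { unfold th; split; [apply Rmult_le_pos; [lra|left; apply Rinv_0_lt_compat; lra]|].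
      apply Rmult_le_reg_r with (T y - T x); [lra|].
      replace ((s - T x) / (T y - T x) * (T y - T x)) with (s - T x) by (field; lra). lra. }
    exists (fun i => x i + th * (y i - x i)). split; [|split].
    + now apply Xw_segment.
    + intros i. specialize (Hxy i). nra.
    + unfold total. rewrite lsum_plus, lsum_scal, lsum_minus. fold (T x) (T y). unfold th. field; lra.
  - exists z; split; [auto|split; [auto|split; [auto|]]].
    apply NNPP; intros Hn. unfold one_signed in Hn. apply not_or_and in Hn as (N1 & N2).
    apply not_all_ex_not in N1 as (a & Ha). apply not_all_ex_not in N2 as (b & Hb').
    apply Rnot_le_lt in Ha, Hb'.
    (* A site with negative [V] cannot touch [x], nor one with positive [V] touch [y]:
       quasimonotonicity against the equilibrium gives the opposite sign. So there is room to lower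
       the class of [a] and raise that of [b]. *)
    assert (x a < z a) as Hza.
    { destruct (proj1 (Hb a)) as [|E]; [auto|].
      pose proof (V_quasimonotone P x z (fun i => proj1 (Hb i)) a) as Hqm. rewrite Vx, E in Hqm. lra. }
    assert (z b < y b) as Hzb.
    { destruct (proj2 (Hb b)) as [|E]; [auto|].
      pose proof (V_quasimonotone P z y (fun i => proj2 (Hb i)) b) as Hqm. rewrite Vy, E in Hqm. lra. }
    pose proof (class_size_pos a) as Ca. pose proof (class_size_pos b) as Cb.
    (* Normalised by the class sizes, so that the variation leaves the height [T] unchanged. *)
    set (eta := fun i => / class_size b * class_ind b i - / class_size a * class_ind a i).
    assert (Zperiodic q eta) as He by (intros i v; unfold eta; now rewrite !class_ind_periodic).
    pose proof (Rinv_0_lt_compat _ Ca) as Ia. pose proof (Rinv_0_lt_compat _ Cb) as Ib.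
    assert (forall i, Rabs (eta i) <= / class_size b + / class_size a) as Hbd.
    { intros i. unfold eta. pose proof (class_ind_bounds a i). pose proof (class_ind_bounds b i). apply Rabs_le; nra. }
    assert (forall c, lsum (fun j => gradW P z j * class_ind c j) (tbox d q) = class_size c * gradW P z c) as Hgc.
    { intros c. unfold class_size. rewrite (Rmult_comm (lsum _ _)), <- lsum_scal. apply lsum_ext; intros j _.
      unfold class_ind. destruct excluded_middle_informative as [Hc|]; [|ring].
      assert (V P z j = V P z c) as E by (apply (class_value z c j (V P)); auto; intros; apply V_tau).
      unfold V in E. lra. }
    destruct (W_variation P w q z eta _ Hq (Xw_perq z Hz) He Hbd) as (C & HC & HW).
    assert (lsum (fun j => gradW P z j * eta j) (tbox d q) = gradW P z b - gradW P z a) as Hg.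
    { rewrite (lsum_ext _ (fun j => / class_size b * (gradW P z j * class_ind b j) - / class_size a * (gradW P z j * class_ind a j)))
        by (intros; unfold eta; ring).
      rewrite lsum_minus, !lsum_scal, !Hgc. field; lra. }
    rewrite Hg in HW.
    assert (0 <= gradW P z b - gradW P z a) as Hfin; [|unfold V in *; lra].
    set (h0 := Rmin (class_size a * (z a - x a)) (class_size b * (y b - z b))).
    apply (slope_nonneg _ C h0); auto.
    { apply Rmin_pos; apply Rmult_lt_0_compat; lra. }
    intros h (Hh & Hh0). specialize (HW h).
    assert (WB P (tbox d q) z <= WB P (tbox d q) (fun i => z i + h * eta i)); [|lra].
    assert (h * / class_size a <= z a - x a) as Ka.
    { apply Rmult_le_reg_r with (class_size a); [auto|]. rewrite Rmult_assoc, Rinv_l by lra.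
      pose proof (Rmin_l (class_size a * (z a - x a)) (class_size b * (y b - z b))). fold h0 in H. lra. }
    assert (h * / class_size b <= y b - z b) as Kb.
    { apply Rmult_le_reg_r with (class_size b); [auto|]. rewrite Rmult_assoc, Rinv_l by lra.
      pose proof (Rmin_r (class_size a * (z a - x a)) (class_size b * (y b - z b))). fold h0 in H. lra. }
    pose proof (Rmult_lt_0_compat _ _ Hh Ia). pose proof (Rmult_lt_0_compat _ _ Hh Ib).
    apply Hmin. split; [|split].
    + intros k l E. pose proof (Hz k l E) as E1. apply functional_extensionality; intros i.
      apply (f_equal (fun f => f i)) in E1. unfold tau in *. unfold eta.
      rewrite !(class_ind_shift _ i k l E). lra.
    + intros i. pose proof (Hb i). unfold eta. split.
      * assert (h * / class_size a * class_ind a i <= z i - x i); [|pose proof (class_ind_bounds b i); nra].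
        unfold class_ind. destruct excluded_middle_informative as [Hc|]; [|lra].
        rewrite (class_diff x z a i) by auto. lra.
      * assert (h * / class_size b * class_ind b i <= y i - z i); [|pose proof (class_ind_bounds a i); nra].
        unfold class_ind. destruct excluded_middle_informative as [Hc|]; [|lra].
        rewrite (class_diff z y b i) by auto. lra.
    + rewrite <- HTz. unfold total, eta. rewrite lsum_plus, lsum_scal, lsum_minus, !lsum_scal.
      fold (class_size a) (class_size b). field; lra.
Qed.

(** * Complete ordered orbits as limits *)

Definition ordered_orbit (x y p : config d) : Prop :=
  Xw w p /\ (forall t, between x y (Flow p t)) /\ forall s t, comparable (Flow p s) (Flow p t).

Lemma Flow_between x y z t : equilibrium x -> equilibrium y -> Lin w z -> between x y z -> 0 <= t ->
  between x y (Flow z t).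
Proof.
  intros (Hx & Vx) (Hy & Vy) Hz Hb Ht i.
  rewrite <- (Phi_equilibrium P w x t (Xw_Lin w x Hx) Vx), <- (Phi_equilibrium P w y t (Xw_Lin w y Hy) Vy).
  split; apply Phi_mono; auto using Xw_Lin; intros j; apply Hb.
Qed.

(** The starting points approach [e0] while the crossing height [c] stays fixed, which keeps the
    limit away from [e0]; recentring at the crossing pushes the starting time to minus infinity. *)
Lemma limit_orbit x y e0 c : equilibrium x -> equilibrium y -> equilibrium e0 -> c <> T e0 ->
  (forall eps, 0 < eps -> exists z, (Xw w z /\ one_signed z /\ between x y z /\
     (forall i, Rabs (z i - e0 i) <= eps)) /\ exists t, 0 <= t /\ T (Flow z t) = c) ->
  exists p, ordered_orbit x y p /\ T p = c.
Proof.
  intros Hx Hy (He0 & Ve0) Hc H.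
  set (ep := fun n : nat => / INR (Datatypes.S n)).
  assert (forall n, 0 < ep n) as Hep by (intros; apply Rinv_0_lt_compat, lt_0_INR; lia).
  destruct (choice_fun _ (fun n => H (ep n) (Hep n))) as (z & HZ).
  destruct (choice_fun _ (fun n => proj2 (HZ n))) as (tm & Ht).
  assert (forall n, Lin w (z n)) as HzL by (intros n; apply Xw_Lin, (HZ n)).
  set (L := INR (length (tbox d q))). assert (0 < L) as HL by apply length_tbox_pos, period_pos.
  (* An orbit that starts near the equilibrium [e0] stays near it up to any fixed time, so it
     reaches the different height [c] late. *)
  assert (forall A, exists N, forall n, (N <= n)%nat -> A <= tm n) as Hinf.
  { intros A. assert (0 < Rabs (c - T e0)) as Hp by (apply Rabs_pos_lt; lra).
    pose proof (Kc_pos P) as HK. set (E := exp (2 * Kc P * Rabs A)). assert (0 < E) as HE by apply exp_pos.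
    destruct (archimed_cor1 (Rabs (c - T e0) / (L * (2 * E)))) as (N & HN & HN0).
    { apply Rdiv_lt_0_compat; [auto|]. apply Rmult_lt_0_compat; lra. }
    exists N. intros n Hn. apply Rnot_lt_le; intros Hlt.
    destruct (HZ n) as ((_ & _ & _ & Hcl) & _). destruct (Ht n) as (Ht1 & Ht2).
    pose proof (Phi_lipschitz P w e0 (z n) (ep n) (tm n) (Xw_Lin w e0 He0) (HzL n) (Rlt_le _ _ (Hep n)) Hcl) as Hl.
    apply (total_close q) in Hl. fold L in Hl. rewrite Ht2, (Phi_equilibrium P w e0) in Hl by auto using Xw_Lin.
    assert (ep n <= / INR N) as Hen by (apply Rinv_le_contravar; [apply lt_0_INR; lia|apply le_INR; lia]).
    assert (exp (2 * Kc P * Rabs (tm n)) <= E) as HEn.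
    { left; apply exp_increasing, Rmult_lt_compat_l; [lra|]. rewrite (Rabs_right (tm n)) by lra.
      pose proof (Rle_abs A); lra. }
    assert (ep n < Rabs (c - T e0) / (L * (2 * E))) as Hen' by lra.
    apply (Rmult_lt_compat_r (L * (2 * E))) in Hen'; [|apply Rmult_lt_0_compat; lra].
    replace (Rabs (c - T e0) / (L * (2 * E)) * (L * (2 * E))) with (Rabs (c - T e0)) in Hen' by (field; split; lra).
    assert (2 * ep n * exp (2 * Kc P * Rabs (tm n)) <= 2 * ep n * E) as Hm.
    { apply Rmult_le_compat_l; [pose proof (Hep n); lra|auto]. }
    apply (Rmult_le_compat_l L) in Hm; [|lra]. lra. }
  set (p := fun n => Flow (z n) (tm n)).
  assert (forall n, Xw w (p n)) as HpX by (intros n; apply Xw_Phi, (HZ n)).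
  destruct (cluster_between x y p) as (r & Hr & Hbr & Hcl); auto.
  { intros n. apply Flow_between; auto; [apply (HZ n)|apply Ht]. }
  assert (forall s n, Flow (p n) s = Flow (z n) (s + tm n)) as Hps by (intros; apply Phi_add; auto).
  exists r. split; [split; [auto|split]|].
  - intros t. apply between_closed. intros e He.
    destruct (Flow_continuous t e He) as (dl & Hd & Hf). destruct (Hinf (- t)) as (N & HN).
    destruct (Hcl dl Hd N) as (n & Hn & Hn'). exists (Flow (p n) t). split.
    + rewrite Hps. apply Flow_between; auto; [apply (HZ n)|]. specialize (HN n Hn); lra.
    + apply Hf; auto using Xw_Lin.
  - intros s t. apply comparable_closed. intros e He.
    destruct (Flow_continuous s e He) as (d1 & Hd1 & Hf1). destruct (Flow_continuous t e He) as (d2 & Hd2 & Hf2).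
    destruct (Hinf (- s)) as (N1 & HN1). destruct (Hinf (- t)) as (N2 & HN2).
    assert (0 < Rmin d1 d2) as Hd by now apply Rmin_pos.
    destruct (Hcl _ Hd (max N1 N2)) as (n & Hn & Hn').
    exists (Flow (p n) s), (Flow (p n) t). split; [|split].
    + rewrite !Hps. apply one_signed_chain; auto; [apply (HZ n)| |].
      * specialize (HN1 n ltac:(lia)); lra.
      * specialize (HN2 n ltac:(lia)); lra.
    + apply Hf1; auto using Xw_Lin. intros i; eapply Rle_trans; [apply Hn'|apply Rmin_l].
    + apply Hf2; auto using Xw_Lin. intros i; eapply Rle_trans; [apply Hn'|apply Rmin_r].
  - apply Rle_antisym; [apply total_approx|apply total_approx_ge]; intros e He;
      destruct (Hcl e He 0%nat) as (n & _ & Hn'); exists (p n); split; auto; unfold p; rewrite (proj2 (Ht n)); lra.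
Qed.

Lemma total_Flow_continuous z : Lin w z -> continuity (fun t => T (Flow z t)).
Proof.
  intros Hz t. apply derivable_continuous_pt. exists (lsum (V P (Flow z t)) (tbox d q)).
  apply (lsum_derivable (fun i t => Flow z t i)). intros; now apply Phi_derivable.
Qed.

Lemma level_reached z e c : Xw w z -> Xw w e -> tends_to z e -> Rmin (T z) (T e) < c < Rmax (T z) (T e) ->
  exists t, 0 <= t /\ T (Flow z t) = c.
Proof.
  intros Hz He Ht Hc. set (L := INR (length (tbox d q))).
  assert (0 < L) as HL by apply length_tbox_pos, period_pos.
  set (g := Rmin (c - Rmin (T z) (T e)) (Rmax (T z) (T e) - c)).
  assert (0 < g) as Hg by (apply Rmin_pos; lra).
  destruct (Ht (g / (2 * L)) ltac:(apply Rdiv_lt_0_compat; lra)) as (t0 & Ht0 & Hcl).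
  specialize (Hcl t0 ltac:(lra)). apply (total_close q) in Hcl. fold L in Hcl.
  replace (L * (g / (2 * L))) with (g / 2) in Hcl by (field; lra). apply Rabs_le_inv in Hcl.
  pose proof (Rmin_l (c - Rmin (T z) (T e)) (Rmax (T z) (T e) - c)) as G1.
  pose proof (Rmin_r (c - Rmin (T z) (T e)) (Rmax (T z) (T e) - c)) as G2. fold g in G1, G2.
  destruct (IVT_gen (fun t => T (Flow z t)) 0 t0 c) as (t & Htt & E).
  - apply total_Flow_continuous; now apply Xw_Lin.
  - rewrite Phi_0 by now apply Xw_Lin. revert Hc G1 G2 Hcl.
    unfold Rmin, Rmax; repeat destruct Rle_dec; lra.
  - exists t; split; [|auto]. rewrite Rmin_left in Htt by lra. lra.
Qed.

(** * Basins of attraction and a third equilibrium *)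

Definition attracting (x y e : config d) : Prop :=
  exists g, 0 < g /\ forall p, Xw w p -> between x y p -> (forall i, Rabs (p i - e i) <= g) -> tends_to p e.

Lemma tends_to_shift z e t : Lin w z -> 0 <= t -> tends_to (Flow z t) e -> tends_to z e.
Proof.
  intros Hz Ht H eps He. destruct (H eps He) as (t0 & Ht0 & Hc). exists (t0 + t); split; [lra|].
  intros s Hs i. specialize (Hc (s - t) ltac:(lra) i). rewrite Phi_add in Hc by auto.
  replace (s - t + t) with s in Hc by ring. auto.
Qed.

Lemma tends_to_shift_back z e t : Lin w z -> 0 <= t -> tends_to z e -> tends_to (Flow z t) e.
Proof.
  intros Hz Ht H eps He. destruct (H eps He) as (t0 & Ht0 & Hc). exists t0; split; [lra|].
  intros s Hs i. rewrite Phi_add by auto. apply Hc; lra.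
Qed.

Lemma positive_gap x y : Xw w x -> Xw w y -> (forall i, x i < y i) -> exists g, 0 < g /\ forall i, x i + g <= y i.
Proof.
  intros Hx Hy H.
  destruct (list_small (fun i r => x i + r <= y i) (tbox d q)) as (g & Hg & Hgi).
  - intros; lra.
  - intros i _; exists (y i - x i); split; [specialize (H i); lra|lra].
  - exists g; split; [auto|]. intros i.
    pose proof (per_diff w q x y (Xw_perq x Hx) (Xw_perq y Hy)) as Hp.
    pose proof (Zperiodic_red q _ i period_pos Hp) as E. cbv beta in E.
    specialize (Hgi (zred q i) (zred_in q i period_pos)). lra.
Qed.

(** [Flow z 1] is strictly above [x], by a uniform gap thanks to periodicity. Whatever starts in the
    interval within this gap of [x] is squeezed between [x] and the orbit of [z]. *)
Lemma attracting_lower x y z : equilibrium x -> Xw w z -> between x y z -> z <> x -> tends_to z x ->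
  attracting x y x.
Proof.
  intros (Hx & Vx) Hz Hb Hne Ht.
  assert (Lin w x /\ Lin w z) as (Lx & Lz) by (split; now apply Xw_Lin).
  assert (forall i, x i < Flow z 1 i) as Hst.
  { intros i. rewrite <- (Phi_equilibrium P w x 1 Lx Vx). apply Phi_strong; auto; [apply Hb|lra]. }
  destruct (positive_gap x (Flow z 1) Hx (Xw_Phi P w z 1 Hz) Hst) as (g & Hg & Hgi).
  exists g; split; [auto|]. intros p Hp Hbp Hpx eps He.
  destruct (tends_to_shift_back z x 1 Lz ltac:(lra) Ht eps He) as (t0 & Ht0 & Hc).
  exists t0; split; [auto|]. intros t Htt i. specialize (Hc t Htt i). apply Rabs_le_inv in Hc. apply Rabs_le.
  assert (x i <= Flow p t i).
  { rewrite <- (Phi_equilibrium P w x t Lx Vx). apply Phi_mono; auto using Xw_Lin; [apply Hbp|lra]. }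
  assert (Flow p t i <= Flow (Flow z 1) t i); [|lra].
  apply Phi_mono; auto using Xw_Lin, Phi_Lin; [|lra]. intros j. specialize (Hgi j). specialize (Hpx j).
  apply Rabs_le_inv in Hpx; lra.
Qed.

Lemma attracting_upper x y z : equilibrium y -> Xw w z -> between x y z -> z <> y -> tends_to z y ->
  attracting x y y.
Proof.
  intros (Hy & Vy) Hz Hb Hne Ht.
  assert (Lin w y /\ Lin w z) as (Ly & Lz) by (split; now apply Xw_Lin).
  assert (forall i, Flow z 1 i < y i) as Hst.
  { intros i. rewrite <- (Phi_equilibrium P w y 1 Ly Vy). apply Phi_strong; auto; [apply Hb|lra]. }
  destruct (positive_gap (Flow z 1) y (Xw_Phi P w z 1 Hz) Hy Hst) as (g & Hg & Hgi).
  exists g; split; [auto|]. intros p Hp Hbp Hpx eps He.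
  destruct (tends_to_shift_back z y 1 Lz ltac:(lra) Ht eps He) as (t0 & Ht0 & Hc).
  exists t0; split; [auto|]. intros t Htt i. specialize (Hc t Htt i). apply Rabs_le_inv in Hc. apply Rabs_le.
  assert (Flow p t i <= y i).
  { rewrite <- (Phi_equilibrium P w y t Ly Vy). apply Phi_mono; auto using Xw_Lin; [apply Hbp|lra]. }
  assert (Flow (Flow z 1) t i <= Flow p t i); [|lra].
  apply Phi_mono; auto using Xw_Lin, Phi_Lin; [|lra]. intros j. specialize (Hgi j). specialize (Hpx j).
  apply Rabs_le_inv in Hpx; lra.
Qed.

(** The orbit is only asked to come close to [e], not to converge: this is all that an omega-limit
    point provides. *)
Lemma basin_open x y e p : equilibrium x -> equilibrium y -> attracting x y e -> Xw w p -> between x y p ->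
  (forall eps, 0 < eps -> exists t, 0 <= t /\ forall i, Rabs (Flow p t i - e i) <= eps) ->
  exists dl, 0 < dl /\ forall p', Xw w p' -> between x y p' -> (forall i, Rabs (p' i - p i) <= dl) -> tends_to p' e.
Proof.
  intros Hx Hy (g & Hg & Ha) Hp Hb H. destruct (H (g / 2) ltac:(lra)) as (t & Ht & Hc).
  destruct (Flow_continuous t (g / 2) ltac:(lra)) as (dl & Hd & Hf). exists dl; split; [auto|].
  intros p' Hp' Hb' Hpp. apply (tends_to_shift p' e t); auto using Xw_Lin.
  apply Ha; [now apply Xw_Phi|apply Flow_between; auto using Xw_Lin|].
  intros i. specialize (Hc i). pose proof (Hf p p' (Xw_Lin w p Hp) (Xw_Lin w p' Hp') Hpp i) as H2.
  apply Rabs_le_inv in Hc, H2. apply Rabs_le; lra.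
Qed.

Lemma V_between_bound x y z : equilibrium x -> Xw w y -> Xw w z -> between x y z ->
  forall i, Rabs (V P z i) <= Kc P * (T y - T x).
Proof.
  intros (Hx & Vx) Hy Hz Hb i. rewrite <- (Rminus_0_r (V P z i)), <- (Vx i).
  apply V_lip. intros j. rewrite Rabs_right by (specialize (Hb j); lra).
  eapply Rle_trans; [apply Xw_gap; auto; apply Hb|].
  pose proof (total_le q z y (fun j => proj2 (Hb j))). lra.
Qed.

(** Freezing the gradient at time [t] leaves a linear function of the orbit and a Taylor error
    quadratic in the time step. Positive [t] keeps nearby times nonnegative, where the field is
    bounded. *)
Lemma W_dissipation x y p t : equilibrium x -> equilibrium y -> Xw w p -> between x y p -> 0 < t ->
  derivable_pt_lim (fun s => WB P (tbox d q) (Flow p s)) t (- lsum (fun j => (V P (Flow p t) j)^2) (tbox d q)).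
Proof.
  intros Hx Hy Hp Hb Ht. set (B := Kc P * (T y - T x)).
  assert (forall s i, 0 <= s -> Rabs (V P (Flow p s) i) <= B) as HB.
  { intros s i Hs. apply (V_between_bound x y); auto; [apply Hy|now apply Xw_Phi|].
    apply Flow_between; auto using Xw_Lin. }
  set (L := INR (length (tbox d q))).
  replace (- lsum (fun j => (V P (Flow p t) j)^2) (tbox d q)) with
    (lsum (fun j => gradW P (Flow p t) j * V P (Flow p t) j) (tbox d q)).
  2:{ rewrite <- (Rmult_1_l (lsum (fun j => _ ^ 2) _)), Ropp_mult_distr_l, <- lsum_scal. apply lsum_ext; intros j _.
      unfold V; ring. }
  apply (derivable_quadratic_error _ (fun s => lsum (fun j => gradW P (Flow p t) j * Flow p s j) (tbox d q)) t _ t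
    (L * (Cbd P * (nB P * B)^2))); auto.
  - apply Rmult_le_pos; [apply pos_INR|]. apply Rmult_le_pos; [left; apply Cbd_spec|apply pow2_ge_0].
  - apply (lsum_derivable (fun j s => gradW P (Flow p t) j * Flow p s j)). intros j.
    apply (derivable_pt_lim_scal (fun s => Flow p s j)). apply Phi_derivable; now apply Xw_Lin.
  - intros h Hh. apply Rabs_def2 in Hh.
    assert (forall i, Rabs (Flow p (t + h) i - Flow p t i) <= B * Rabs h) as Hd.
    { intros i. destruct (mvt_any (fun s => Flow p s i) (fun s => V P (Flow p s) i) t (t + h)) as (c & -> & Hc).
      - intros; apply Phi_derivable; now apply Xw_Lin.
      - replace (t + h - t) with h by ring. rewrite Rabs_mult. apply Rmult_le_compat_r; [apply Rabs_pos|].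
        apply HB. revert Hc; unfold Rmin; destruct Rle_dec; lra. }
    pose proof (W_taylor P q (Flow p t) (Flow p (t + h)) (B * Rabs h)) as HW.
    rewrite <- lsum_minus.
    rewrite (lsum_ext (fun a => gradW P (Flow p t) a * Flow p (t + h) a - gradW P (Flow p t) a * Flow p t a)
      (fun j => gradW P (Flow p t) j * (Flow p (t + h) j - Flow p t j))) by (intros; ring).
    eapply Rle_trans; [apply HW|]; auto.
    + apply (per_lattice w); auto. apply Xw_perq, Xw_Phi, Hp.
    + apply (per_diff w); apply Xw_perq, Xw_Phi, Hp.
    + rewrite !Rpow_mult_distr, <- (pow2_abs h). fold L. right; ring.
Qed.

(** The energy is bounded below, so its dissipation [D] comes arbitrarily close to 0 along the
    orbit; a cluster point of such positions is critical. *)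
Lemma omega_limit_equilibrium x y p : equilibrium x -> equilibrium y -> Xw w p -> between x y p ->
  exists e, equilibrium e /\ between x y e /\
    forall eps, 0 < eps -> exists t, 0 <= t /\ forall i, Rabs (Flow p t i - e i) <= eps.
Proof.
  intros Hx Hy Hp Hb. set (f := fun s => WB P (tbox d q) (Flow p s)).
  set (L := INR (length (tbox d q))).
  destruct (S_bounded_below P) as (m & Hm).
  assert (forall s, L * m <= f s) as Hf.
  { intros s. unfold L. rewrite <- lsum_const. apply lsum_le; intros; apply Hm. }
  set (D := fun z => lsum (fun j => (V P z j)^2) (tbox d q)).
  assert (forall e, 0 < e -> exists c, 0 <= c /\ D (Flow p c) <= e) as HD.
  { intros e He. apply NNPP; intros Hn.
    (* The count starts at time 1 because [W_dissipation] needs positive times. *)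
    assert (forall n : nat, f (INR n + 1) <= f 1 - INR n * e) as Hdec.
    { induction n as [|n IH]; [simpl; replace (0 + 1) with 1 by ring; lra|].
      rewrite S_INR. pose proof (pos_INR n).
      destruct (MVT_cor2 f (fun s => - D (Flow p s)) (INR n + 1) (INR n + 1 + 1)) as (c & Hc & Hc'); [lra| |].
      - intros c Hc. apply (W_dissipation x y); auto; lra.
      - assert (e < D (Flow p c)); [|lra]. apply Rnot_le_lt; intros Hle. apply Hn. exists c; split; [lra|auto]. }
    destruct (INR_unbounded ((f 1 - L * m) / e)) as (n & Hn').
    apply (Rmult_gt_compat_r e) in Hn'; [|lra].
    replace ((f 1 - L * m) / e * e) with (f 1 - L * m) in Hn' by (field; lra).
    specialize (Hdec n). specialize (Hf (INR n + 1)). lra. }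
  set (ep := fun n : nat => / INR (Datatypes.S n)).
  assert (forall n, 0 < ep n) as Hep by (intros; apply Rinv_0_lt_compat, lt_0_INR; lia).
  destruct (choice_fun (fun n c => 0 <= c /\ D (Flow p c) <= ep n) (fun n => HD (ep n) (Hep n))) as (c & Hc).
  destruct (cluster_between x y (fun n => Flow p (c n))) as (e & He & Hbe & Hcl).
  { intros n; now apply Xw_Phi. }
  { intros n; apply Flow_between; auto using Xw_Lin; apply Hc. }
  exists e; split; [split; [auto|]|split; [auto|]].
  - assert (forall j, In j (tbox d q) -> V P e j = 0) as Hv.
    { intros j Hj. apply NNPP; intros Hne. set (a := Rabs (V P e j)).
      assert (0 < a) as Ha by now apply Rabs_pos_lt. pose proof (Kc_pos P) as HK.
      destruct (archimed_cor1 (a^2 / 4)) as (N & HN & HN0); [assert (0 < a^2) by (apply pow_lt; auto); lra|].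
      destruct (Hcl (a / (2 * Kc P)) ltac:(apply Rdiv_lt_0_compat; lra) N) as (n & Hn & Hcn).
      pose proof (V_lip P e (Flow p (c n)) _ Hcn j) as Hl.
      replace (Kc P * (a / (2 * Kc P))) with (a / 2) in Hl by (field; lra).
      destruct (Hc n) as (_ & Hd).
      assert ((V P (Flow p (c n)) j)^2 <= ep n) as H2.
      { eapply Rle_trans; [|exact Hd]. apply (lsum_mem_le (fun j => (V P (Flow p (c n)) j)^2)); [intros; apply pow2_ge_0|auto]. }
      assert (a / 2 <= Rabs (V P (Flow p (c n)) j)) as H3.
      { unfold a in *. revert Hl. unfold Rabs; repeat destruct Rcase_abs; lra. }
      assert ((a / 2)^2 <= (Rabs (V P (Flow p (c n)) j))^2) as H4 by (apply pow_incr; lra).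
      rewrite pow2_abs in H4.
      assert (ep n <= / INR N) by (apply Rinv_le_contravar; [apply lt_0_INR; lia|apply le_INR; lia]).
      replace ((a / 2)^2) with (a^2 / 4) in H4 by field. lra. }
    intros i. pose proof (Zperiodic_red q (gradW P e) i period_pos (gradW_periodic P w q e Hq (Xw_perq e He))) as E.
    unfold V. rewrite E. apply (Hv (zred q i)), zred_in, period_pos.
  - intros eps Heps. destruct (Hcl eps Heps 0%nat) as (n & _ & Hn). exists (c n); split; [apply Hc|auto].
Qed.

Lemma tends_to_unique z e e' : tends_to z e -> tends_to z e' -> e = e'.
Proof.
  intros H H'. apply functional_extensionality; intros i. apply NNPP; intros Hne.
  assert (0 < Rabs (e i - e' i)) as Hp by (apply Rabs_pos_lt; lra).
  destruct (H (Rabs (e i - e' i) / 4) ltac:(lra)) as (t & Ht & Hc).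
  destruct (H' (Rabs (e i - e' i) / 4) ltac:(lra)) as (t' & Ht' & Hc').
  specialize (Hc (Rmax t t') (Rmax_l _ _) i). specialize (Hc' (Rmax t t') (Rmax_r _ _) i).
  revert Hp Hc Hc'. unfold Rabs; repeat destruct Rcase_abs; lra.
Qed.

(* If both ends attract, the segment from [x] to [y] leaves the basin of [x] at a point in
   neither basin, whose omega-limit set contains a third equilibrium. *)
Lemma mountain_pass x y : equilibrium x -> equilibrium y -> (forall i, x i <= y i) -> x <> y ->
  attracting x y x -> attracting x y y ->
  exists e, equilibrium e /\ between x y e /\ e <> x /\ e <> y.
Proof.
  intros Hx Hy Hxy Hne Ax Ay.
  set (ga := fun th i => x i + th * (y i - x i)).
  assert (forall th, 0 <= th <= 1 -> between x y (ga th)) as Hgb.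
  { intros th Hth i. unfold ga. specialize (Hxy i). nra. }
  assert (forall th, Xw w (ga th)) as HgX.
  { intros th. apply Xw_segment; [apply Hx|apply Hy]. }
  set (G := T y - T x).
  assert (0 < G) as HG by (unfold G; pose proof (Xw_total_lt x y (proj1 Hx) (proj1 Hy) Hxy Hne); lra).
  assert (forall a b i, Rabs (ga a i - ga b i) <= Rabs (a - b) * G) as Hgc.
  { intros a b i. unfold ga. replace (x i + a * (y i - x i) - (x i + b * (y i - x i))) with ((a - b) * (y i - x i)) by ring.
    rewrite Rabs_mult. apply Rmult_le_compat_l; [apply Rabs_pos|]. rewrite Rabs_right by (specialize (Hxy i); lra).
    apply Xw_gap; auto; [apply Hx|apply Hy]. }
  assert (forall e th, attracting x y e -> 0 <= th <= 1 ->
    (forall eps, 0 < eps -> exists t, 0 <= t /\ forall i, Rabs (Flow (ga th) t i - e i) <= eps) ->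
    exists dl, 0 < dl /\ forall th', 0 <= th' <= 1 -> Rabs (th' - th) < dl -> tends_to (ga th') e) as Hop.
  { intros e th Ae Hth Hc. destruct (basin_open x y e (ga th) Hx Hy Ae (HgX th) (Hgb th Hth) Hc) as (dl & Hd & Hb).
    exists (dl / G); split; [now apply Rdiv_lt_0_compat|]. intros th' Hth' Hcl. apply Hb; auto.
    intros i. eapply Rle_trans; [apply Hgc|]. apply Rle_trans with (dl / G * G); [apply Rmult_le_compat_r; lra|].
    right; field; lra. }
  assert (ga 0 = x) as G0 by (apply functional_extensionality; intros; unfold ga; ring).
  assert (ga 1 = y) as G1 by (apply functional_extensionality; intros; unfold ga; ring).
  assert (forall e, equilibrium e -> tends_to e e) as Hself.
  { intros e (He & Ve) eps Heps. exists 0; split; [lra|]. intros t _ i.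
    rewrite (Phi_equilibrium P w e t (Xw_Lin w e He) Ve). rewrite Rabs_minus_self; lra. }
  (* At the supremum [th] of [A], a limit point [x] would extend the basin past [th], or put [y]
     into it when [th = 1]; a limit point [y] would attract parameters of [A] just below [th]. *)
  set (A := fun th => 0 <= th <= 1 /\ tends_to (ga th) x).
  destruct (completeness A) as (th & H1 & H2).
  { exists 1. intros a (Ha & _); lra. }
  { exists 0. split; [lra|]. rewrite G0. now apply Hself. }
  assert (0 <= th <= 1) as Hth.
  { split; [apply H1; split; [lra|rewrite G0; now apply Hself]|]. apply H2. intros a (Ha & _); lra. }
  destruct (omega_limit_equilibrium x y (ga th) Hx Hy (HgX th) (Hgb th Hth)) as (e & He & Hbe & Hc).
  exists e; split; [auto|split; [auto|split]]; intros ->.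
  - destruct (Hop x th Ax Hth Hc) as (dl & Hd & Ho).
    destruct (Rle_lt_or_eq_dec th 1 (proj2 Hth)) as [Hlt|E].
    + set (th' := th + Rmin (dl / 2) (1 - th)).
      assert (0 < Rmin (dl / 2) (1 - th)) as Hp by (apply Rmin_pos; lra).
      pose proof (Rmin_l (dl / 2) (1 - th)). pose proof (Rmin_r (dl / 2) (1 - th)).
      assert (th' <= th); [|unfold th' in *; lra]. apply H1. split; [unfold th'; lra|].
      apply Ho; [unfold th'; lra|]. unfold th'. apply Rabs_def1; lra.
    + apply Hne. rewrite <- G1. apply (tends_to_unique (ga 1)); [|rewrite G1 at 1 2; now apply Hself].
      rewrite <- E. apply Ho; [auto|]. rewrite Rabs_minus_self; auto.
  - destruct (Hop y th Ay Hth Hc) as (dl & Hd & Ho).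
    assert (exists a, A a /\ th - dl < a) as (a & (Ha & Hax) & Hlt).
    { apply NNPP; intros Hn. assert (th <= th - dl); [|lra]. apply H2. intros a Ha.
      apply Rnot_lt_le; intros Hlt; apply Hn; eauto. }
    assert (a <= th) as Hath by (apply H1; split; auto).
    apply Hne. apply (tends_to_unique (ga a)); [auto|]. apply Ho; [auto|]. apply Rabs_def1; lra.
Qed.

Lemma ordered_orbit_exists x y : equilibrium x -> equilibrium y -> (forall i, x i <= y i) -> x <> y ->
  exists p, ordered_orbit x y p /\ p <> x /\ p <> y.
Proof.
  intros Hx Hy Hxy Hne.
  destruct (classic (exists e, equilibrium e /\ between x y e /\ e <> x /\ e <> y)) as [(e & (He & Ve) & Hb & Hex & Hey)|Hno].
  (* A third equilibrium is itself a constant ordered orbit, so from here on monotone orbits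
     converge to [x] or to [y]. *)
  { exists e; split; [|auto]. split; [auto|]. assert (forall t, Flow e t = e) as E by (intros; apply Phi_equilibrium; auto using Xw_Lin).
    split; [intros t; now rewrite E|]. intros s t; rewrite !E; left; intros; lra. }
  pose proof (Xw_total_lt x y (proj1 Hx) (proj1 Hy) Hxy Hne) as HT.
  set (c := (T x + T y) / 2).
  assert (forall s, T x < s < T y -> exists z, (Xw w z /\ one_signed z /\ between x y z /\ T z = s) /\ (tends_to z x \/ tends_to z y)) as Hsl.
  { intros s Hs. destruct (slice_minimizer x y s Hx Hy Hxy Hne ltac:(lra)) as (z & Hz & Hb & HTz & Ho).
    exists z; split; [auto|].
    destruct (one_signed_converges x y z Hz Ho) as (e & He & Hbe & Ht).
    - intros t Ht; apply Flow_between; auto using Xw_Lin.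
    - destruct (classic (e = x)) as [->|N1]; [now left|]. destruct (classic (e = y)) as [->|N2]; [now right|].
      exfalso; apply Hno; eauto. }
  assert (forall e p, c <> T e -> ordered_orbit x y p -> T p = c -> p <> e) as Hpe by (intros e p H1 H2 H3 ->; auto).
  (* If nothing strictly inside tends to [x], slice minimizers close to [x] climb to [y] through the
     middle height [c], and [limit_orbit] applies at [x]; symmetrically at [y]. Otherwise both ends
     attract. *)
  destruct (classic (exists z, Xw w z /\ between x y z /\ T x < T z < T y /\ tends_to z x)) as [(z1 & Hz1 & Hb1 & HT1 & Ht1)|NX].
  - destruct (classic (exists z, Xw w z /\ between x y z /\ T x < T z < T y /\ tends_to z y)) as [(z2 & Hz2 & Hb2 & HT2 & Ht2)|NY].
    + exfalso. apply Hno. apply mountain_pass; auto.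
      * apply (attracting_lower x y z1); auto. intros ->; lra.
      * apply (attracting_upper x y z2); auto. intros ->; lra.
    + destruct (limit_orbit x y y c Hx Hy Hy) as (p & Hp & Hpc); [unfold c; lra| |].
      (* The quarter keeps the starting height above [c], which the descending orbit must then
         cross. *)
      * intros eps He. set (s := T y - Rmin eps ((T y - T x) / 4)).
        assert (0 < Rmin eps ((T y - T x) / 4)) by (apply Rmin_pos; lra).
        pose proof (Rmin_l eps ((T y - T x) / 4)). pose proof (Rmin_r eps ((T y - T x) / 4)).
        destruct (Hsl s) as (z & (Hz & Ho & Hb & HTz) & Hlim); [unfold s; lra|].
        exists z. split; [split; [auto|split; [auto|split; [auto|]]]|].
        -- intros i. pose proof (Xw_gap z y Hz (proj1 Hy) (fun i => proj2 (Hb i)) i). specialize (Hb i).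
           rewrite HTz in *. apply Rabs_le; unfold s in *; lra.
        -- destruct Hlim as [Hl|Hl]; [|exfalso; apply NY; exists z; rewrite HTz; repeat split; auto; try apply Hb; unfold s; lra].
           apply (level_reached z x); auto; [apply Hx|]. rewrite HTz. unfold s, c. rewrite Rmin_right, Rmax_left; lra.
      * exists p; split; [auto|split; apply Hpe; auto; unfold c; lra].
  - destruct (limit_orbit x y x c Hx Hy Hx) as (p & Hp & Hpc); [unfold c; lra| |].
    * intros eps He. set (s := T x + Rmin eps ((T y - T x) / 4)).
      assert (0 < Rmin eps ((T y - T x) / 4)) by (apply Rmin_pos; lra).
      pose proof (Rmin_l eps ((T y - T x) / 4)). pose proof (Rmin_r eps ((T y - T x) / 4)).
      destruct (Hsl s) as (z & (Hz & Ho & Hb & HTz) & Hlim); [unfold s; lra|].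
      exists z. split; [split; [auto|split; [auto|split; [auto|]]]|].
      -- intros i. pose proof (Xw_gap x z (proj1 Hx) Hz (fun i => proj1 (Hb i)) i). specialize (Hb i).
         rewrite HTz in *. apply Rabs_le; unfold s in *; lra.
      -- destruct Hlim as [Hl|Hl]; [exfalso; apply NX; exists z; rewrite HTz; repeat split; auto; try apply Hb; unfold s; lra|].
         apply (level_reached z y); auto; [apply Hy|]. rewrite HTz. unfold s, c. rewrite Rmin_left, Rmax_right; lra.
    * exists p; split; [auto|split; apply Hpe; auto; unfold c; lra].
Qed.

End Heteroclinic.

(** * Maximal invariant chains *)

(** [tau] is a height that controls coordinatewise differences, so an element of nearly maximal
    height is uniformly close to the coordinatewise supremum. The abstract form also serves for
    infima, after a change of sign. *)
Lemma chain_supremum {I : Type} (K : (I -> R) -> Prop) (tau : (I -> R) -> R) c :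
  (exists a, K a) -> (forall a, K a -> tau a <= c) ->
  (forall a a', K a -> K a' -> forall i, a' i - a i <= Rmax 0 (tau a' - tau a)) ->
  exists x, (forall a, K a -> forall i, a i <= x i) /\
    forall e, 0 < e -> exists a, K a /\ forall i, Rabs (a i - x i) <= e.
Proof.
  intros (a0 & Ha0) Hc Hgap.
  assert (forall i, exists m, is_lub (fun r => exists a, K a /\ r = a i) m) as Hlub.
  { intros i. destruct (completeness (fun r => exists a, K a /\ r = a i)) as (m & Hm); [| |eauto].
    - exists (a0 i + Rmax 0 (c - tau a0)). intros r (a & Ha & ->).
      pose proof (Hgap a0 a Ha0 Ha i). specialize (Hc a Ha).
      assert (Rmax 0 (tau a - tau a0) <= Rmax 0 (c - tau a0)) by (apply Rle_max_compat_l; lra). lra.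
    - eauto. }
  destruct (choice_fun _ Hlub) as (x & Hx).
  assert (forall a, K a -> forall i, a i <= x i) as Hub by (intros a Ha i; apply (Hx i); eauto).
  exists x; split; [auto|]. intros e He.
  destruct (completeness (fun r => exists a, K a /\ r = tau a)) as (s & Hs1 & Hs2).
  { exists c. intros r (a & Ha & ->); auto. }
  { eauto. }
  assert (exists a, K a /\ s - e < tau a) as (a & Ha & Hlt).
  { apply NNPP; intros Hn. assert (s <= s - e); [|lra]. apply Hs2. intros r (a & Ha & ->).
    apply Rnot_lt_le; intros Hlt; eauto. }
  exists a; split; [auto|]. intros i. rewrite Rabs_minus_sym, Rabs_right by (specialize (Hub a Ha i); lra).
  assert (x i <= a i + e); [|lra]. apply (Hx i). intros r (a' & Ha' & ->).
  pose proof (Hgap a a' Ha Ha' i). assert (tau a' <= s) by (apply Hs1; eauto).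
  assert (Rmax 0 (tau a' - tau a) <= e) by (apply Rmax_lub; lra). lra.
Qed.

Section GhostCircle.
Context {d : nat}.
Variable P : LocalPotentials d.
Variable w : Vector.t Q d.
Variable q : nat.
Hypothesis Hq : integral_period w q.
Variable m : config d.
Hypothesis Hm : minimizes P w q m.

Notation Flow := (Phi P w).
Notation T := (total q).

Definition invariant_chain (A : config d -> Prop) : Prop :=
  (forall x, A x -> Xw w x) /\ (forall x y, A x -> A y -> comparable x y) /\
  (forall x t, A x -> A (Flow x t)) /\ (forall x k l, A x -> A (tau k l x)).

Lemma invariant_chain_ext (A B : config d -> Prop) : (forall x, A x <-> B x) -> invariant_chain A -> invariant_chain B.
Proof.
  intros E (H1 & H2 & H3 & H4). split; [|split; [|split]].
  - intros x Hx; apply H1, E, Hx.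
  - intros x y Hx Hy; apply H2; apply E; auto.
  - intros x t Hx; apply E, H3, E, Hx.
  - intros x k l Hx; apply E, H4, E, Hx.
Qed.

Definition translates (x : config d) : Prop := exists k l, x = tau k l m.

Lemma translates_chain : invariant_chain translates.
Proof.
  pose proof (minimizer_Xw P w q m Hq Hm) as Hmx.
  split; [|split; [|split]].
  - intros x (k & l & ->). now apply Xw_tau.
  - intros x y (k & l & ->) (k' & l' & ->). unfold comparable.
    apply (minimizers_comparable P w q); auto; now apply minimizes_tau.
  - intros x t (k & l & ->). rewrite Phi_equilibrium; [now exists k, l| |].
    + now apply Lin_tau, Xw_Lin.
    + apply (minimizer_critical P w q); auto. now apply minimizes_tau.
  - intros x k l (k' & l' & ->). exists (zadd k k'), (l + l')%Z. apply tau_tau.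
Qed.

Lemma maximal_chain_exists : exists A, invariant_chain A /\ A m /\
  forall B, invariant_chain B -> (forall x, A x -> B x) -> forall x, B x -> A x.
Proof.
  (* Zorn is applied to sets whose union with the translates of [m] is an invariant chain: this
     builds [m] into the maximal element and makes the union of an empty family admissible. *)
  destruct (@classical_sets.Zorn_bigcup (config d) (fun A => invariant_chain (fun x => A x \/ translates x)))
    as (A & HA & Hmax).
  - intros F HF Htot.
    assert (forall x y, (classical_sets.bigcup F (fun X => X) x \/ translates x) ->
      (classical_sets.bigcup F (fun X => X) y \/ translates y) ->
      exists X : config d -> Prop, invariant_chain X /\ X x /\ X y /\
        forall z, X z -> classical_sets.bigcup F (fun X => X) z \/ translates z) as H.
    { intros x y [[X HX Hx]|Hx] [[Y HY Hy]|Hy].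
      - destruct (Htot X Y HX HY) as [Hs|Hs].
        + exists (fun x => Y x \/ translates x). split; [now apply HF|split; [left; now apply Hs|split; [now left|]]].
          intros z [Hz|Hz]; [left; now exists Y|now right].
        + exists (fun x => X x \/ translates x). split; [now apply HF|split; [now left|split; [left; now apply Hs|]]].
          intros z [Hz|Hz]; [left; now exists X|now right].
      - exists (fun x => X x \/ translates x). split; [now apply HF|split; [now left|split; [now right|]]].
        intros z [Hz|Hz]; [left; now exists X|now right].
      - exists (fun x => Y x \/ translates x). split; [now apply HF|split; [now right|split; [now left|]]].
        intros z [Hz|Hz]; [left; now exists Y|now right].
      - exists translates. split; [apply translates_chain|auto]. }
    split; [|split; [|split]].
    + intros x Hx. destruct (H x x Hx Hx) as (X & HX & Hx' & _). now apply HX.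
    + intros x y Hx Hy. destruct (H x y Hx Hy) as (X & HX & Hx' & Hy' & _). now apply HX.
    + intros x t Hx. destruct (H x x Hx Hx) as (X & HX & Hx' & _ & Hz). now apply Hz, HX.
    + intros x k l Hx. destruct (H x x Hx Hx) as (X & HX & Hx' & _ & Hz). now apply Hz, HX.
  - exists (fun x => A x \/ translates x). split; [auto|split].
    + right. exists zz, 0%Z. apply functional_extensionality; intros i. unfold tau.
      replace (zadd i zz) with i by zvec. ring.
    + intros B HB Hsub x Hx. apply NNPP; intros Hn. apply (Hmax B).
      * split; [intros z Hz; apply Hsub; now left|]. intros Hs. apply Hn; left; now apply Hs.
      * apply (invariant_chain_ext B); [|auto]. intros z; split; [now left|].
        intros [Hz|Hz]; [auto|apply Hsub; now right].
Qed.

(** * Properties of a maximal invariant chain *)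

Section Maximal.
Variable A : config d -> Prop.
Hypothesis HA : invariant_chain A.
Hypothesis Am : A m.
Hypothesis Amax : forall B, invariant_chain B -> (forall x, A x -> B x) -> forall x, B x -> A x.

Lemma chain_Xw x : A x -> Xw w x.
Proof. apply HA. Qed.

Lemma chain_Lin x : A x -> Lin w x.
Proof. intros; now apply Xw_Lin, chain_Xw. Qed.

Lemma chain_le x y : A x -> A y -> T x <= T y -> forall i, x i <= y i.
Proof.
  intros Hx Hy Ht. destruct (proj1 (proj2 HA) x y Hx Hy) as [H|H]; [auto|].
  rewrite (Xw_eq w q Hq y x); auto using chain_Xw. intros; lra.
Qed.

Lemma chain_gap x y : A x -> A y -> forall i, y i - x i <= Rmax 0 (T y - T x).
Proof.
  intros Hx Hy i. destruct (Rle_or_lt (T x) (T y)) as [H|H].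
  - eapply Rle_trans; [|apply Rmax_r]. apply (Xw_gap w q Hq); auto using chain_Xw. now apply chain_le.
  - eapply Rle_trans; [|apply Rmax_l]. pose proof (chain_le y x Hy Hx (Rlt_le _ _ H) i); lra.
Qed.

Lemma chain_lipschitz x y : A x -> A y -> forall i, Rabs (y i - x i) <= Rabs (T y - T x).
Proof.
  intros Hx Hy i. pose proof (chain_gap x y Hx Hy i) as H1. pose proof (chain_gap y x Hy Hx i) as H2.
  revert H1 H2. unfold Rmax, Rabs; repeat destruct Rle_dec; repeat destruct Rcase_abs; lra.
Qed.

(** Each clause of [invariant_chain] passes to uniform limits, so the closure is an invariant chain
    and maximality absorbs it. *)
Lemma chain_closed x : adherent A x -> A x.
Proof.
  revert x. apply Amax.
  - split; [|split; [|split]].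
    + intros x Hx. apply Xw_closed. intros e He. destruct (Hx e He) as (y & Hy & Hc).
      exists y; split; [now apply chain_Xw|auto].
    + intros x y Hx Hy. apply comparable_closed. intros e He.
      destruct (Hx e He) as (x' & Hx' & Hcx). destruct (Hy e He) as (y' & Hy' & Hcy).
      exists x', y'. split; [now apply HA|auto].
    + intros x t Hx e He. destruct (Flow_continuous P w t e He) as (dl & Hd & Hf).
      destruct (Hx dl Hd) as (y & Hy & Hc). exists (Flow y t). split; [now apply HA|].
      apply Hf; auto using chain_Lin. apply Xw_Lin, Xw_closed. intros e' He'.
      destruct (Hx e' He') as (z & Hz & Hcz). exists z; split; [now apply chain_Xw|auto].
    + intros x k l Hx e He. destruct (Hx e He) as (y & Hy & Hc). exists (tau k l y). split; [now apply HA|].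
      intros i. unfold tau. replace (y (zadd i k) + IZR l - (x (zadd i k) + IZR l)) with (y (zadd i k) - x (zadd i k)) by ring.
      apply Hc.
  - intros x Hx e He. exists x; split; [auto|]. intros i. rewrite Rabs_minus_self; lra.
Qed.

Lemma chain_total_small c : exists x, A x /\ T x < c.
Proof.
  set (L := INR (length (tbox d q))). assert (0 < L) as HL by apply length_tbox_pos, (period_pos w q Hq).
  destruct (archimed ((T m - c) / L)) as (Hu & _).
  exists (tau zz (- up ((T m - c) / L)) m). split; [now apply HA|].
  rewrite (total_tau w) by now apply (Xw_perq w q Hq), chain_Xw.
  fold L. replace (om w zz) with 0.
  - rewrite opp_IZR. apply (Rmult_gt_compat_l L) in Hu; [|auto].
    replace (L * ((T m - c) / L)) with (T m - c) in Hu by (field; lra). lra.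
  - replace (@zz d) with (zscal 0 (@zz d)) by zvec. rewrite om_scal; simpl; ring.
Qed.

Lemma chain_total_large c : exists x, A x /\ c < T x.
Proof.
  set (L := INR (length (tbox d q))). assert (0 < L) as HL by apply length_tbox_pos, (period_pos w q Hq).
  destruct (archimed ((c - T m) / L)) as (Hu & _).
  exists (tau zz (up ((c - T m) / L)) m). split; [now apply HA|].
  rewrite (total_tau w) by now apply (Xw_perq w q Hq), chain_Xw.
  fold L. replace (om w zz) with 0.
  - apply (Rmult_gt_compat_l L) in Hu; [|auto].
    replace (L * ((c - T m) / L)) with (c - T m) in Hu by (field; lra). lra.
  - replace (@zz d) with (zscal 0 (@zz d)) by zvec. rewrite om_scal; simpl; ring.
Qed.

Lemma Flow_near_0 x e : A x -> 0 < e -> exists dl, 0 < dl /\ forall t, Rabs t < dl -> Rabs (T (Flow x t) - T x) < e.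
Proof.
  intros Hx He. destruct (total_Flow_continuous P w q x (chain_Lin x Hx) 0 e He) as (dl & Hd & H).
  exists dl; split; [auto|]. intros t Ht. destruct (Req_dec t 0) as [->|Hne].
  - rewrite Phi_0 by now apply chain_Lin. rewrite Rabs_minus_self; auto.
  - specialize (H t). simpl in H. unfold Rdist in H. rewrite (Phi_0 P w x) in H by now apply chain_Lin.
    apply H. split; [split; [exact I|auto]|]. now rewrite Rminus_0_r.
Qed.

(* The ends of a gap are equilibria: for small [|t|] the orbit of an end stays on its own
   side of the gap, so each of its coordinates has a local extremum at [t = 0]. *)
Lemma gap_ends_equilibria c x y : A x -> A y -> T x < c < T y ->
  (forall a, A a -> T a < c -> forall i, a i <= x i) ->
  (forall a, A a -> c < T a -> forall i, y i <= a i) -> equilibrium P w x /\ equilibrium P w y.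
Proof.
  intros Hx Hy Hc Hlo Hhi. split; (split; [now apply chain_Xw|]); intros i.
  - destruct (Flow_near_0 x (c - T x) Hx ltac:(lra)) as (dl & Hd & Hn).
    pose proof (Phi_derivable P w x (chain_Lin x Hx) 0 i) as D. rewrite Phi_0 in D by now apply chain_Lin.
    set (pr := exist _ (V P x i) D : derivable_pt (fun s => Flow x s i) 0).
    rewrite <- (deriv_maximum _ (- dl) dl 0 pr); [reflexivity|lra|lra|].
    intros t H1 H2. rewrite (Phi_0 P w x) by now apply chain_Lin. apply Hlo; [now apply HA|].
    specialize (Hn t ltac:(apply Rabs_def1; lra)). apply Rabs_def2 in Hn; lra.
  - destruct (Flow_near_0 y (T y - c) Hy ltac:(lra)) as (dl & Hd & Hn).
    pose proof (Phi_derivable P w y (chain_Lin y Hy) 0 i) as D. rewrite Phi_0 in D by now apply chain_Lin.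
    set (pr := exist _ (V P y i) D : derivable_pt (fun s => Flow y s i) 0).
    rewrite <- (deriv_minimum _ (- dl) dl 0 pr); [reflexivity|lra|lra|].
    intros t H1 H2. rewrite (Phi_0 P w y) by now apply chain_Lin. apply Hhi; [now apply HA|].
    specialize (Hn t ltac:(apply Rabs_def1; lra)). apply Rabs_def2 in Hn; lra.
Qed.

Lemma tau_tau_inv k l (x : config d) : tau k l (tau (zscal (-1) k) (- l) x) = x.
Proof. rewrite tau_comm. apply tau_inv. Qed.

Lemma gap_filled x y p : A x -> A y -> (forall i, x i <= y i) -> x <> y ->
  (forall a, A a -> (forall i, a i <= x i) \/ (forall i, y i <= a i)) ->
  ordered_orbit P w x y p -> A p.
Proof.
  intros Hx Hy Hxy Hne Hgap (Hp & Hb & Hc).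
  assert (Lin w p) as Lp by now apply Xw_Lin.
  assert (Flow p 0 = p) as P0 by now apply Phi_0.
  pose proof (Xw_total_lt w q Hq x y (chain_Xw x Hx) (chain_Xw y Hy) Hxy Hne) as HT.
  set (O := fun z => exists k l t, z = tau k l (Flow p t)).
  assert (forall z a, O z -> A a -> comparable z a) as HOA.
  { intros z a (k & l & t & ->) Ha.
    destruct (Hgap (tau (zscal (-1) k) (- l) a)) as [H|H]; [now apply HA|right|left];
      rewrite <- (tau_tau_inv k l a); apply tau_le; intros i; specialize (H i); specialize (Hb t i); lra. }
  assert (forall s t k l, comparable (Flow p s) (tau k l (Flow p t))) as HOO.
  { intros s t k l. set (L := INR (length (tbox d q))).
    assert (0 < L) as HL by apply length_tbox_pos, (period_pos w q Hq).
    (* A translation with nonzero [om w k + IZR l] changes heights, and no element of the chain lies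
       inside the gap, so it carries the interval from [x] to [y] entirely below or above itself. A
       translation with value 0 fixes the orbit, which is ordered. *)
    destruct (Rtotal_order (om w k + IZR l) 0) as [Hneg|[H0|Hpos]].
    - right. intros i.
      assert (forall i, tau k l y i <= x i) as H.
      { destruct (Hgap (tau k l y)) as [H|H]; [now apply HA|auto|].
        exfalso. apply (total_le q) in H. rewrite (total_tau w) in H by now apply (Xw_perq w q Hq), chain_Xw.
        fold L in H. pose proof (Rmult_lt_0_compat L (- (om w k + IZR l)) HL ltac:(lra)). lra. }
      pose proof (tau_le k l _ _ (fun i => proj2 (Hb t i)) i). specialize (H i). specialize (Hb s i). lra.
    - rewrite (Xw_Phi P w p t Hp k l H0). apply Hc.
    - left. intros i.
      assert (forall i, y i <= tau k l x i) as H.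
      { destruct (Hgap (tau k l x)) as [H|H]; [now apply HA| |auto].
        exfalso. apply (total_le q) in H. rewrite (total_tau w) in H by now apply (Xw_perq w q Hq), chain_Xw.
        fold L in H. pose proof (Rmult_lt_0_compat L (om w k + IZR l) HL ltac:(lra)). lra. }
      pose proof (tau_le k l _ _ (fun i => proj1 (Hb t i)) i). specialize (H i). specialize (Hb s i). lra. }
  apply (Amax (fun z => A z \/ O z)).
  - split; [|split; [|split]].
    + intros z [Hz|(k & l & t & ->)]; [now apply chain_Xw|]. now apply Xw_tau, Xw_Phi.
    + intros z z' [Hz|Hz] [Hz'|Hz'].
      * now apply HA.
      * apply comparable_sym; auto.
      * auto.
      * destruct Hz as (k & l & s & ->). destruct Hz' as (k' & l' & t & ->).
        rewrite <- (tau_tau_inv k l (tau k' l' (Flow p t))), (tau_tau (zscal (-1) k)).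
        destruct (HOO s t (zadd (zscal (-1) k) k') (- l + l')%Z) as [H|H]; [left|right]; now apply tau_le.
    + intros z t [Hz|(k & l & s & ->)]; [left; now apply HA|right]. exists k, l, (t + s).
      rewrite Phi_tau by now apply Phi_Lin. now rewrite Phi_add.
    + intros z k l [Hz|(k' & l' & s & ->)]; [left; now apply HA|right].
      exists (zadd k k'), (l + l')%Z, s. apply tau_tau.
  - auto.
  - right. exists zz, 0%Z, 0. rewrite P0. apply functional_extensionality; intros i. unfold tau.
    replace (zadd i zz) with i by zvec. ring.
Qed.

Lemma chain_level c : exists x, A x /\ T x = c.
Proof.
  apply NNPP; intros Hno.
  assert (forall a, A a -> T a <> c) as Hnc by (intros a Ha E; eauto).
  destruct (chain_supremum (fun a => A a /\ T a < c) T c) as (x & Hxu & Hxa).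
  { destruct (chain_total_small c) as (a & Ha & Hc); eauto. }
  { intros a (_ & Ha); lra. }
  { intros a a' (Ha & _) (Ha' & _); now apply chain_gap. }
  (* The infimum of the part of the chain above [c], obtained as a supremum after changing signs. *)
  destruct (chain_supremum (fun a => A (fun i => - a i) /\ c < T (fun i => - a i)) (fun a => - T (fun i => - a i)) (- c)) as (y' & Hyu & Hya).
  { destruct (chain_total_large c) as (a & Ha & Hc). exists (fun i => - a i).
    replace (fun i => - - a i) with a; [auto|]. apply functional_extensionality; intros; ring. }
  { intros a (_ & Ha); lra. }
  { intros a a' (Ha & _) (Ha' & _) i. pose proof (chain_gap _ _ Ha' Ha i) as H. cbv beta in H.
    replace (- T (fun i => - a' i) - - T (fun i => - a i)) with (T (fun i => - a i) - T (fun i => - a' i)) by ring. lra. }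
  set (y := fun i => - y' i).
  assert (forall a, A a -> c < T a -> forall i, y i <= a i) as Hyl.
  { intros a Ha Hc i. specialize (Hyu (fun i => - a i)). cbv beta in Hyu.
    replace (fun i => - - a i) with a in Hyu by (apply functional_extensionality; intros; ring).
    specialize (Hyu (conj Ha Hc) i). unfold y; lra. }
  assert (forall e, 0 < e -> exists a, (A a /\ c < T a) /\ forall i, Rabs (a i - y i) <= e) as Hya'.
  { intros e He. destruct (Hya e He) as (a & Ha & Hc). exists (fun i => - a i). split; [auto|].
    intros i. unfold y. replace (- a i - - y' i) with (- (a i - y' i)) by ring. rewrite Rabs_Ropp; auto. }
  assert (A x) as Hx by (apply chain_closed; intros e He; destruct (Hxa e He) as (a & (Ha & _) & Hc); eauto).
  assert (A y) as Hy by (apply chain_closed; intros e He; destruct (Hya' e He) as (a & (Ha & _) & Hc); eauto).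
  assert (T x < c) as Tx.
  { assert (T x <= c) as [|H]; [|auto|now apply Hnc in H]. apply (total_approx w q Hq). intros e He.
    destruct (Hxa e He) as (a & (_ & Ha) & Hc); exists a; split; [auto|lra]. }
  assert (c < T y) as Ty.
  { assert (c <= T y) as [|H]; [|auto|now apply eq_sym, Hnc in H]. apply (total_approx_ge w q Hq). intros e He.
    destruct (Hya' e He) as (a & (_ & Ha) & Hc); exists a; split; [auto|lra]. }
  assert (forall i, x i <= y i) as Hxy by (apply chain_le; auto; lra).
  assert (x <> y) as Hne by (intros E; rewrite E in Tx; lra).
  assert (forall a, A a -> (forall i, a i <= x i) \/ (forall i, y i <= a i)) as Hgap.
  { intros a Ha. destruct (Rtotal_order (T a) c) as [H|[H|H]]; [left; auto|now apply Hnc in H|right; auto]. }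
  destruct (gap_ends_equilibria c x y Hx Hy (conj Tx Ty) (fun a Ha Hc => Hxu a (conj Ha Hc)) Hyl) as (Ex & Ey).
  destruct (ordered_orbit_exists P w q Hq x y Ex Ey Hxy Hne) as (p & Hp & Npx & Npy).
  pose proof (gap_filled x y p Hx Hy Hxy Hne Hgap Hp) as Ap.
  destruct Hp as (_ & Hb & _). specialize (Hb 0). rewrite Phi_0 in Hb by now apply chain_Lin.
  destruct (Hgap p Ap) as [H|H].
  - apply Npx, functional_extensionality; intros i. specialize (H i); specialize (Hb i); lra.
  - apply Npy, functional_extensionality; intros i. specialize (H i); specialize (Hb i); lra.
Qed.

(** Periodicity of a pointwise limit involves two sites at a time; once it is known, closeness on
    one period is uniform and [chain_closed] applies. *)
Lemma chain_pw_closed : pw_closed A.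
Proof.
  intros x Hx. apply chain_closed.
  assert (per w q x) as Hp.
  { intros i v. apply NNPP; intros Hne.
    set (j := zadd i (zscal (Z.of_nat q) v)) in *.
    assert (0 < Rabs (x j - om w j - (x i - om w i))) as Hpos by (apply Rabs_pos_lt; lra).
    destruct (Hx [i; j] (Rabs (x j - om w j - (x i - om w i)) / 4)) as (y & Hy & Hc); [lra|].
    pose proof (Hc i (or_introl eq_refl)) as H1. pose proof (Hc j (or_intror (or_introl eq_refl))) as H2.
    pose proof (Xw_perq w q Hq y (chain_Xw y Hy) i v) as E. cbv beta in E. fold j in E.
    revert H1 H2 Hpos. unfold Rabs; repeat destruct Rcase_abs; lra. }
  intros e He. destruct (Hx (tbox d q) e He) as (y & Hy & Hc). exists y; split; [auto|].
  apply (per_close w q x y e (period_pos w q Hq) Hp (Xw_perq w q Hq y (chain_Xw y Hy))).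
  intros i Hi; left; now apply Hc.
Qed.

Lemma chain_connected : pw_connected A.
Proof.
  intros U V0 HU HV Hcov Hdis.
  destruct (classic (forall x, ~ (A x /\ U x))) as [|NU]; [now left|].
  destruct (classic (forall x, ~ (A x /\ V0 x))) as [|NV]; [now right|exfalso].
  apply not_all_not_ex in NU as (u & Au & Uu). apply not_all_not_ex in NV as (v & Av & Vv).
  (* [ga] inverts the height on the chain, and by [chain_lipschitz] it is 1-Lipschitz at every
     site. *)
  destruct (choice_fun _ chain_level) as (ga & Hga).
  assert (forall x, A x -> ga (T x) = x) as Hid.
  { intros x Hx. destruct (Hga (T x)) as (H1 & H2). apply (Xw_eq w q Hq); auto using chain_Xw.
    - apply chain_le; auto; lra.
    - lra. }
  (* Locally constant, since [U] and [V0] pull back to disjoint open sets covering the line. If both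
     were nonempty, the intermediate value theorem would give it a zero, but its values are 1 and
     -1. *)
  set (f := fun c => if excluded_middle_informative (U (ga c)) then 1 else -1).
  assert (continuity f) as Hf.
  { intros c e He. destruct (Hga c) as (Ac & Tc).
    assert (exists dl, 0 < dl /\ forall c', Rabs (c' - c) < dl -> f c' = f c) as (dl & Hd & H).
    { destruct (Hcov (ga c) Ac) as [Hc|Hc].
      - destruct (HU _ Hc) as (Ls & dl & Hd & Hn). exists dl; split; [auto|]. intros c' Hc'.
        unfold f. destruct excluded_middle_informative as [_|N1], excluded_middle_informative as [_|N2]; try tauto.
        exfalso; apply N1, Hn. intros i _. destruct (Hga c') as (Ac' & Tc').
        eapply Rle_lt_trans; [now apply chain_lipschitz|]. rewrite Tc, Tc'. auto.
      - destruct (HV _ Hc) as (Ls & dl & Hd & Hn). exists dl; split; [auto|]. intros c' Hc'.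
        assert (V0 (ga c')) as Vc'.
        { apply Hn. intros i _. destruct (Hga c') as (Ac' & Tc').
          eapply Rle_lt_trans; [now apply chain_lipschitz|]. rewrite Tc, Tc'. auto. }
        unfold f. destruct excluded_middle_informative as [U1|_]; [exfalso; apply (Hdis (ga c')); split; [apply Hga|auto]|].
        destruct excluded_middle_informative as [U2|_]; [exfalso; apply (Hdis (ga c)); split; [apply Hga|auto]|reflexivity]. }
    exists dl; split; [auto|]. intros c' (_ & Hc'). simpl in Hc' |- *. unfold Rdist in *.
    rewrite (H c' Hc'). rewrite Rabs_minus_self; auto. }
  destruct (IVT_gen f (T u) (T v) 0 Hf) as (c & _ & Hc).
  - unfold f. rewrite !Hid by auto. destruct (excluded_middle_informative (U u)); [|tauto].
    destruct (excluded_middle_informative (U v)); [exfalso; apply (Hdis v); auto|].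
    unfold Rmin, Rmax; repeat destruct Rle_dec; lra.
  - unfold f in Hc. destruct excluded_middle_informative; lra.
Qed.

(** The chain contains the positions at time -1, which are comparable; flowing forward for one unit
    of time makes the order strict. *)
Lemma chain_strictly_ordered : strictly_ordered A.
Proof.
  assert (forall x y, A x -> A y -> (forall i, x i <= y i) -> x <> y -> forall i, x i < y i) as H.
  { intros x y Hx Hy Hxy Hne.
    assert (forall z, A z -> Flow (Flow z (-1)) 1 = z) as Hback.
    { intros z Hz. rewrite Phi_add by now apply chain_Lin. replace (1 + -1) with 0 by ring. now apply Phi_0, chain_Lin. }
    assert (A (Flow x (-1)) /\ A (Flow y (-1))) as (Ax & Ay) by (split; now apply HA).
    assert (Flow x (-1) <> Flow y (-1)) as Hne'.
    { intros E. apply Hne. now rewrite <- (Hback x Hx), <- (Hback y Hy), E. }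
    rewrite <- (Hback x Hx), <- (Hback y Hy).
    apply Phi_strong; auto using chain_Lin; [|lra].
    destruct (proj1 (proj2 HA) _ _ Ax Ay) as [Hle|Hle]; [auto|exfalso].
    apply Hne, functional_extensionality; intros i.
    pose proof (Phi_mono P w _ _ 1 (chain_Lin _ Ay) (chain_Lin _ Ax) Hle ltac:(lra) i) as Hr.
    rewrite !Hback in Hr by auto. specialize (Hxy i); lra. }
  intros x y Hx Hy. destruct (classic (x = y)) as [|Hne]; [auto|].
  destruct (proj1 (proj2 HA) x y Hx Hy) as [Hle|Hle]; [left|right; right]; auto.
Qed.

(** Uniqueness in X covers an arbitrary flow line [g], which is not assumed to stay near the linear
    configuration. *)
Lemma chain_flow_invariant : flow_invariant P A.
Proof.
  intros x Hx. split.
  - exists (Flow x). split; [now apply Phi_flow, chain_Lin|now apply Phi_0, chain_Lin].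
  - intros g Hg H0 t. rewrite <- (Phi_unique P w g x t Hg H0 (chain_Lin x Hx)). now apply HA.
Qed.

Lemma Lin_rotation x : Lin w x -> has_rotation_vector w x.
Proof.
  intros (M & HM) i e He. change (Q2R (dotQ w i)) with (om w i).
  destruct (INR_unbounded (Rabs M / e)) as (N & HN). exists (Datatypes.S N). intros n Hn.
  assert (0 < INR n) as Hn0 by (apply lt_0_INR; lia).
  assert (INR N <= INR n) as HNn by (apply le_INR; lia).
  specialize (HM (zscal (Z.of_nat n) i)). rewrite om_scal, <- INR_IZR_INZ in HM. unfold Rdist.
  replace (x (zscal (Z.of_nat n) i) / INR n - om w i) with ((x (zscal (Z.of_nat n) i) - INR n * om w i) / INR n)
    by (field; lra).
  unfold Rdiv. rewrite Rabs_mult, (Rabs_right (/ INR n)) by (left; now apply Rinv_0_lt_compat).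
  apply Rmult_lt_reg_r with (INR n); [auto|]. rewrite Rmult_assoc, Rinv_l by lra.
  apply (Rmult_gt_compat_r e) in HN; [|auto]. replace (Rabs M / e * e) with (Rabs M) in HN by (field; lra).
  pose proof (Rle_abs M). assert (e * INR N <= e * INR n) by (apply Rmult_le_compat_l; lra). lra.
Qed.

Lemma chain_Bbar x : A x -> Bbar w x.
Proof.
  intros Hx. split; [|split].
  - intros k l. destruct (proj1 (proj2 HA) x (tau k l x) Hx) as [H|H]; [now apply HA|left|right]; intros i; specialize (H i); lra.
  - now apply Lin_rotation, chain_Lin.
  - intros k l E i. apply dotQ_zero in E. now rewrite (chain_Xw x Hx k l E).
Qed.

Lemma chain_ghost_circle : ghost_circle P A.
Proof.
  split; [now exists m|]. split; [apply chain_pw_closed|]. split; [apply chain_connected|].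
  split; [apply chain_strictly_ordered|]. split; [intros; now apply HA|apply chain_flow_invariant].
Qed.

End Maximal.
End GhostCircle.

Theorem mainTheorem17 (d : nat) (P : LocalPotentials d) (w : Vector.t Q d) :
  exists G : config d -> Prop,
    ghost_circle P G /\ (forall x, G x -> Bbar w x) /\
    (exists x, G x /\ global_minimizer P x).
Proof.
  destruct (integral_period_exists w) as (q & Hq).
  destruct (minimizer_exists P w q Hq) as (m & Hm).
  destruct (maximal_chain_exists P w q Hq m Hm) as (A & HA & Am & Amax).
  exists A. split; [now apply (chain_ghost_circle P w q Hq m)|split].
  - intros x. now apply (chain_Bbar P w A HA).
  - exists m. split; [auto|]. now apply (minimizer_global P w q).
Qed.
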